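(* There does not exist an $\mathrm{Out}^0(W_4)$-equivariant piecewise Euclidean $\mathrm{CAT}(0)$ metric on McCullough–Miller space $K_4$, nor an $\mathrm{Out}^0(W_4)$-equivariant piecewise hyperbolic $\mathrm{CAT}(-1)$ metric on $K_4$.
   Context: $W_n=\langle a_1,\dots,a_n\mid a_i^2=1\rangle$, $[n]=\{1,\dots,n\}$. For $i\in[n]$ and nonempty $D\subseteq[n]\setminus\{i\}$, the partial conjugation $x_{i,D}$ sends $a_j\mapsto a_ia_ja_i$ for $j\in D$ and fixes the other generators. $\mathrm{Out}^0(W_n)=\mathrm{Aut}^0(W_n)/\mathrm{Inn}(W_n)$ where $\mathrm{Aut}^0(W_n)$ consists of automorphisms sending each $a_j$ to a conjugate of itself. Hypertrees: a hypertree on $[n]$ is a set of subsets (hyperedges) of $[n]$ of size $\ge2$ such that any two vertices are joined by a unique simple walk (alternating sequence of distinct vertices and distinct hyperedges, consecutive vertices in the intervening hyperedge); $\mathcal{HT}_n$ is the set of them. $\Theta\le\Lambda$ if $\Theta$ is obtained from $\Lambda$ by finitely many folds (a fold replaces two intersecting distinct hyperedges by their union). $\Theta$ carries $x_{i,D}$ if for every $d\in D$, $j\in[n]\setminus(D\cup\{i\})$ the simple walk from $d$ to $j$ visits $i$; $\alpha\in\mathrm{Out}^0(W_n)$ is carried by $\Theta$ if it is a product of partial conjugations carried by $\Theta$. McCullough–Miller space: on $\mathrm{Out}^0(W_n)\times\mathcal{HT}_n$ set $(\alpha,\Theta)\sim(\beta,\Lambda)$ iff $\Theta=\Lambda$ and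 $\alpha^{-1}\beta$ is carried by $\Theta$; write $[\alpha,\Theta]$ for classes. Order: $[\alpha,\Theta]\le[\beta,\Lambda]$ iff $\Theta\le\Lambda$ and $\alpha^{-1}\beta$ is carried by $\Lambda$. $K_n$ is the simplicial realization (order complex) of this poset. $\mathrm{Out}^0(W_n)$ acts by simplicial automorphisms via $\varphi\cdot[\alpha,\Theta]=[\varphi\alpha,\Theta]$. A piecewise Euclidean (resp. hyperbolic) metric on $K_n$ means: each simplex is metrized as a geodesic simplex in Euclidean space (resp. hyperbolic space), face inclusions are isometries, and $K_n$ carries the induced length metric. It is $G$-equivariant if $G$ acts by isometries. *)

(* Defs.v *)
From Stdlib Require Import Reals.
From mathcomp Require Import all_boot.

Set Implicit Arguments.
Unset Strict Implicit.
Unset Printing Implicit Defensive.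
Local Open Scope R_scope.

(* The right-angled Coxeter group W_n = <a_0,...,a_{n-1} | a_i^2 = 1>. *)
(* Elements are words over 'I_n; [red] is the free reduction (deleting *)
(* adjacent equal letters), giving the normal form of the element.     *)
Definition push n (x : 'I_n) (w : seq 'I_n) : seq 'I_n :=
  if w is y :: w' then (if x == y then w' else x :: w) else [:: x].
Definition red n (w : seq 'I_n) : seq 'I_n := foldr (@push n) [::] w.

(* An endomorphism of W_n given by the images of the generators. *)
Definition hom n := 'I_n -> seq 'I_n.
Definition happ n (f : hom n) (w : seq 'I_n) : seq 'I_n := red (flatten (map f w)).
Definition hcomp n (f g : hom n) : hom n := fun j => happ f (g j).
Definition hid n : hom n := fun j => [:: j].
Definition heq n (f g : hom n) : Prop := forall j, red (f j) = red (g j).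
(* the generator images are involutions or trivial, so f defines an endomorphism *)
Definition is_hom n (f : hom n) : Prop := forall j, red (f j ++ f j) = [::].

(* Aut^0(W_n): automorphisms sending each a_j to a conjugate of itself
   (a_j^{-1}=a_j, so w^{-1} = rev w). *)
Definition is_aut0 n (f : hom n) : Prop :=
  (forall j, exists w : seq 'I_n, red (f j) = red (w ++ j :: rev w)) /\
  exists g : hom n, is_hom g /\ heq (hcomp f g) (@hid n) /\ heq (hcomp g f) (@hid n).

Definition pc n (i : 'I_n) (D : {set 'I_n}) : hom n :=
  fun j => if j \in D then [:: i; j; i] else [:: j].
Definition inn n (w : seq 'I_n) : hom n := fun j => w ++ j :: rev w.
Definition prod_pc n (ps : seq ('I_n * {set 'I_n})) : hom n :=
  foldr (fun p f => hcomp (pc p.1 p.2) f) (@hid n) ps.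

Definition is_walk n (T : {set {set 'I_n}}) (x y : 'I_n)
    (vs : seq 'I_n) (es : seq {set 'I_n}) : Prop :=
  [/\ size vs = (size es).+1, head x vs = x /\ last x vs = y,
      uniq vs /\ uniq es, all (fun E => E \in T) es &
      forall k, (k < size es)%N ->
        nth x vs k \in nth set0 es k /\ nth x vs k.+1 \in nth set0 es k].

Definition is_hypertree n (T : {set {set 'I_n}}) : Prop :=
  (forall E, E \in T -> (2 <= #|E|)%N) /\
  forall x y : 'I_n, exists vs es, is_walk T x y vs es /\
    forall vs' es', is_walk T x y vs' es' -> vs' = vs /\ es' = es.

Definition fold_step n (L T : {set {set 'I_n}}) : bool :=
  [exists E, exists F, [&& E \in L, F \in L, E != F, E :&: F != set0 &
                           T == (L :\ E :\ F) :|: [set E :|: F]]].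
Definition ht_le n (T L : {set {set 'I_n}}) : bool := connect (@fold_step n) L T.

Definition carries n (T : {set {set 'I_n}}) (i : 'I_n) (D : {set 'I_n}) : Prop :=
  forall d j, d \in D -> j \notin D -> j != i ->
    forall vs es, is_walk T d j vs es -> i \in vs.

(* a^{-1} b is carried by T, as an element of Out^0 :
   b = a o (product of partial conjugations carried by T) o (inner) *)
Definition rel_carried n (T : {set {set 'I_n}}) (a b : hom n) : Prop :=
  exists (ps : seq ('I_n * {set 'I_n})) (w : seq 'I_n),
    (forall p, p \in ps -> [/\ p.1 \notin p.2, p.2 != set0 & carries T p.1 p.2]) /\
    heq b (hcomp a (hcomp (prod_pc ps) (inn w))).

Definition vtx n := (hom n * {set {set 'I_n}})%type.
Definition vdef n : vtx n := (@hid n, set0).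
Definition valid_vtx n (v : vtx n) : Prop := is_aut0 v.1 /\ is_hypertree v.2.
Definition vequiv n (u v : vtx n) : Prop := u.2 = v.2 /\ rel_carried u.2 u.1 v.1.
Definition vle n (u v : vtx n) : Prop := ht_le u.2 v.2 /\ rel_carried v.2 u.1 v.1.

(* a simplex of the order complex: a chain of pairwise distinct classes *)
Definition is_chain n (s : seq (vtx n)) : Prop :=
  (forall u, List.In u s -> valid_vtx u) /\
  forall i j, (i < size s)%N -> (j < size s)%N -> i <> j ->
    ~ vequiv (nth (@vdef n) s i) (nth (@vdef n) s j) /\
    (vle (nth (@vdef n) s i) (nth (@vdef n) s j) \/ vle (nth (@vdef n) s j) (nth (@vdef n) s i)).

(* A point of the geometric realization |K_n|: a function giving the
   barycentric weight of each vertex (constant on classes), supported on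
   a chain. *)
Definition supported n (p : vtx n -> R) (s : seq (vtx n)) : Prop :=
  forall v, p v <> 0 -> valid_vtx v /\ exists u, List.In u s /\ vequiv v u.

Definition is_point n (p : vtx n -> R) : Prop :=
  (forall u v, vequiv u v -> p u = p v) /\
  exists s, [/\ is_chain s, supported p s, (forall u, List.In u s -> 0 <= p u) &
                 \big[Rplus/0]_(u <- s) p u = 1].

Definition comb n (s : seq (vtx n)) (c : vtx n -> R) (e : vtx n -> nat -> R) : nat -> R :=
  fun i => \big[Rplus/0]_(u <- s) (c u * e u i).

Definition edot (N : nat) (x y : nat -> R) : R := \big[Rplus/0]_(i < N) (x i * y i).
Definition enorm (N : nat) (x : nat -> R) : R := sqrt (edot N x x).

(* e realizes the simplex s with edge lengths len as a (nondegenerate)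
   geodesic simplex in R^N *)
Definition eucl_real n (len : vtx n -> vtx n -> R) (s : seq (vtx n)) (N : nat)
    (e : vtx n -> nat -> R) : Prop :=
  (forall u v, List.In u s -> List.In v s ->
     enorm N (fun i => e u i - e v i) = len u v) /\
  (forall c : vtx n -> R, \big[Rplus/0]_(u <- s) c u = 0 ->
     (forall i, (i < N)%N -> comb s c e i = 0) ->
     forall u, List.In u s -> c u = 0).

Definition sd_E n (len : vtx n -> vtx n -> R) (s : seq (vtx n)) (p q : vtx n -> R)
    (a : R) : Prop :=
  forall N e, eucl_real len s N e -> a = enorm N (comb s (fun u => p u - q u) e).

(* Minkowski space R^{1,N}, hyperboloid model of H^N *)
Definition lor (N : nat) (x y : nat -> R) : R :=
  (- (x 0%N * y 0%N) + \big[Rplus/0]_(i < N) (x i.+1 * y i.+1)).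

Definition hyp_real n (len : vtx n -> vtx n -> R) (s : seq (vtx n)) (N : nat)
    (e : vtx n -> nat -> R) : Prop :=
  [/\ (forall u, List.In u s -> lor N (e u) (e u) = (-1) /\ (0 < e u 0%N)),
      (forall u v, List.In u s -> List.In v s ->
         (0 <= len u v) /\ cosh (len u v) = (- lor N (e u) (e v))) &
      (forall c : vtx n -> R, (forall i, (i <= N)%N -> comb s c e i = 0) ->
         forall u, List.In u s -> c u = 0)].

Definition sd_H n (len : vtx n -> vtx n -> R) (s : seq (vtx n)) (p q : vtx n -> R)
    (a : R) : Prop :=
  forall N e, hyp_real len s N e ->
    (0 <= a) /\
    (cosh a * sqrt (lor N (comb s p e) (comb s p e) * lor N (comb s q e) (comb s q e))
      = - lor N (comb s p e) (comb s q e)).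

Definition piecewise_metric n
    (real : (vtx n -> vtx n -> R) -> seq (vtx n) -> nat -> (vtx n -> nat -> R) -> Prop)
    (len : vtx n -> vtx n -> R) : Prop :=
  (forall u u' v v', vequiv u u' -> vequiv v v' -> len u v = len u' v') /\
  forall s, is_chain s -> s <> [::] -> exists N e, real len s N e.

Inductive str_len n (sd : seq (vtx n) -> (vtx n -> R) -> (vtx n -> R) -> R -> Prop)
  : (vtx n -> R) -> (vtx n -> R) -> R -> Prop :=
| str_nil p : is_point p -> str_len sd p p 0
| str_cons p q r s a L : is_point p -> is_chain s -> supported p s -> supported q s ->
    sd s p q a -> str_len sd q r L -> str_len sd p r (a + L).

Definition is_length_metric n (sd : seq (vtx n) -> (vtx n -> R) -> (vtx n -> R) -> R -> Prop)
    (d : (vtx n -> R) -> (vtx n -> R) -> R) : Prop :=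
  forall p q, is_point p -> is_point q ->
    (forall L, str_len sd p q L -> (d p q <= L)) /\
    (forall eps, (0 < eps) -> exists L, str_len sd p q L /\ (L < d p q + eps)).

(* action of phi in Aut^0 (through Out^0): phi.[a,T] = [phi a, T];
   pull phi p = p o (phi . -) *)
Definition pull n (phi : hom n) (p : vtx n -> R) : vtx n -> R :=
  fun v => p (hcomp phi v.1, v.2).

Definition equivariant n (d : (vtx n -> R) -> (vtx n -> R) -> R) : Prop :=
  forall phi, is_aut0 phi -> forall p q, is_point p -> is_point q ->
    d (pull phi p) (pull phi q) = d p q.

Definition geod (P : Type) (X : P -> Prop) (d : P -> P -> R) (x y : P) (g : R -> P) : Prop :=
  g 0 = x /\ g (d x y) = y /\
  forall s t, (0 <= s <= d x y) -> (0 <= t <= d x y) ->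
    X (g s) /\ d (g s) (g t) = Rabs (s - t).

Definition CAT_wrt (M : Type) (XM : M -> Prop) (dM : M -> M -> R)
    (P : Type) (X : P -> Prop) (d : P -> P -> R) : Prop :=
  (forall x y, X x -> X y -> exists g, geod X d x y g) /\
  forall p q r g1 g2 g3, X p -> X q -> X r ->
    geod X d p q g1 -> geod X d q r g2 -> geod X d r p g3 ->
  forall p' q' r', XM p' -> XM q' -> XM r' ->
    dM p' q' = d p q -> dM q' r' = d q r -> dM r' p' = d r p ->
  forall g a b l h c e m,
    List.In (g, a, b, l) [:: (g1, p', q', d p q); (g2, q', r', d q r); (g3, r', p', d r p)] ->
    List.In (h, c, e, m) [:: (g1, p', q', d p q); (g2, q', r', d q r); (g3, r', p', d r p)] ->
  forall s t x' y', (0 <= s <= l) -> (0 <= t <= m) -> XM x' -> XM y' ->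
    dM a x' = s -> dM x' b = (l - s) -> dM c y' = t -> dM y' e = (m - t) ->
    (d (g s) (h t) <= dM x' y').

Definition E2 := (R * R)%type.
Definition E2pt (x : E2) : Prop := True.
Definition E2dist (x y : E2) : R := sqrt ((x.1 - y.1) ^ 2 + (x.2 - y.2) ^ 2).

(* hyperbolic plane H^2, hyperboloid model *)
Definition H2 := (R * R * R)%type.
Definition H2pt (x : H2) : Prop :=
  ((x.1.1) ^ 2 - (x.1.2) ^ 2 - (x.2) ^ 2 = 1 /\ 0 < x.1.1).
Definition arcosh (z : R) : R := ln (z + sqrt (z ^ 2 - 1)).
Definition H2dist (x y : H2) : R :=
  arcosh (x.1.1 * y.1.1 - x.1.2 * y.1.2 - x.2 * y.2).

Definition CAT0 (P : Type) (X : P -> Prop) (d : P -> P -> R) : Prop := CAT_wrt E2pt E2dist X d.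
Definition CATm1 (P : Type) (X : P -> Prop) (d : P -> P -> R) : Prop := CAT_wrt H2pt H2dist X d.

(* Main.v *)
(* The complex K_4 is two-dimensional; its triangles are the flags nuc < e < T, where e has two and T three
   hyperedges. In a CAT(0) or CAT(-1) metric, the angles round a vertex along a closed cycle of
   triangles have sum at least 2 pi: if the sum were smaller, the two chords obtained by unrolling the
   cycle in the model plane in both directions would be distinct geodesics with common end points.
   By equivariance the angles A, B, C of a flag at nuc, e, T depend only on (e, T), and
   A + B + C <= pi. Short cycles, closed up by relations between partial conjugations, show
     - round e: B(e,T) + B(e,T') >= pi for T <> T';
     - round a path: C(e,P) + C(e',P) >= pi / 2 for its two flags;
     - round a star: C(e,S) + C(e',S) + C(e'',S) >= pi for its three flags.
   An 8-cycle round a nuclear vertex through the stars with centres c and c' and two paths has sum of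
   angles A at least 2 pi, which leaves at most pi for the four angles C of the stars. Adding this up for the
   three pairs c, c' among three of the four vertices contradicts the inequality for stars. *)
Require Import Defs.
From Stdlib Require Import Reals Lra Lia ClassicalEpsilon FunctionalExtensionality.
From HB Require Import structures.
From mathcomp Require Import all_boot.

Set Implicit Arguments.
Unset Strict Implicit.
Unset Printing Implicit Defensive.

(** * Words and homomorphisms *)

Section Words.
Variable n : nat.
Implicit Types (x y i j : 'I_n) (u v w : seq 'I_n) (f g h a b : hom n).

(** Equivariance and the CAT inequality concern [d] alone, and [d] is an infimum over strings: a
    priori an edge need not be geodesic, nor a simplex isometrically embedded, so neither lengths
    nor angles are visibly invariant. Hence the detour through the unfolding of the open star of an
    edge: it bounds [d] from below near a point and, with the obvious upper bound, determines [d]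
    locally; local geodesics are then shown to be geodesics. Of the CAT condition only two
    consequences are kept: geodesics overlapping in a segment can be glued, and geodesics are
    unique. In homogeneous coordinates lines and barycentric coordinates are linear in both
    geometries, so one argument serves both; curvature enters the final count only through the
    inequality for the angle sum. A point is a function on all pairs, valid or not, constant on
    classes. For this, validity must be invariant under [vequiv], which requires cancelling an
    automorphism on the right of maps not known to be endomorphisms. *)

Definition reduced w := sorted (fun x y => x != y) w.

Lemma push_reduced x w : reduced w -> reduced (push x w).
Proof.
case: w => [|y w] //= Hw; case: eqP => [_|/eqP ne]; last by rewrite /= ne.
exact: path_sorted Hw.
Qed.

Lemma foldr_push_reduced r w : reduced r -> reduced (foldr (@push n) r w).
Proof. by move=> Hr; elim: w => //= x w; apply: push_reduced. Qed.

Lemma red_reduced w : reduced (red w).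
Proof. exact: foldr_push_reduced. Qed.

Lemma red_id w : reduced w -> red w = w.
Proof.
elim: w => //= x w IH Hw; rewrite /red /= -/(red w) IH; last exact: path_sorted Hw.
by case: w Hw {IH} => //= y w /andP[/negbTE ->].
Qed.

Lemma red_red w : red (red w) = red w.
Proof. exact: red_id (red_reduced w). Qed.

Lemma push_push x w : reduced w -> push x (push x w) = w.
Proof.
case: w => [|y w] /=; first by rewrite eqxx.
case: eqP => [->|_] Hw; last by rewrite /= eqxx.
by case: w Hw => //= z w /andP[/negbTE -> _].
Qed.

Lemma red_cat u v : red (u ++ v) = foldr (@push n) (red v) u.
Proof. by rewrite /red foldr_cat. Qed.

Lemma red_catr u v : red (u ++ red v) = red (u ++ v).
Proof. by rewrite !red_cat red_red. Qed.

Lemma red_catl u v : red (red u ++ v) = red (u ++ v).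
Proof.
rewrite !red_cat; have Hr := red_reduced v; move: (red v) Hr => r Hr.
elim: u => //= x u <-; rewrite -/(red u); have Hu := red_reduced u.
case: (red u) Hu => //= y w Hw; case: eqP => [->|_] //=.
by rewrite push_push //; apply: foldr_push_reduced.
Qed.

Lemma red_cat2 u v u' v' : red u = red u' -> red v = red v' ->
  red (u ++ v) = red (u' ++ v').
Proof. by move=> Hu Hv; rewrite -red_catl -red_catr Hu Hv red_catl red_catr. Qed.

Lemma red_cancel u x v : red (u ++ x :: x :: v) = red (u ++ v).
Proof.
by rewrite !red_cat /red /= -/(red v) push_push //; apply: red_reduced.
Qed.

Lemma red_rev_cancel u w v : red (u ++ w ++ rev w ++ v) = red (u ++ v).
Proof.
elim/last_ind: w v => [|w x IH] v //.
rewrite rev_rcons cat_rcons /= -(IH v).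
by have := red_cancel (u ++ w) x (rev w ++ v); rewrite -!catA.
Qed.

Lemma red_rev_cancel' u w v : red (u ++ rev w ++ w ++ v) = red (u ++ v).
Proof. by rewrite -{2}(revK w) red_rev_cancel. Qed.

Lemma red_cat_rev w : red (w ++ rev w) = [::].
Proof. by have := red_rev_cancel [::] w [::]; rewrite !cats0. Qed.

Lemma red_inv_uniq u v w : red (u ++ v) = [::] -> red (u ++ w) = [::] -> red v = red w.
Proof.
move=> E1 E2.
rewrite -[LHS](red_rev_cancel' [::] u) /= -red_catr E1.
by rewrite -[RHS](red_rev_cancel' [::] u) /= -[in RHS]red_catr E2.
Qed.

Lemma red_rev w w' : red w = red w' -> red (rev w) = red (rev w').
Proof.
move=> E; apply: (@red_inv_uniq w); first exact: red_cat_rev.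
by rewrite -red_catl E red_catl red_cat_rev.
Qed.

(** [happ] without the final reduction, so that it commutes with concatenation on the nose. *)
Definition fw f w := flatten (map f w).

Lemma fw_cat f u v : fw f (u ++ v) = fw f u ++ fw f v.
Proof. by rewrite /fw map_cat flatten_cat. Qed.

Lemma fw_cons f x w : fw f (x :: w) = f x ++ fw f w.
Proof. by []. Qed.

(** Deleting a pair [x x] from the word deletes [f x ++ f x] from its image, which reduces to the
    empty word. *)
Lemma fw_red f w : is_hom f -> red (fw f (red w)) = red (fw f w).
Proof.
move=> Hf; elim: w => //= x w IH; rewrite -/(red w).
have -> : red (fw f (x :: w)) = red (f x ++ fw f (red w)).
  by rewrite fw_cons -red_catr -IH red_catr.
case: (red w) => //= y r; case: eqP => // ->.
by rewrite [fw f (y :: r)]fw_cons catA -red_catl Hf.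
Qed.

Lemma fw_heq f g w : heq f g -> red (fw f w) = red (fw g w).
Proof. by move=> E; elim: w => //= x w IH; apply: red_cat2. Qed.

Lemma fw_hcomp f g w : red (fw (hcomp f g) w) = red (fw f (fw g w)).
Proof.
elim: w => //= x w IH; rewrite !fw_cons fw_cat; apply: red_cat2 => //.
by rewrite /hcomp /happ red_red.
Qed.

Lemma hcompE f g j : red (hcomp f g j) = red (fw f (g j)).
Proof. by rewrite /hcomp /happ red_red. Qed.

Lemma heq_sym f g : heq f g -> heq g f. Proof. by move=> E j. Qed.
Lemma heq_trans f g h : heq f g -> heq g h -> heq f h.
Proof. by move=> E1 E2 j; rewrite E1. Qed.

(** [hcomp g h] reduces its words before [f] is applied; this is harmless because a homomorphism [f]
    respects reduction. *)
Lemma hcompA f g h : is_hom f -> heq (hcomp (hcomp f g) h) (hcomp f (hcomp g h)).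
Proof. by move=> Hf j; rewrite !hcompE fw_hcomp /hcomp /happ fw_red. Qed.

Lemma hcomp_heql f f' g : heq f f' -> heq (hcomp f g) (hcomp f' g).
Proof. by move=> E j; rewrite !hcompE; apply: fw_heq. Qed.

Lemma hcomp_heqr f g g' : is_hom f -> heq g g' -> heq (hcomp f g) (hcomp f g').
Proof. by move=> Hf E j; rewrite !hcompE -fw_red // E fw_red. Qed.

Lemma fw_hid w : fw (@hid n) w = w.
Proof. by rewrite /fw; elim: w => //= x w ->. Qed.

Lemma hcomp1f f : heq (hcomp (@hid n) f) f.
Proof. by move=> j; rewrite hcompE fw_hid. Qed.

Lemma hcompf1 f : heq (hcomp f (@hid n)) f.
Proof. by move=> j; rewrite hcompE /fw /= cats0. Qed.

Lemma is_hom_comp f g : is_hom f -> is_hom g -> is_hom (hcomp f g).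
Proof.
move=> Hf Hg j; rewrite /hcomp /happ red_catl red_catr -fw_cat -fw_red //.
by rewrite Hg.
Qed.

Lemma conj_invol w j : red ((w ++ j :: rev w) ++ (w ++ j :: rev w)) = [::].
Proof.
rewrite -catA cat_cons (_ : w ++ j :: rev w ++ w ++ j :: rev w =
  (w ++ [:: j]) ++ rev w ++ w ++ j :: rev w) -?catA //.
rewrite catA red_rev_cancel' -catA /= red_cancel; exact: red_cat_rev.
Qed.

Lemma is_hom_conj f : (forall j, exists w, red (f j) = red (w ++ j :: rev w)) -> is_hom f.
Proof.
move=> H j; have [w E] := H j; rewrite -red_catl -red_catr E red_catl red_catr.
exact: conj_invol.
Qed.

Lemma is_aut0_hom f : is_aut0 f -> is_hom f.
Proof. by case=> /is_hom_conj. Qed.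

Lemma is_hom1 : is_hom (@hid n).
Proof. by move=> j; rewrite /red /= eqxx. Qed.

Lemma fw_inv f w : is_hom f -> red (fw f w ++ fw f (rev w)) = [::].
Proof. by move=> Hf; rewrite -fw_cat -fw_red // red_cat_rev. Qed.

Lemma fw_rev f w : is_hom f -> red (fw f (rev w)) = red (rev (fw f w)).
Proof.
by move=> Hf; apply: (@red_inv_uniq (fw f w)); rewrite ?fw_inv ?red_cat_rev.
Qed.

Lemma fw_conj f w j : is_hom f ->
  red (fw f (w ++ j :: rev w)) = red (fw f w ++ f j ++ rev (fw f w)).
Proof.
move=> Hf; rewrite fw_cat fw_cons; apply: red_cat2 => //; apply: red_cat2 => //.
exact: fw_rev.
Qed.

Lemma is_aut0_heq f g : heq f g -> is_aut0 f -> is_aut0 g.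
Proof.
move=> E Hf; have Hh := is_aut0_hom Hf; case: Hf => H1 [k [Hk [E1 E2]]]; split.
  by move=> j; have [w Ew] := H1 j; exists w; rewrite -E.
exists k; split=> //; split.
  exact: heq_trans (hcomp_heql _ (heq_sym E)) E1.
exact: heq_trans (hcomp_heqr Hk (heq_sym E)) E2.
Qed.

Lemma is_aut0_1 : is_aut0 (@hid n).
Proof.
split=> [j|]; first by exists [::].
exists (@hid n); split; first exact: is_hom1.
by split; apply: hcomp1f.
Qed.

Lemma is_aut0_comp f g : is_aut0 f -> is_aut0 g -> is_aut0 (hcomp f g).
Proof.
move=> Hf Hg; have hf := is_aut0_hom Hf; have hg := is_aut0_hom Hg.
case: Hf => f1 [f' [hf' [ff' f'f]]]; case: Hg => g1 [g' [hg' [gg' g'g]]]; split.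
  move=> j; have [w Ew] := g1 j; have [w' Ew'] := f1 j.
  exists (fw f w ++ w'); rewrite hcompE -fw_red // Ew fw_red // fw_conj //.
  rewrite rev_cat -!catA; apply: red_cat2 => //.
  by rewrite -red_catl Ew' red_catl -catA.
exists (hcomp g' f'); split; first exact: is_hom_comp.
split.
  apply: heq_trans (hcompA _ _ hf) _.
  apply: heq_trans (hcomp_heqr hf (heq_sym (hcompA _ _ hg))) _.
  apply: heq_trans (hcomp_heqr hf (hcomp_heql _ gg')) _.
  exact: heq_trans (hcomp_heqr hf (hcomp1f _)) ff'.
apply: heq_trans (hcompA _ _ hg') _.
apply: heq_trans (hcomp_heqr hg' (heq_sym (hcompA _ _ hf'))) _.
apply: heq_trans (hcomp_heqr hg' (hcomp_heql _ f'f)) _.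
exact: heq_trans (hcomp_heqr hg' (hcomp1f _)) g'g.
Qed.

(** Applying the inverse [g] to [f j = w j w^-1] gives [j = g(w) g(j) g(w)^-1], so [g] too sends
    every generator to a conjugate of itself. *)
Lemma is_aut0_inv f : is_aut0 f ->
  exists g, [/\ is_aut0 g, heq (hcomp f g) (@hid n) & heq (hcomp g f) (@hid n)].
Proof.
move=> Hf; have hf := is_aut0_hom Hf; case: Hf => f1 [g [hg [fg gf]]].
exists g; split=> //; split; last by exists f.
move=> j; have [w Ew] := f1 j; exists (rev (fw g w)).
have := gf j; rewrite hcompE -fw_red // Ew fw_red // fw_conj // revK => E.
transitivity (red (rev (fw g w) ++ (fw g w ++ g j ++ rev (fw g w)) ++ fw g w)).
  rewrite -!catA; rewrite (red_rev_cancel' [::]) /=.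
  by have := red_rev_cancel' (g j) (fw g w) [::]; rewrite !cats0 => ->.
by apply: red_cat2 => //; apply: (red_cat2 E).
Qed.

Lemma fw_inn u v : red (fw (inn u) v) = red (u ++ v ++ rev u).
Proof.
elim: v => [|x v IH] /=; first by rewrite red_cat_rev.
rewrite fw_cons -red_catr IH red_catr /inn -catA cat_cons.
have := red_rev_cancel' (u ++ [:: x]) u (v ++ rev u).
by rewrite -!catA /=.
Qed.

Lemma hcomp_inn f w : is_hom f -> heq (hcomp f (inn w)) (hcomp (inn (fw f w)) f).
Proof. by move=> Hf j; rewrite !hcompE fw_conj // fw_inn. Qed.

Lemma inn_comp u v : heq (hcomp (inn u) (inn v)) (inn (u ++ v)).
Proof. by move=> j; rewrite hcompE fw_inn /inn rev_cat -!catA. Qed.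

Lemma inn_heq u v : red u = red v -> heq (inn u) (inn v).
Proof.
move=> E j; apply: red_cat2 => //; rewrite -cat1s -[j :: rev v]cat1s.
by apply: red_cat2 => //; apply: red_rev.
Qed.

Lemma inn_nil : heq (@inn n [::]) (@hid n). Proof. by []. Qed.

Lemma is_hom_inn w : is_hom (inn w).
Proof. by apply: is_hom_conj => j; exists w. Qed.

Lemma is_aut0_inn w : is_aut0 (inn w).
Proof.
split=> [j|]; first by exists w.
exists (inn (rev w)); split; first exact: is_hom_inn.
split; apply: heq_trans (inn_comp _ _) _; apply: heq_trans inn_nil; apply: inn_heq.
  exact: red_cat_rev.
by rewrite -{2}(revK w) red_cat_rev.
Qed.

Lemma pcE i (D : {set 'I_n}) j : pc i D j = if j \in D then [:: i; j; i] else [:: j].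
Proof. by []. Qed.

Lemma is_hom_pc i (D : {set 'I_n}) : is_hom (pc i D).
Proof.
apply: is_hom_conj => j; rewrite pcE; case: ifP => _; last by exists [::].
by exists [:: i].
Qed.

Lemma pc_comp i (D E : {set 'I_n}) : i \notin D -> i \notin E -> [disjoint D & E] ->
  heq (hcomp (pc i D) (pc i E)) (pc i (D :|: E)).
Proof.
move=> iD iE DE j; rewrite hcompE !pcE in_setU.
case: ifP => jE; last by rewrite orbF /fw /= cats0 pcE.
have /negbTE jD : j \notin D by rewrite (disjointFl DE).
by rewrite orbT /fw /= !pcE (negbTE iD) jD.
Qed.

Lemma pc_invol i (D : {set 'I_n}) : i \notin D -> heq (hcomp (pc i D) (pc i D)) (@hid n).
Proof.
move=> iD j; rewrite hcompE !pcE; case: ifP => jD; last by rewrite /fw /= cats0 pcE jD.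
rewrite /fw /= !pcE (negbTE iD) jD /=.
by rewrite -[LHS]/(red ([::] ++ i :: i :: [:: j; i; i])) red_cancel (red_cancel [:: j] i [::]).
Qed.

Lemma pc_commute i j (D E : {set 'I_n}) :
  i \notin D -> i \notin E -> j \notin D -> j \notin E -> [disjoint D & E] ->
  heq (hcomp (pc i D) (pc j E)) (hcomp (pc j E) (pc i D)).
Proof.
move=> iD iE jD jE DE k; rewrite !hcompE !pcE.
case: (boolP (k \in D)) => kD; case: (boolP (k \in E)) => kE.
- by rewrite (disjointFr DE kD) in kE.
- by rewrite /fw /= !pcE kD (negbTE kE) (negbTE iE).
- by rewrite /fw /= !pcE kE (negbTE kD) (negbTE jD).
- by rewrite /fw /= !pcE (negbTE kE) (negbTE kD).
Qed.

Lemma pc_full i : heq (pc i [set~ i]) (inn [:: i]).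
Proof.
move=> j; rewrite pcE in_setC1; case: eqP => [->|_] //=.
by rewrite /inn -[RHS]/(red ([::] ++ i :: i :: [:: i])) red_cancel.
Qed.

Lemma is_aut0_pc i (D : {set 'I_n}) : i \notin D -> is_aut0 (pc i D).
Proof.
move=> iD; split=> [j|].
  by rewrite pcE; case: ifP => _; [exists [:: i] | exists [::]].
by exists (pc i D); split; [exact: is_hom_pc | split; apply: pc_invol].
Qed.

End Words.

(** * The Magnus representation of W_n over F_2, and right cancellation *)

Section Magnus.
Variable n : nat.
Implicit Types (x y i j : 'I_n) (m u v w q : seq 'I_n).

(* The coefficient, in F_2, of the monomial m in the product of the (1 + X_i), i in w. *)
Fixpoint coef m w : bool :=
  if w is x :: w' then
    coef m w' (+) (if m is y :: m' then (x == y) && coef m' w' else false)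
  else m == [::].

Lemma coef_nil w : coef [::] w = true.
Proof. by elim: w => //= x w ->. Qed.

(** The reduced monomials are those that survive modulo the squares [X_i^2], and there
    [(1 + X_i)^2 = 1]. *)
Lemma coef_cancel m x w : reduced m -> coef m (x :: x :: w) = coef m w.
Proof.
case: m => [|y m] Hm; first by rewrite !coef_nil.
rewrite /=; case: eqP => [E|_] /=; last by rewrite !addbF.
case: m Hm => [|z m] /=; first by rewrite addbF -addbA addbb addbF.
rewrite E => /andP[/negbTE -> _].
by rewrite addbF -addbA addbb addbF.
Qed.

Lemma coef_red m w : reduced m -> coef m (red w) = coef m w.
Proof.
elim: w m => // x w IH m Hm.
have Hc : coef m (x :: w) = coef m (x :: red w).
  by rewrite /= IH //; case: m Hm => // y m /path_sorted Hm; rewrite IH.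
rewrite Hc /red /= -/(red w); case: (red w) => // y r /=.
by case: eqP => [<-|//]; rewrite -[RHS]/(coef m (x :: x :: r)) coef_cancel.
Qed.

Lemma addb_inj (c d : bool) : c (+) d = false -> c = d.
Proof. by case: c; case: d. Qed.

(** The Cauchy product: the sum of [f s && g t] over all splittings [m = s ++ t]. *)
Fixpoint conv (f g : seq 'I_n -> bool) m : bool :=
  if m is y :: m' then (f [::] && g m) (+) conv (fun s => f (y :: s)) g m'
  else f [::] && g [::].

Lemma convD f1 f2 g m :
  conv (fun s => f1 s (+) f2 s) g m = conv f1 g m (+) conv f2 g m.
Proof.
elim: m f1 f2 => [|y m IH] f1 f2 /=; first by rewrite andb_addl.
by rewrite IH andb_addl addbACA.
Qed.

Lemma convZ b f g m : conv (fun s => b && f s) g m = b && conv f g m.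
Proof.
elim: m f => [|y m IH] f /=; first by rewrite andbA.
by rewrite IH andb_addr andbA.
Qed.

Lemma eq_conv f1 f2 g m : f1 =1 f2 -> conv f1 g m = conv f2 g m.
Proof.
elim: m f1 f2 => [|y m IH] f1 f2 E /=; first by rewrite E.
by rewrite E; congr (_ (+) _); apply: IH => s.
Qed.

Lemma coef_cat m u v : coef m (u ++ v) = conv (coef^~ u) (coef^~ v) m.
Proof.
elim: u m => [|x u IH] m.
  case: m => [|y m] //=.
  rewrite (@eq_conv _ (fun s => false && (s == [::]))) ?convZ ?addbF //.
rewrite /= IH; case: m => [|y m] /=; first by rewrite !addbF.
rewrite convD convZ IH addbF addbA; congr (_ (+) _).
Qed.

Definition agree (k : nat) u u' := forall m, reduced m -> size m < k -> coef m u = coef m u'.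

Lemma conv_diff h h' g g' m :
  (forall s t, m = s ++ t -> t != [::] -> h s = h' s /\ g t = g' t) ->
  conv h g m (+) conv h' g' m = (h m && g [::]) (+) (h' m && g' [::]).
Proof.
elim: m h h' => [|y m IH] h h' H //=.
have [-> ->] := H [::] (y :: m) erefl isT.
rewrite addbACA addbb /=; apply: IH => s t E tn.
by apply: (H (y :: s)) => //; rewrite E.
Qed.

Lemma reduced_catP (s t : seq 'I_n) : reduced (s ++ t) -> reduced s /\ reduced t.
Proof.
rewrite /reduced; case: s => [|x s] //=; rewrite cat_path => /andP[-> H]; split=> //.
exact: path_sorted H.
Qed.

(** Below degree [k] the factors agree, so in degree [k] only the two extreme splittings of [m] can
    differ, and there the other factor is the constant coefficient 1. *)
Lemma coef_cat_diff k m u v u' v' : agree k u u' -> agree k v v' ->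
  reduced m -> size m <= k ->
  coef m (u ++ v) (+) coef m (u' ++ v') =
  (coef m u (+) coef m u') (+) (coef m v (+) coef m v').
Proof.
move=> Hu Hv Hm Hk; rewrite !coef_cat.
case: m Hm Hk => [|y m] Hm Hk /=; first by rewrite !coef_nil.
rewrite !coef_nil !andTb addbACA addbC conv_diff; first by rewrite !coef_nil !andbT.
move=> s t E tn; have [Hs Ht] : reduced (y :: s) /\ reduced t.
  by apply: reduced_catP; rewrite cat_cons -E.
have st : size t > 0 by case: (t) tn.
move: Hk; rewrite E /= size_cat => Hk; split; [apply: Hu | apply: Hv] => //=.
  by apply: leq_trans Hk; rewrite ltnS -addn1 leq_add2l.
by apply: leq_ltn_trans Hk; apply: leq_addl.
Qed.

Definition xsum (dl : 'I_n -> bool) q := foldr (fun i b => dl i (+) b) false q.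

Lemma xsum_cat dl u v : xsum dl (u ++ v) = xsum dl u (+) xsum dl v.
Proof. by elim: u => //= x u ->; rewrite addbA. Qed.

Lemma xsum_rev dl u : xsum dl (rev u) = xsum dl u.
Proof. by elim: u => //= x u IH; rewrite rev_cons -cats1 xsum_cat /= addbF IH addbC. Qed.

Lemma xsum_red dl w : xsum dl (red w) = xsum dl w.
Proof.
elim: w => //= x w <-; rewrite -/(red w); case: (red w) => //= y r.
by case: eqP => //= ->; rewrite addbA addbb.
Qed.

Lemma agree_fw k (A A' : hom n) q : (forall i, agree k (A i) (A' i)) ->
  agree k (fw A q) (fw A' q) /\ (forall m, reduced m -> size m = k -> 0 < k ->
  coef m (fw A q) (+) coef m (fw A' q) =
  xsum (fun i => coef m (A i) (+) coef m (A' i)) q).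
Proof.
move=> H; elim: q => [|x q [IH1 IH2]]; first by split=> // m _ _ _; rewrite addbb.
split=> [m Hm Hk|m Hm Hk k0].
  apply: addb_inj; rewrite !fw_cons (coef_cat_diff (H x) IH1) ?(ltnW Hk) //.
  by rewrite (H x) // IH1 // !addbb.
by rewrite !fw_cons (coef_cat_diff (H x) IH1) ?Hk // IH2.
Qed.

Lemma coef_size m w : size w <= size m -> coef m w = (m == w).
Proof.
elim: w m => [|x w IH] [|y m] //= H.
rewrite (IH (y :: m) (ltnW H)) (IH m H) eqseq_cons [y == x]eq_sym.
by case: (y :: m =P w) => // E; rewrite -E /= ltnn in H.
Qed.

(** The monomial [red v] has coefficient 1 in [v]; in a reduced word that is not longer it occurs
    only if the two words coincide. *)
Lemma coef_inj u v : (forall m, reduced m -> coef m u = coef m v) -> red u = red v.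
Proof.
move=> H; wlog le : u v H / size (red u) <= size (red v) => [W|].
  by case: (leqP (size (red u)) (size (red v))) => [|/ltnW]; [|symmetry]; apply: W => // m /H.
have Hv := red_reduced v.
have := H _ Hv; rewrite -(coef_red u) // -[in RHS](coef_red v) //.
by rewrite !coef_size // eqxx => /eqP.
Qed.

(* An endomorphism conjugating the generators is the identity in degree one of the Magnus algebra
   over F_2, so the difference of A and A' is killed degree by degree. *)
Lemma hom_right_cancel (Q A A' : hom n) : is_aut0 Q ->
  heq (hcomp A Q) (hcomp A' Q) -> heq A A'.
Proof.
move=> [HQ _] E.
suff H k : forall i, agree k (A i) (A' i).
  by move=> j; apply: coef_inj => m Hm; apply: (H (size m).+1).
elim: k => [//|k IH] j m Hm; rewrite ltnS leq_eqVlt => /orP[/eqP Hk|]; last exact: IH.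
case: (posnP k) => [k0|k0]; first by move: Hk; rewrite k0 => /size0nil ->; rewrite !coef_nil.
have [_ /(_ m Hm Hk k0)] := agree_fw (Q j) IH.
rewrite -(coef_red (fw A _)) // -(coef_red (fw A' _)) // -!hcompE E addbb.
(* Mod 2 the letters of [w] and [rev w] cancel, so the discrepancy in degree [k] along [Q j] is that
   at [j] alone. *)
have [w Ew] := HQ j; rewrite -xsum_red Ew xsum_red xsum_cat /= xsum_rev.
by rewrite addbC -addbA addbb addbF => /esym/addb_inj.
Qed.

End Magnus.

(** * The automorphisms carried by a hypertree form a group *)

Section Carried.
Variable n : nat.
Implicit Types (T : {set {set 'I_n}}) (a b Q : hom n) (D : {set 'I_n}).

Definition pc_carried T (p : 'I_n * {set 'I_n}) :=
  [/\ p.1 \notin p.2, p.2 != set0 & carries T p.1 p.2].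

Definition carried T Q :=
  exists ps w, (forall p, p \in ps -> pc_carried T p) /\ heq Q (hcomp (prod_pc ps) (inn w)).

Lemma prod_pc_aut0 (ps : seq ('I_n * {set 'I_n})) :
  (forall p, p \in ps -> p.1 \notin p.2) -> is_aut0 (prod_pc ps).
Proof.
elim: ps => [|p ps IH] H; first exact: is_aut0_1.
apply: is_aut0_comp; first by apply: is_aut0_pc; apply: H; rewrite mem_head.
by apply: IH => q qs; apply: H; rewrite inE qs orbT.
Qed.

Lemma pcs_aut0 T (ps : seq ('I_n * {set 'I_n})) :
  (forall p, p \in ps -> pc_carried T p) -> is_aut0 (prod_pc ps).
Proof. by move=> H; apply: prod_pc_aut0 => p /H[]. Qed.

Lemma carried_aut0 T Q : carried T Q -> is_aut0 Q.
Proof.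
case=> ps [w [H E]]; apply: is_aut0_heq (heq_sym E) _.
apply: is_aut0_comp; [exact: pcs_aut0 H | exact: is_aut0_inn].
Qed.

Lemma carried_heq T Q Q' : heq Q Q' -> carried T Q -> carried T Q'.
Proof.
by move=> E [ps [w [H E']]]; exists ps, w; split=> //; apply: heq_trans (heq_sym E) _.
Qed.

Lemma carried_inn T w : carried T (inn w).
Proof. by exists [::], w; split=> //; apply: heq_sym; apply: hcomp1f. Qed.

Lemma carried1 T : carried T (@hid n).
Proof. exact: carried_heq (@inn_nil n) (carried_inn T [::]). Qed.

Lemma carried_pc T i D : i \notin D -> D != set0 -> carries T i D -> carried T (pc i D).
Proof.
move=> iD D0 H; exists [:: (i, D)], [::]; split=> [p|]; first by rewrite inE => /eqP ->.
have h := @is_hom_pc n i D.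
have hp : is_hom (prod_pc [:: (i, D)]) by apply: is_hom_comp => //; apply: is_hom1.
apply: heq_sym; apply: heq_trans (hcomp_heqr hp (@inn_nil n)) _.
exact: heq_trans (hcompf1 _) (hcompf1 _).
Qed.

Lemma prod_pc_cat (ps qs : seq ('I_n * {set 'I_n})) :
  heq (prod_pc (ps ++ qs)) (hcomp (prod_pc ps) (prod_pc qs)).
Proof.
elim: ps => [|p ps IH] /=; first by apply: heq_sym; apply: hcomp1f.
apply: heq_trans (hcomp_heqr (@is_hom_pc n _ _) IH) _.
by apply: heq_sym; apply: hcompA; apply: is_hom_pc.
Qed.

(** The inner factor of [Q] has to pass the product [P] of partial conjugations in [Q']: [inn w]
    followed on the right by [P] is [P] followed by [inn] of the preimage of [w] under [P]. *)
Lemma carried_comp T Q Q' : carried T Q -> carried T Q' -> carried T (hcomp Q Q').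
Proof.
move=> HQ [qs [v [Hqs E']]]; have hQ := is_aut0_hom (carried_aut0 HQ).
case: HQ => ps [w [Hps E]].
have hp := is_aut0_hom (pcs_aut0 Hps); have Aq := pcs_aut0 Hqs.
have hq := is_aut0_hom Aq.
have [q' [Aq' qq' q'q]] := is_aut0_inv Aq; have hq' := is_aut0_hom Aq'.
exists (ps ++ qs), (fw q' w ++ v); split.
  by move=> p; rewrite mem_cat => /orP[/Hps|/Hqs].
apply: heq_trans (hcomp_heqr hQ E') _.
apply: heq_trans (hcomp_heql _ E) _.
apply: heq_trans (hcompA _ _ hp) _.
apply: heq_sym; apply: heq_trans (hcomp_heql _ (prod_pc_cat ps qs)) _.
apply: heq_trans (hcompA _ _ hp) _; apply: hcomp_heqr => //; apply: heq_sym.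
apply: heq_trans (heq_sym (hcompA _ _ (@is_hom_inn n w))) _.
apply: heq_sym; apply: heq_trans (hcomp_heqr hq (heq_sym (inn_comp _ _))) _.
apply: heq_trans (heq_sym (hcompA _ _ hq)) _; apply: hcomp_heql.
apply: heq_trans (hcomp_inn _ hq) _; apply: hcomp_heql; apply: inn_heq.
by rewrite -fw_hcomp (fw_heq _ qq') fw_hid.
Qed.

Lemma prod_pc_rev T (ps : seq ('I_n * {set 'I_n})) :
  (forall p, p \in ps -> pc_carried T p) ->
  heq (hcomp (prod_pc ps) (prod_pc (rev ps))) (@hid n).
Proof.
elim: ps => [|p ps IH] H; first exact: hcomp1f.
have Hp : p.1 \notin p.2 by case: (H p (mem_head _ _)).
have H' q : q \in ps -> pc_carried T q by move=> qs; apply: H; rewrite inE qs orbT.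
have hp := @is_hom_pc n p.1 p.2; have hps := is_aut0_hom (pcs_aut0 H').
rewrite rev_cons -cats1 /=; apply: heq_trans (hcompA _ _ hp) _.
apply: heq_trans (hcomp_heqr hp (hcomp_heqr hps (prod_pc_cat _ _))) _.
apply: heq_trans (hcomp_heqr hp (heq_sym (hcompA _ _ hps))) _.
apply: heq_trans (hcomp_heqr hp (hcomp_heql _ (IH H'))) _.
apply: heq_trans (hcomp_heqr hp (hcomp1f _)) _ => /=.
apply: heq_trans (hcomp_heqr hp (hcompf1 _)) _; exact: pc_invol.
Qed.

Lemma carried_inv T Q : carried T Q -> exists Q',
  [/\ carried T Q', heq (hcomp Q Q') (@hid n) & heq (hcomp Q' Q) (@hid n)].
Proof.
move=> HQ; have [Q' [A' QQ' Q'Q]] := is_aut0_inv (carried_aut0 HQ).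
exists Q'; split=> //; have hQ' := is_aut0_hom A'.
case: HQ => ps [w [Hps E]].
have Hr p : p \in rev ps -> pc_carried T p by rewrite mem_rev => /Hps.
have hp := is_aut0_hom (pcs_aut0 Hps).
have C1 : carried T (hcomp (inn (rev w)) (prod_pc (rev ps))).
  apply: carried_comp (carried_inn _ _) _.
  exists (rev ps), [::]; split=> //; have hr := is_aut0_hom (pcs_aut0 Hr).
  by apply: heq_sym; apply: heq_trans (hcomp_heqr hr (@inn_nil n)) (hcompf1 _).
apply: carried_heq C1.
set P := prod_pc ps in E hp; set P' := prod_pc (rev ps).
have hi := @is_hom_inn n w; have hi' := @is_hom_inn n (rev w).
(* Both sides are right inverses of Q. *)
apply: heq_sym.
apply: heq_trans (heq_sym (hcompf1 _)) _.
have e : heq (hcomp Q (hcomp (inn (rev w)) P')) (@hid n).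
  apply: heq_trans (hcomp_heql _ E) _; apply: heq_trans (hcompA _ _ hp) _.
  apply: heq_trans (prod_pc_rev Hps); apply: hcomp_heqr => //.
  apply: heq_trans (heq_sym (hcompA _ _ hi)) _.
  apply: heq_trans (hcomp1f _); apply: hcomp_heql.
  apply: heq_trans (inn_comp _ _) _; apply: heq_trans (@inn_nil n).
  by apply: inn_heq; apply: red_cat_rev.
apply: heq_trans (hcomp_heqr hQ' (heq_sym e)) _.
apply: heq_trans (heq_sym (hcompA _ _ hQ')) _.
exact: heq_trans (hcomp_heql _ Q'Q) (hcomp1f _).
Qed.

Lemma rel_carriedE T a b : is_hom a ->
  rel_carried T a b <-> exists2 Q, carried T Q & heq b (hcomp a Q).
Proof.
move=> ha; split=> [[ps [w [H E]]]|[Q [ps [w [H E]]] E']].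
  by exists (hcomp (prod_pc ps) (inn w)) => //; exists ps, w.
by exists ps, w; split=> //; apply: heq_trans E' (hcomp_heqr ha E).
Qed.

Lemma rel_refl T a : is_hom a -> rel_carried T a a.
Proof.
move=> ha; apply/rel_carriedE => //; exists (@hid n); first exact: carried1.
by apply: heq_sym; apply: hcompf1.
Qed.

Lemma rel_heq T a b : is_hom a -> heq a b -> rel_carried T a b.
Proof.
move=> ha E; apply/rel_carriedE => //; exists (@hid n); first exact: carried1.
by apply: heq_trans (heq_sym E) _; apply: heq_sym; apply: hcompf1.
Qed.

Lemma rel_comp T a Q : is_hom a -> carried T Q -> rel_carried T a (hcomp a Q).
Proof. by move=> ha H; apply/rel_carriedE => //; exists Q. Qed.

(** From right to left nothing is known about [a], not even that it is an endomorphism. But [b]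
    composed with the inverse of [Q] is an automorphism, and [hom_right_cancel] identifies it with
    [a]. *)
Lemma rel_aut0 T a b : rel_carried T a b -> is_aut0 a <-> is_aut0 b.
Proof.
move=> R; split=> [Ha|Hb].
  have ha := is_aut0_hom Ha; move/(rel_carriedE _ _ ha): R => [Q HQ E].
  by apply: is_aut0_heq (heq_sym E) _; apply: is_aut0_comp Ha (carried_aut0 HQ).
case: R => ps [w [H E]]; set Q := hcomp (prod_pc ps) (inn w) in E.
have AQ : is_aut0 Q.
  by apply: is_aut0_comp; [exact: (@pcs_aut0 T ps H) | exact: is_aut0_inn].
have [Q' [A' QQ' Q'Q]] := is_aut0_inv AQ.
have hb := is_aut0_hom Hb.
apply: (@is_aut0_heq n (hcomp b Q')); last exact: is_aut0_comp.
apply: (hom_right_cancel AQ).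
apply: heq_trans (hcompA _ _ hb) _; apply: heq_trans (hcomp_heqr hb Q'Q) _.
exact: heq_trans (hcompf1 _) E.
Qed.

Lemma rel_sym T a b : is_aut0 a -> rel_carried T a b -> rel_carried T b a.
Proof.
move=> Ha R; have ha := is_aut0_hom Ha; have hb := is_aut0_hom (proj1 (rel_aut0 R) Ha).
move/(rel_carriedE _ _ ha): R => [Q HQ E]; have [Q' [C' QQ' _]] := carried_inv HQ.
apply/rel_carriedE => //; exists Q' => //; apply: heq_sym.
apply: heq_trans (hcomp_heql _ E) _; apply: heq_trans (hcompA _ _ ha) _.
exact: heq_trans (hcomp_heqr ha QQ') (hcompf1 _).
Qed.

Lemma rel_trans T a b c : is_aut0 a -> rel_carried T a b -> rel_carried T b c ->
  rel_carried T a c.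
Proof.
move=> Ha R1 R2; have ha := is_aut0_hom Ha; have hb := is_aut0_hom (proj1 (rel_aut0 R1) Ha).
move/(rel_carriedE _ _ ha): R1 => [Q HQ E]; move/(rel_carriedE _ _ hb): R2 => [Q' HQ' E'].
apply/rel_carriedE => //; exists (hcomp Q Q'); first exact: carried_comp.
apply: heq_trans E' _; apply: heq_trans (hcomp_heql _ E) _; exact: hcompA.
Qed.

Lemma rel_hcomp T f a b : is_hom f -> is_hom a -> rel_carried T a b ->
  rel_carried T (hcomp f a) (hcomp f b).
Proof.
move=> hf ha /(rel_carriedE _ _ ha)[Q HQ E]; apply/rel_carriedE; first exact: is_hom_comp.
exists Q => //; apply: heq_trans (hcomp_heqr hf E) _; apply: heq_sym; exact: hcompA.
Qed.

End Carried.

(** * Hypertrees *)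

Section Folds.
Variable n : nat.
Implicit Types (T L E F : {set {set 'I_n}}).

(** The number of hyperedges is the rank function that tells the members of a chain apart. The union
    may already be a hyperedge, so a fold can lose more than one. *)
Lemma fold_step_card L T : fold_step L T -> #|T| < #|L|.
Proof.
case/existsP=> E /existsP[F /and5P[EL FL EF _ /eqP ->]].
rewrite (cardsD1 E L) EL (cardsD1 F (L :\ E)) !inE FL eq_sym EF /= add1n ltnS.
by rewrite (leq_trans (leq_card_setU _ _)) // cards1 addn1 add1n.
Qed.

Lemma ht_leP T L : ht_le T L -> T = L \/ #|T| < #|L|.
Proof.
case/connectP=> p; elim: p L => [|M p IH] L /=; first by move=> _ ->; left.
case/andP=> /fold_step_card H Hp /(IH _ Hp)[->|H2]; right=> //.
exact: ltn_trans H2 H.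
Qed.

Lemma ht_le_trans : transitive (@ht_le n).
Proof. by move=> y x z H1 H2; apply: connect_trans H2 H1. Qed.

Lemma ht_le_fold L T : fold_step L T -> ht_le T L.
Proof. exact: connect1. Qed.

End Folds.

Section Hypertrees.
Variable n : nat.
Implicit Types (T : {set {set 'I_n.+1}}) (x y : 'I_n.+1).

Lemma walk_take T x y vs es z k : is_walk T x y vs es -> k <= size es ->
  z = nth x vs k -> is_walk T x z (take k.+1 vs) (take k es).
Proof.
case=> Hs [Hh Hl] [uv ue] He Hk ke zk.
have kv : k < size vs by rewrite Hs ltnS.
split.
- by rewrite !size_takel ?Hs ?ltnS // (leq_trans ke).
- split; first by case: (vs) Hh.
  by rewrite zk (last_nth x) size_takel // [LHS]/= nth_take.
- by rewrite !take_uniq.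
- by apply/allP=> E /mem_take; apply: allP.
- move=> i; rewrite size_takel // => ik.
  have [] := Hk i (leq_trans ik ke).
  by rewrite !nth_take // ltnW.
Qed.

Lemma walk_rcons T x y vs es z E : is_walk T x y vs es -> E \in T -> E \notin es ->
  z \notin vs -> y \in E -> z \in E -> is_walk T x z (rcons vs z) (rcons es E).
Proof.
case=> Hs [Hh Hl] [uv ue] He Hk ET Ees zvs yE zE; split.
- by rewrite !size_rcons Hs.
- by split; [case: (vs) Hs Hh | rewrite last_rcons].
- by rewrite !rcons_uniq Ees zvs.
- by rewrite all_rcons ET.
- move=> k; rewrite size_rcons ltnS leq_eqVlt => /orP[/eqP ->|kl].
    rewrite !nth_rcons ltnn eqxx Hs ltnS leqnn ltnn eqxx; split=> //.
    by move: Hl; rewrite (last_nth x); case: (vs) Hs => //= a l [<-] ->.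
  rewrite !nth_rcons Hs kl !ltnS (ltnW kl) kl; exact: Hk.
Qed.

(* Root the hypertree at ord0: every hyperedge is the last one of the walk from the root to some
   other vertex. *)
Lemma hypertree_card T : is_hypertree T -> #|T| <= n.
Proof.
case=> H2 HW.
pose f y := last set0 (sval (constructive_indefinite_description _
  (svalP (constructive_indefinite_description _ (HW ord0 y))))).
have fP y vs es : is_walk T ord0 y vs es -> f y = last set0 es.
  rewrite /f; case: constructive_indefinite_description => vs0 /= ex.
  case: constructive_indefinite_description => es0 /= [H U] W.
  by have [_ ->] := U _ _ W.
have cn : #|[set~ (ord0 : 'I_n.+1)]| = n by rewrite cardsC1 card_ord.
suff Tf : T \subset f @: [set~ ord0].
  by apply: leq_trans (subset_leq_card Tf) _; rewrite -[X in _ <= X]cn leq_imset_card.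
apply/subsetP=> E ET.
have last_in y vs es : is_walk T ord0 y vs es -> last set0 es = E -> y != ord0 ->
    E \in f @: [set~ ord0].
  by move=> W lE y0; apply/imsetP; exists y; rewrite ?in_setC1 // (fP _ _ _ W).
have H2E := H2 _ ET.
have edge0 : forall x vs es, is_walk T ord0 x vs es -> es != [::] -> x != ord0.
  move=> x vs es [Hs [Hh Hl] [uv _] _ _]; case: es Hs => // F es.
  case: vs Hh Hl uv => [|a [|b vs]] //= -> Hl /andP[a0 _] _ _.
  by apply: contraNneq a0 => x0; rewrite -x0 -Hl mem_last.
have lastk : forall x vs es k, is_walk T ord0 x vs es -> k < size es -> nth set0 es k = E ->
    E \in f @: [set~ ord0].
  move=> x vs es k W ke kE.
  have W' := walk_take W ke erefl.
  apply: (last_in _ _ _ W').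
    by rewrite (last_nth set0) size_takel // [LHS]/= nth_take.
  by apply: (edge0 _ _ _ W'); rewrite -size_eq0 size_takel.
have [x xE] : exists x, x \in E by apply/card_gt0P; apply: leq_trans H2E.
have [y] : exists y, y \in E :\ x.
  by apply/card_gt0P; move: H2E; rewrite (cardsD1 x) xE.
rewrite !inE => /andP[yx yE].
have [vs [es [W U]]] := HW ord0 x.
case: (boolP (E \in es)) => Ees; first by apply: (lastk _ _ _ (index E es) W); rewrite ?index_mem ?nth_index.
(* If [y] is already on the walk to [x], its truncation at [y] followed by [E] is a second walk to
   [x], which is impossible. *)
case: (boolP (y \in vs)) => yvs.
  have [Hs _ _ _ _] := W.
  have ke : index y vs <= size es by rewrite -ltnS -Hs index_mem.
  have yk : y = nth ord0 vs (index y vs) by rewrite nth_index.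
  have W1 := walk_take W ke yk.
  have xt : x \notin take (index y vs).+1 vs.
    case: (W) => _ [Hh Hl] [uv _] _ _; apply/negP=> xt.
    have xi : x = nth ord0 vs (size es).
      by rewrite -Hl (last_nth ord0); case: (vs) Hs => //= a l [->].
    have : index x vs <= index y vs.
      rewrite -[X in index x X](cat_take_drop (index y vs).+1 vs) index_cat xt -ltnS.
      by move: xt; rewrite -index_mem size_takel // Hs ltnS.
    rewrite xi index_uniq ?Hs // => le.
    have e : index y vs = size es by apply/eqP; rewrite eqn_leq ke le.
    by move: yx; rewrite yk e -xi eqxx.
  have W2 := walk_rcons W1 ET (contra (@mem_take _ _ _ _) Ees) xt yE xE.
  have [_ e] := U _ _ W2; case/negP: Ees; rewrite -e mem_rcons mem_head //.
(* Otherwise the walk to [x] extends through [E] to [y], with [E] as its last hyperedge. *)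
have W2 := walk_rcons W ET Ees yvs xE yE.
apply: (last_in _ _ _ W2); first by rewrite last_rcons.
by apply: (edge0 _ _ _ W2); case: (es).
Qed.

(** A walk from another vertex to [x] must use the only hyperedge, which therefore contains [x]. *)
Lemma hypertree_card1 T : is_hypertree T -> #|T| = 1 -> T = [set setT].
Proof.
move=> [H2 HW] /eqP/cards1P[E TE]; rewrite TE; congr [set _]; apply/setP=> x; rewrite inE.
have : #|E| >= 2 by apply: H2; rewrite TE set11.
case/card_gt1P=> a [b] [aE bE ab].
have [z zx zE] : exists2 z, z != x & z \in E.
  by case: (eqVneq a x) => [e|]; [exists b => //; rewrite -e eq_sym | exists a].
have [vs [es [[Hs [Hh Hl] [uv ue] He Hk] _]]] := HW z x.
have es1 : size es <= 1.
  have : {subset es <= [:: E]} by move=> F /(allP He); rewrite TE !inE.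
  by move/(uniq_leq_size ue).
case: es Hs Hk es1 He {ue} => [|F [|]] //= Hs Hk _ He.
  by case: vs Hs Hh Hl {Hk uv} => [|c [|]] //= _ -> e; rewrite e eqxx in zx.
have {Hk} [_] := Hk 0 isT; case: vs Hs Hh Hl {uv} => [|c [|d [|]]] //= _ _ -> xF.
by move: He; rewrite TE inE andbT => /eqP <-.
Qed.

Lemma hypertree_gt0 T : 0 < n -> is_hypertree T -> 0 < #|T|.
Proof.
move=> n0 [_ HW]; rewrite lt0n cards_eq0; apply/eqP=> T0.
have [vs [es [[Hs [Hh Hl] _ He _] _]]] := HW ord0 ord_max.
have : es = [::] by case: es {Hs} He => // E es /= /andP[]; rewrite T0 inE.
move=> e; rewrite e in Hs; case: vs Hs Hh Hl => [|a [|]] //= _ -> /(congr1 val) /= e0.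
by rewrite -e0 in n0.
Qed.

End Hypertrees.

Fixpoint words {T : Type} (s : seq T) k : seq (seq T) :=
  if k is k'.+1 then [seq z :: w | z <- s, w <- words s k'] else [:: [::]].

Lemma mem_words {T : eqType} (s w : seq T) : {subset w <= s} -> w \in words s (size w).
Proof.
elim: w => [|z w IH] H //=; apply/allpairsP; exists (z, w) => /=; split=> //.
  by apply: H; rewrite mem_head.
by apply: IH => y yw; apply: H; rewrite inE yw orbT.
Qed.

Lemma words_sub {T : eqType} (s w : seq T) k : w \in words s k -> {subset w <= s}.
Proof.
elim: k w => [|k IH] w /=; first by rewrite inE => /eqP ->.
case/allpairsP=> [[z u]] /= [zs us ->] y; rewrite inE => /orP[/eqP -> //|].
exact: IH.
Qed.

(* Sets over 'I_4 do not compute: hypertrees are encoded by lists of lists of numbers, on which walks,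
   folds and carrying are decided by evaluation. *)
Section Codes.
Implicit Types (l : seq nat) (tc el : seq (seq nat)) (vs : seq 'I_4) (x y : 'I_4).

Definition decode l : {set 'I_4} := [set i | val i \in l].
Definition decodes tc : {set {set 'I_4}} := [set E in map decode tc].

Definition cwalk tc (x y : nat) (vs : seq nat) el :=
  [&& size vs == (size el).+1, head x vs == x, last x vs == y, uniq vs, uniq el,
      all (mem tc) el &
      all (fun k => (nth x vs k \in nth [::] el k) && (nth x vs k.+1 \in nth [::] el k))
          (iota 0 (size el))].

(** The vertices of a walk are distinct, so it has at most three hyperedges, whence [iota 0 4] for
    their number. *)
Definition walks tc (x y : nat) : seq (seq nat * seq (seq nat)) :=
  flatten [seq [seq p <- [seq (w, el) | w <- filter uniq (words (iota 0 4) k.+1),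
                                         el <- filter uniq (words tc k)]
                | cwalk tc x y p.1 p.2] | k <- iota 0 4].

Lemma mem_walks tc (x y : nat) (vs : seq nat) el : {subset vs <= iota 0 4} ->
  cwalk tc x y vs el -> (vs, el) \in walks tc x y.
Proof.
move=> Hv W; case/and5P: (W) => /eqP Hs _ _ uv /and3P[ue /allP He _].
apply/flattenP; exists [seq p <- [seq (w, el) | w <- filter uniq (words (iota 0 4) (size el).+1),
   el <- filter uniq (words tc (size el))] | cwalk tc x y p.1 p.2].
  apply/mapP; exists (size el) => //; rewrite mem_iota /= add0n -Hs.
  by have := uniq_leq_size uv Hv.
rewrite mem_filter W andTb; apply/allpairsP; exists (vs, el); split=> //.
  by rewrite mem_filter uv -Hs mem_words.
by rewrite mem_filter ue mem_words.
Qed.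

Lemma decode_inj l l' : {subset l <= iota 0 4} -> {subset l' <= iota 0 4} ->
  decode l = decode l' -> l =i l'.
Proof.
move=> H H' /setP E i; case: (ltnP i 4) => i4.
  by have := E (Ordinal i4); rewrite !inE.
by apply/idP/idP => [/H|/H']; rewrite mem_iota /= ltnNge i4.
Qed.

(** Strictly increasing lists serve as canonical codes: on them [decode] is injective. *)
Definition code_ok tc := all (all (mem (iota 0 4))) tc && all (sorted ltn) tc.

Lemma decode_inj_ok tc : code_ok tc -> {in tc &, injective decode}.
Proof.
case/andP=> /allP H1 /allP H2 l l' Hl Hl' E.
apply: (irr_sorted_eq ltn_trans ltnn) (H2 _ Hl) (H2 _ Hl') _.
by apply: decode_inj E; apply/allP; [exact: H1 | exact: H1].
Qed.

Lemma is_walk_cwalk tc x y vs es : code_ok tc -> is_walk (decodes tc) x y vs es ->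
  exists2 el, es = map decode el & cwalk tc x y (map val vs) el.
Proof.
move=> ok [Hs [Hh Hl] [uv ue] He Hk].
have [el Eel Hel] : exists2 el, es = map decode el & all (mem tc) el.
  elim: (es) He => [|E es' IH] /=; first by exists [::].
  case/andP; rewrite inE => /mapP[l lt ->] /IH[el -> Hel].
  by exists (l :: el) => //=; rewrite lt.
exists el => //; rewrite /cwalk Hel size_map Hs Eel size_map eqxx (map_inj_uniq val_inj) uv.
have -> : head (x : nat) (map val vs) == x by case: (vs) Hh => //= a s ->.
have -> : last (x : nat) (map val vs) == y by rewrite last_map Hl.
rewrite (map_uniq (f := decode)) -?Eel //=; apply/allP=> k; rewrite mem_iota add0n => /andP[_ ke].
have ks : k < size es by rewrite Eel size_map.
have k1 : k < size vs by rewrite Hs ltnS ltnW.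
have k2 : k.+1 < size vs by rewrite Hs ltnS.
have [] := Hk k ks; rewrite Eel !(nth_map [::]) // !inE.
by rewrite (nth_map x _ _ k1) (nth_map x _ _ k2) => -> ->.
Qed.

Lemma cwalk_is_walk tc x y vs el : code_ok tc -> cwalk tc x y (map val vs) el ->
  is_walk (decodes tc) x y vs (map decode el).
Proof.
move=> ok /and5P[/eqP Hs Hh Hl uv /and3P[ue /allP He /allP Hk]].
rewrite size_map in Hs; split.
- by rewrite size_map.
- split; first by case: (vs) Hh => //= a s /eqP/val_inj.
  by apply: val_inj; rewrite /= -(last_map val); apply/eqP.
- split; first by rewrite (map_inj_uniq val_inj) in uv.
  by rewrite map_inj_in_uniq // => l l' /He /= Hl' /He /= Hl''; apply: (decode_inj_ok ok).
- by apply/allP=> E /mapP[l /He lt ->]; rewrite inE map_f.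
- move=> k; rewrite size_map => ke.
  have := Hk k; rewrite mem_iota add0n ke => /(_ isT).
  have k1 : k < size vs by rewrite Hs ltnS ltnW.
  have k2 : k.+1 < size vs by rewrite Hs ltnS.
  by rewrite (nth_map x _ _ k1) (nth_map x _ _ k2) !(nth_map [::]) // !inE => /andP[-> ->].
Qed.

(** A list of walks of length one expresses existence and uniqueness at once. *)
Definition hypertreeb tc := [&& code_ok tc, all (fun l => 1 < size l) tc &
  all (fun i => all (fun j => size (walks tc i j) == 1) (iota 0 4)) (iota 0 4)].

Lemma mem_val vs : {subset map val vs <= iota 0 4}.
Proof. by move=> z /mapP[a _ ->]; rewrite mem_iota /= ltn_ord. Qed.

Lemma mem_iota4 (x : 'I_4) : (x : nat) \in iota 0 4.
Proof. by rewrite mem_iota /= ltn_ord. Qed.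

Lemma card_decode l : sorted ltn l -> all (mem (iota 0 4)) l -> #|decode l| = size l.
Proof.
move=> sl Hl.
have ul : uniq (pmap (@insub nat (fun i => i < 4) 'I_4) l).
  by rewrite (pmap_sub_uniq) // (sorted_uniq ltn_trans ltnn).
have -> : decode l = [set i in pmap (@insub nat (fun i => i < 4) 'I_4) l].
  by apply/setP=> i; rewrite !inE mem_pmap_sub.
rewrite cardsE (card_uniqP ul) size_pmap_sub; apply/eqP; rewrite -all_count.
apply/allP=> z zl; have : z \in iota 0 4 := allP Hl z zl.
by rewrite mem_iota.
Qed.

Lemma hypertreebP tc : hypertreeb tc -> is_hypertree (decodes tc).
Proof.
case/and3P=> ok H2 HW; split.
  move=> E; rewrite inE => /mapP[l lt ->]; case/andP: (ok) => /allP/(_ l lt) H /allP/(_ l lt) H'.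
  by rewrite card_decode //; apply: (allP H2).
move=> x y; have /eqP := allP (allP HW x (mem_iota4 x)) y (mem_iota4 y).
case E: (walks tc x y) => [|[vs el] [|]] // _.
have /flattenP [s /mapP[k _ ->]] : (vs, el) \in walks tc x y by rewrite E mem_head.
rewrite mem_filter => /andP[W /allpairsP[p [Hv _ [ev _]]]].
have Eus : map val (map (@inord 3) vs) = vs.
  move: Hv; rewrite -ev mem_filter => /andP[_ /words_sub Hv].
  rewrite -map_comp map_id_in // => z zv /=; rewrite inordK //.
  by move: (Hv z zv); rewrite mem_iota.
rewrite -Eus in W; exists (map (@inord 3) vs), (map decode el).
split; first exact: cwalk_is_walk.
move=> vs1 es1 /(is_walk_cwalk ok)[el1 -> W1].
have := mem_walks (@mem_val vs1) W1; rewrite E inE => /eqP[e1 ->]; split=> //.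
by apply: (inj_map val_inj); rewrite Eus.
Qed.

Definition carriesb tc (i : nat) (dl : seq nat) :=
  all (fun d => all (fun j => [|| j \in dl, j == i |
    all (fun p => i \in p.1) (walks tc d j)]) (iota 0 4)) dl.

Lemma carriesbP tc (i : 'I_4) dl : code_ok tc -> carriesb tc i dl ->
  carries (decodes tc) i (decode dl).
Proof.
move=> ok /allP H d j; rewrite !inE => ddl jdl ji vs es /(is_walk_cwalk ok)[el _ W].
have := allP (H _ ddl) _ (mem_iota4 j); rewrite (negbTE jdl).
have -> /= : ((j : nat) == i) = false by apply/negbTE.
move=> /allP/(_ _ (mem_walks (@mem_val vs) W)) /= /mapP[z zv e].
by rewrite (val_inj e).
Qed.

End Codes.

Section MoreCodes.
Implicit Types (l : seq nat) (tc el : seq (seq nat)).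

Definition foldb tc l1 l2 tc' :=
  let tc2 := [seq i <- iota 0 4 | (i \in l1) || (i \in l2)] ::
             [seq l <- tc | (l != l1) && (l != l2)] in
  [&& code_ok tc, l1 \in tc, l2 \in tc, l1 != l2, has (mem l1) l2,
      all (mem tc') tc2 & all (mem tc2) tc'].

Lemma foldbP tc l1 l2 tc' : foldb tc l1 l2 tc' -> fold_step (decodes tc) (decodes tc').
Proof.
case/and5P=> ok H1 H2 ne /and3P[/hasP[i i2 i1'] /allP S1 /allP S2].
have i1 : i \in l1 := i1'.
have inj := decode_inj_ok ok.
apply/existsP; exists (decode l1); apply/existsP; exists (decode l2).
have l4 : i < 4.
  have : i \in iota 0 4 by case/andP: ok => /allP/(_ _ H1)/allP/(_ _ i1).
  by rewrite mem_iota.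
apply/and5P; split; rewrite ?inE ?map_f //.
- by apply: contraNneq ne => /inj ->.
- by apply/set0Pn; exists (Ordinal l4); rewrite !inE i1.
have E12 : decode l1 :|: decode l2 = decode [seq i <- iota 0 4 | (i \in l1) || (i \in l2)].
  by apply/setP=> j; rewrite !inE mem_filter mem_iota4 andbT.
apply/eqP/setP=> E; rewrite E12 !inE; apply/idP/idP.
  case/mapP=> l lt'; have {lt'} := S2 l lt'.
  rewrite [mem _ l]inE => /orP[/eqP-> ->|]; first by rewrite eqxx orbT.
  rewrite mem_filter => /andP[/andP[n1 n2] lt] ->; rewrite map_f // andbT.
  by rewrite (inj_in_eq inj lt H1) (inj_in_eq inj lt H2) n1 n2.
case/orP=> [/and3P[n2 n1 /mapP[l lt El]]|/eqP ->]; last first.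
  by apply: map_f; apply: S1; rewrite mem_head.
rewrite El; apply: map_f; apply: S1; rewrite inE mem_filter lt andbT orbC.
by apply/orP; left; apply/andP; split; apply/negP=> /eqP e; move: n1 n2; rewrite El e eqxx.
Qed.

Definition foldsb tc tc' := has (fun l1 => has (fun l2 => foldb tc l1 l2 tc') tc) tc.

Lemma foldsbP tc tc' : foldsb tc tc' -> fold_step (decodes tc) (decodes tc').
Proof. by case/hasP=> l1 _ /hasP[l2 _ /foldbP]. Qed.

Lemma decodes_neq tc tc' : code_ok (tc ++ tc') -> ~~ all (mem tc') tc ->
  decodes tc != decodes tc'.
Proof.
move=> ok; apply: contraNneq => E; apply/allP=> l lt.
have : decode l \in decodes tc' by rewrite -E inE map_f.
rewrite inE => /mapP[l' l't e]; rewrite (decode_inj_ok ok _ _ e) //.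
  by rewrite mem_cat lt.
by rewrite mem_cat l't orbT.
Qed.

Lemma card_decodes tc : code_ok tc -> uniq tc -> #|decodes tc| = size tc.
Proof.
move=> ok u; rewrite cardsE -(size_map decode); apply/card_uniqP.
by rewrite map_inj_in_uniq //; apply: decode_inj_ok.
Qed.

End MoreCodes.

(** * The four kinds of hypertrees on four vertices *)

Section Trees4.
Implicit Types c l m k p q r s : 'I_4.

Definition nuc : {set {set 'I_4}} := [set setT].
(** The leaf [l] hangs on [c], which separates it from the other two vertices; this is why [pc c
    [set l]] is carried. *)
Definition rk c l : {set {set 'I_4}} := [set [set c; l]; [set~ l]].
Definition star c : {set {set 'I_4}} := [set [set c; x] | x in [set~ c]].
Definition path4 p q r s : {set {set 'I_4}} := [set [set p; q]; [set q; r]; [set r; s]].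

Let pairc (a b : nat) := [seq i <- iota 0 4 | (i == a) || (i == b)].
Let nucc := [:: iota 0 4].
Let rkc (c l : nat) := [:: pairc c l; [seq i <- iota 0 4 | i != l]].
Let starc (c : nat) := [seq pairc c x | x <- iota 0 4 & x != c].
Let pathc (p q r s : nat) := [:: pairc p q; pairc q r; pairc r s].

Let decode_pair (a b : 'I_4) : decode (pairc a b) = [set a; b].
Proof. by apply/setP=> i; rewrite !inE mem_filter mem_iota4 andbT. Qed.

Let nucE : nuc = decodes nucc.
Proof.
apply/setP=> E; rewrite !inE; congr (E == _).
by apply/setP=> i; rewrite in_setT in_set mem_iota4.
Qed.

Let rkE c l : rk c l = decodes (rkc c l).
Proof.
apply/setP=> E; rewrite !inE decode_pair; congr (_ || (E == _)).
by apply/setP=> i; rewrite !inE mem_filter mem_iota4 andbT.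
Qed.

Let starE c : star c = decodes (starc c).
Proof.
apply/setP=> E; rewrite inE; apply/imsetP/mapP.
  case=> x; rewrite !inE => xc ->; exists (pairc c x); rewrite ?decode_pair //.
  by apply/mapP; exists (x : nat) => //; rewrite mem_filter mem_iota4 andbT.
case=> l /mapP[x]; rewrite mem_filter mem_iota => /andP[xc /andP[_ x4]] -> ->.
by exists (Ordinal x4); rewrite ?inE // -decode_pair.
Qed.

Let pathE p q r s : path4 p q r s = decodes (pathc p q r s).
Proof. by apply/setP=> E; rewrite !inE !decode_pair -orbA. Qed.

(** A check over all quadruples of distinct numbers below 4, in a form that [vm_compute] decides. *)
Let all4 (P : nat -> nat -> nat -> nat -> bool) :=
  all (fun a => all (fun b => all (fun d => all (fun e =>
    if uniq [:: a; b; d; e] then P a b d e else true) (iota 0 4)) (iota 0 4)) (iota 0 4)) (iota 0 4).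

Let all4P P c l m k : all4 P -> uniq [:: c; l; m; k] -> P c l m k.
Proof.
move=> H u; have := allP (allP (allP (allP H c (mem_iota4 c)) l (mem_iota4 l)) m (mem_iota4 m)) k
  (mem_iota4 k).
by case: ifP => // /negP[]; rewrite -[X in uniq X]/(map val [:: c; l; m; k]) (map_inj_uniq val_inj).
Qed.

Lemma nuc_hypertree : is_hypertree nuc.
Proof. by rewrite nucE; apply: hypertreebP; vm_compute. Qed.

Lemma hypertrees4 c l m k : uniq [:: c; l; m; k] ->
  [/\ is_hypertree (rk c l), is_hypertree (star c) & is_hypertree (path4 c l m k)].
Proof.
rewrite rkE starE pathE => u.
have H : all4 (fun (c l m k : nat) => [&& hypertreeb (rkc c l), hypertreeb (starc c) &
  hypertreeb (pathc c l m k)]) by vm_compute.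
by case/and3P: (all4P H u) => H1 H2 H3; split; apply: hypertreebP.
Qed.

(** Merging the two hyperedges of the path away from an end leaves that end as a leaf on its
    neighbour: [k] on [m], or [c] on [l]. *)
Lemma folds4 c l m k : uniq [:: c; l; m; k] ->
  [/\ ht_le nuc (rk c l), ht_le (rk c l) (star c),
      ht_le (rk m k) (path4 c l m k) & ht_le (rk l c) (path4 c l m k)].
Proof.
rewrite !rkE starE pathE nucE => u.
have H : all4 (fun (c l m k : nat) => [&& foldsb (rkc c l) nucc, foldsb (starc c) (rkc c l),
  foldsb (pathc c l m k) (rkc m k) & foldsb (pathc c l m k) (rkc l c)]) by vm_compute.
by case/and4P: (all4P H u) => H1 H2 H3 H4; split; apply: ht_le_fold; apply: foldsbP.
Qed.

Lemma carries4 c l m k : uniq [:: c; l; m; k] ->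
  [/\ carries (rk c l) c [set l], carries (star c) c [set l],
      carries (path4 c l m k) m [set k] & carries (path4 c l m k) l [set c]].
Proof.
rewrite !rkE starE pathE => u.
have H : all4 (fun (c l m k : nat) => [&& code_ok (rkc c l), code_ok (starc c), code_ok (pathc c l m k),
  carriesb (rkc c l) c [:: l], carriesb (starc c) c [:: l],
  carriesb (pathc c l m k) m [:: k] & carriesb (pathc c l m k) l [:: c]]) by vm_compute.
have E (x : 'I_4) : [set x] = decode [:: x : nat] by apply/setP=> i; rewrite !inE.
rewrite !E.
case/and5P: (all4P H u) => H1 H2 H3 H4 /and3P[H5 H6 H7].
by split; apply: carriesbP.
Qed.

Lemma cards4 c l m k : uniq [:: c; l; m; k] ->
  [/\ #|nuc| = 1, #|rk c l| = 2, #|star c| = 3 & #|path4 c l m k| = 3].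
Proof.
rewrite !rkE starE pathE nucE => u.
have H : all4 (fun (c l m k : nat) => all (fun tc => code_ok tc && uniq tc)
  [:: nucc; rkc c l; starc c; pathc c l m k] && (size (starc c) == 3)) by vm_compute.
case/andP: (all4P H u) => /and5P[/andP[? ?] /andP[? ?] /andP[? ?] /andP[? ?] _] /eqP E.
by rewrite !card_decodes.
Qed.

Lemma neqs4 c l m k : uniq [:: c; l; m; k] ->
  [/\ rk c l != rk c m, rk c l != rk l c, rk c l != rk m k & rk c l != rk l m] /\
  [/\ star c != path4 c l m k, star l != path4 c l m k, star m != path4 c l m k &
      star k != path4 c l m k].
Proof.
rewrite !rkE !starE !pathE => u.
pose L (c l m k : nat) :=
  [:: (rkc c l, rkc c m); (rkc c l, rkc l c); (rkc c l, rkc m k); (rkc c l, rkc l m);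
      (starc c, pathc c l m k); (starc l, pathc c l m k); (starc m, pathc c l m k);
      (starc k, pathc c l m k)].
have H : all4 (fun (c l m k : nat) =>
  all (fun t => code_ok (t.1 ++ t.2) && ~~ all (mem t.2) t.1) (L c l m k)) by vm_compute.
have K t : t \in L c l m k -> decodes t.1 != decodes t.2.
  by move=> tL; have /andP[h1 h2] := allP (all4P H u) t tL; apply: decodes_neq.
split; split.
- by apply: (K (_, _)); rewrite !inE eqxx.
- by apply: (K (_, _)); rewrite !inE eqxx ?orbT.
- by apply: (K (_, _)); rewrite !inE eqxx ?orbT.
- by apply: (K (_, _)); rewrite !inE eqxx ?orbT.
- by apply: (K (_, _)); rewrite !inE eqxx ?orbT.
- by apply: (K (_, _)); rewrite !inE eqxx ?orbT.
- by apply: (K (_, _)); rewrite !inE eqxx ?orbT.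
- by apply: (K (_, _)); rewrite !inE eqxx ?orbT.
Qed.

End Trees4.

(** * Chains and points *)

HB.instance Definition _ := Monoid.isComLaw.Build R R0 Rplus
  (fun x y z => esym (Rplus_assoc x y z)) Rplus_comm Rplus_0_l.

Section Vertices.
Variable n : nat.
Implicit Types (u v w x y : vtx n) (s : seq (vtx n)).

Lemma vequiv_valid u v : vequiv u v -> valid_vtx u <-> valid_vtx v.
Proof.
case: u v => a T [b L] [/= -> R]; rewrite /valid_vtx /=.
by have := rel_aut0 R; tauto.
Qed.

Lemma vequiv_refl v : valid_vtx v -> vequiv v v.
Proof. by case=> [/is_aut0_hom h _]; split=> //; apply: rel_refl. Qed.

Lemma vequiv_sym u v : valid_vtx u -> vequiv u v -> vequiv v u.
Proof. by case=> A _ [E R]; split=> //; rewrite -E; apply: rel_sym. Qed.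

Lemma vequiv_trans u v w : valid_vtx v -> vequiv u v -> vequiv v w -> vequiv u w.
Proof.
move=> Hv uv vw; have [A _] := proj2 (vequiv_valid uv) Hv.
case: uv vw => [E R] [E' R']; split; first by rewrite E.
by apply: rel_trans A R _; rewrite E.
Qed.

Definition veq u v : bool := if excluded_middle_informative (vequiv u v) then true else false.

Lemma veqP u v : reflect (vequiv u v) (veq u v).
Proof. by rewrite /veq; case: excluded_middle_informative => H; constructor. Qed.

Lemma veqC u v : valid_vtx u -> valid_vtx v -> veq u v = veq v u.
Proof. by move=> Hu Hv; apply/veqP/veqP; apply: vequiv_sym. Qed.

Lemma veq_refl v : valid_vtx v -> veq v v.
Proof. by move=> H; apply/veqP; apply: vequiv_refl. Qed.

Lemma veq_congl u u' v : valid_vtx v -> vequiv u u' -> veq u v = veq u' v.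
Proof.
move=> Hv uu'; apply/veqP/veqP => H.
  have Hu := proj2 (vequiv_valid H) Hv.
  exact: vequiv_trans Hu (vequiv_sym Hu uu') H.
have Hu' := proj2 (vequiv_valid H) Hv.
exact: vequiv_trans Hu' uu' H.
Qed.

Definition comparable u v := vle u v \/ vle v u.
Definition adj u v := [/\ valid_vtx u, valid_vtx v, ~ vequiv u v & comparable u v].

Lemma adj_sym u v : adj u v -> adj v u.
Proof.
case=> Hu Hv ne c; split=> //; first by move=> /(vequiv_sym Hv).
by case: c; [right | left].
Qed.

Lemma In_nth s x : List.In x s -> exists2 i, i < size s & nth (@vdef n) s i = x.
Proof.
elim: s => //= a s IH [->|/IH[i Hi <-]]; first by exists 0.
by exists i.+1.
Qed.

Lemma nth_In s i : i < size s -> List.In (nth (@vdef n) s i) s.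
Proof. by elim: s i => // a s IH [|i] /= Hi; [left | right; apply: IH]. Qed.

Lemma is_chain_cons u s :
  is_chain (u :: s) <-> [/\ valid_vtx u, forall v, List.In v s -> adj u v & is_chain s].
Proof.
split=> [[H1 H2]|[Hu Ha [H1 H2]]].
  split; first by apply: H1; left.
    move=> v /[dup] vs /In_nth[i Hi <-].
    have [ne c] := H2 0 i.+1 isT Hi (@O_S _).
    by split=> //; apply: H1; [left | right; apply: nth_In].
  split=> [v vs|i j Hi Hj ij]; first by apply: H1; right.
  by apply: (H2 i.+1 j.+1) => // -[].
split=> [v [<- //|]|[|i] [|j] Hi Hj ij //=]; first exact: H1.
- by have [_ _ ne c] := Ha _ (nth_In (Hj : j < size s)).
- by have /adj_sym[_ _ ne c] := Ha _ (nth_In (Hi : i < size s)).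
- by apply: H2 => // e; apply: ij; rewrite e.
Qed.

Lemma is_chain_nil : is_chain ([::] : seq (vtx n)). Proof. by split. Qed.

Lemma is_chain2 u v : is_chain [:: u; v] <-> adj u v.
Proof.
split=> [/is_chain_cons[_ H _]|H]; first by apply: H; left.
apply/is_chain_cons; have [Hu Hv _ _] := H; split=> // [w [<-|]|] //.
by apply/is_chain_cons; split=> //; apply: is_chain_nil.
Qed.

Lemma is_chain3 u v w : is_chain [:: u; v; w] <-> [/\ adj u v, adj u w & adj v w].
Proof.
split=> [/is_chain_cons[_ H /is_chain2 H']|[H1 H2 H3]].
  by split=> //; apply: H; [left | right; left].
apply/is_chain_cons; have [Hu Hv _ _] := H1; split=> // [x [<-|[<-|]]|] //.
exact/is_chain2.
Qed.

Lemma chain_valid s x : is_chain s -> List.In x s -> valid_vtx x.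
Proof. by case=> H _; apply: H. Qed.

Lemma chain_In s x y : is_chain s -> List.In x s -> List.In y s -> ~ vequiv x y -> adj x y.
Proof.
elim: s => // a s IH /is_chain_cons[Ha H Hs] /= [<-|xs] [<-|ys] ne.
- by case: ne; apply: vequiv_refl.
- exact: H.
- by apply: adj_sym; apply: H.
- exact: IH.
Qed.

Lemma vle_card u v : vle u v -> ~ vequiv u v -> #|u.2| < #|v.2|.
Proof.
case: u v => a T [b L] [/= /ht_leP[E|//] R] []; split=> //=.
by rewrite E.
Qed.

Lemma adj_card u v : adj u v -> #|u.2| != #|v.2|.
Proof.
case=> Hu Hv ne [/vle_card H|/vle_card H]; first by rewrite neq_ltn H.
by rewrite neq_ltn H ?orbT // => /(vequiv_sym Hv).
Qed.

(** The marking of a smaller vertex also marks every vertex above it, so a chain can be written with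
    the marking of its least member. *)
Lemma vle_min u v : valid_vtx u -> vle u v -> vequiv (u.1, v.2) v.
Proof. by case: u => a T [/= A _] [_ R]; split. Qed.

Local Open Scope R_scope.

Lemma sum_ext (F G : vtx n -> R) s : (forall a, List.In a s -> F a = G a) ->
  \big[Rplus/0]_(a <- s) F a = \big[Rplus/0]_(a <- s) G a.
Proof.
elim: s => [|a s IH] H; first by rewrite !big_nil.
by rewrite !big_cons IH ?H //; [left | move=> b bs; apply: H; right].
Qed.

Lemma sum_veq a c s : is_chain s -> (exists2 b, List.In b s & vequiv a b) ->
  \big[Rplus/0]_(b <- s) (if veq a b then c else 0) = c.
Proof.
have Z : forall r, (forall b, List.In b r -> ~ vequiv a b) ->
    \big[Rplus/0]_(b <- r) (if veq a b then c else 0) = 0.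
  elim=> [|b r IH] H; first by rewrite big_nil.
  rewrite big_cons IH => [|b' br]; last by apply: H; right.
  by case: veqP => [/H[]|_]; [left | lra].
elim: s => [|b s IH] => [_ [] //|/is_chain_cons[Hb H Hs] [b0]] /=.
rewrite big_cons => bs ab0; case: veqP => [ab|nab].
  rewrite Z; first lra.
  move=> b' /H[_ _ ne _] ab'; apply: ne.
  have Ha := proj2 (vequiv_valid ab) Hb.
  exact: vequiv_trans Ha (vequiv_sym Ha ab) ab'.
rewrite IH //; first lra.
by case: bs => [e|bs]; [case: nab; rewrite e | exists b0].
Qed.

(** A point has many supporting chains. Both sums equal the double sum over equivalent pairs from
    [s] and [s'], so a barycentric sum does not depend on the chain. *)
Lemma sum_switch (p F : vtx n -> R) s s' : is_chain s -> is_chain s' ->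
  (forall u v, vequiv u v -> p u = p v) -> (forall u v, vequiv u v -> F u = F v) ->
  supported p s -> supported p s' ->
  \big[Rplus/0]_(a <- s) (p a * F a) = \big[Rplus/0]_(a <- s') (p a * F a).
Proof.
move=> Hs Hs' pE FE S S'.
have E : forall a, List.In a s -> p a * F a =
    \big[Rplus/0]_(b <- s') (if veq a b then p b * F b else 0).
  move=> a /(chain_valid Hs) Ha; case: (Req_dec (p a) 0) => [p0|/S' [_ [b [bs ab]]]].
    rewrite p0 Rmult_0_l; elim: (s') => [|b r IH]; first by rewrite big_nil.
    rewrite big_cons -IH; case: veqP => [/pE <-|_]; first by rewrite p0; lra.
    by lra.
  have ex : exists2 b, List.In b s' & vequiv a b by exists b.
  rewrite -[LHS](sum_veq (p a * F a) Hs' ex).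
  by apply: sum_ext => b' _; case: veqP => // /[dup] /pE <- /FE <-.
rewrite (sum_ext E) exchange_big /=; apply: sum_ext => b bs.
have Hb := chain_valid Hs' bs.
case: (Req_dec (p b) 0) => [p0|/S [_ [a [as' ba]]]].
  rewrite p0 Rmult_0_l; elim: (s) => [|a r IH]; first by rewrite big_nil.
  by rewrite big_cons IH; case: veqP => _; lra.
have ex : exists2 a, List.In a s & vequiv b a by exists a.
rewrite -[RHS](sum_veq (p b * F b) Hs ex).
apply: sum_ext => a' as''; rewrite veqC //; exact: chain_valid as''.
Qed.

Lemma point_sum1 (p : vtx n -> R) s : is_point p -> is_chain s -> supported p s ->
  \big[Rplus/0]_(a <- s) p a = 1.
Proof.
move=> [pE [s' [Hs' S' _ <-]]] Hs S.
have := @sum_switch p (fun=> 1) s s' Hs Hs' pE (fun _ _ _ => erefl) S S'.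
by rewrite (@sum_ext _ p) ?(@sum_ext _ p s') // => a _; lra.
Qed.

Lemma point_ge0 (p : vtx n -> R) v : is_point p -> 0 <= p v.
Proof.
move=> [pE [s [Hs S P _]]]; case: (Req_dec (p v) 0) => [->|]; first lra.
by move=> /S [_ [u [us /pE ->]]]; apply: P.
Qed.

(** The weights sit on all representatives of the three classes, as [is_point] demands; a sum
    instead of nested tests keeps the formula symmetric. *)
Definition mk u v w (a b c : R) : vtx n -> R := fun x =>
  (if veq x u then a else 0) + (if veq x v then b else 0) + (if veq x w then c else 0).

Lemma mk_132 u v w a b c : mk u v w a b c = mk u w v a c b.
Proof. by apply: functional_extensionality => x; rewrite /mk; lra. Qed.

Lemma mk_0 u v w w' a b : mk u v w a b 0 = mk u v w' a b 0.
Proof.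
have Z (t : bool) : (if t then 0 else 0) = 0 by case: t.
by apply: functional_extensionality => x; rewrite /mk !Z.
Qed.

Lemma adj_veqF u v : adj u v -> veq u v = false.
Proof. by case=> _ _ ne _; apply/veqP. Qed.

Lemma mk_sum u v w a b c (F : vtx n -> R) : is_chain [:: u; v; w] ->
  \big[Rplus/0]_(x <- [:: u; v; w]) (mk u v w a b c x * F x) = a * F u + b * F v + c * F w.
Proof.
move=> /is_chain3[uv uw vw]; have [Hu Hv _ _] := uv; have [_ Hw _ _] := uw.
rewrite !big_cons big_nil /mk !veq_refl // !adj_veqF //; try exact: adj_sym.
lra.
Qed.

Lemma mk_supported u v w a b c : is_chain [:: u; v; w] -> supported (mk u v w a b c) [:: u; v; w].
Proof.
move=> [H _] x; rewrite /mk.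
have K y : List.In y [:: u; v; w] -> vequiv x y ->
    valid_vtx x /\ exists y, List.In y [:: u; v; w] /\ vequiv x y.
  by move=> yu xy; split; [apply: (proj2 (vequiv_valid xy)); apply: H | exists y].
case: veqP => [xu|_]; first by move=> _; apply: K xu; left.
case: veqP => [xv|_]; first by move=> _; apply: K xv; right; left.
case: veqP => [xw|_]; first by move=> _; apply: K xw; right; right; left.
by move=> []; lra.
Qed.

Lemma mk_point u v w a b c : is_chain [:: u; v; w] -> 0 <= a -> 0 <= b -> 0 <= c ->
  a + b + c = 1 -> is_point (mk u v w a b c).
Proof.
move=> H a0 b0 c0 E; have Hv y := chain_valid H (x := y); split.
  move=> x y xy; rewrite /mk !(veq_congl _ xy) //; apply: Hv; rewrite /=; tauto.
exists [:: u; v; w]; split=> //; first exact: mk_supported.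
  by move=> x _; rewrite /mk; do 3!case: ifP => _; lra.
have := mk_sum a b c (fun=> 1) H; rewrite (@sum_ext _ (mk u v w a b c)) => [->|x _]; lra.
Qed.

Lemma mk_at u v w a b c : is_chain [:: u; v; w] ->
  [/\ mk u v w a b c u = a, mk u v w a b c v = b & mk u v w a b c w = c].
Proof.
move=> /is_chain3[uv uw vw]; have [Hu Hv _ _] := uv; have [_ Hw _ _] := uw.
rewrite /mk !veq_refl // !adj_veqF //; try exact: adj_sym.
by split; lra.
Qed.

Definition vact (f : hom n) v : vtx n := (hcomp f v.1, v.2).

Lemma vact_valid f v : is_aut0 f -> valid_vtx v -> valid_vtx (vact f v).
Proof. by move=> Hf [H1 H2]; split=> //=; apply: is_aut0_comp. Qed.

Lemma vact_equiv f u v : is_aut0 f -> valid_vtx v -> vequiv (vact f u) (vact f v) <-> vequiv u v.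
Proof.
move=> Hf Hv; have hf := is_aut0_hom Hf; split=> [[/= E R]|e]; last first.
  have [[Hu _] [E R]] := (proj2 (vequiv_valid e) Hv, e).
  by split=> //=; apply: rel_hcomp R => //; apply: is_aut0_hom.
have Hfv : is_aut0 (hcomp f v.1) by case: (vact_valid Hf Hv).
have Hfu := proj2 (rel_aut0 R) Hfv.
have [g [Hg fg gf]] := is_aut0_inv Hf; have hg := is_aut0_hom Hg.
have gK a : heq (hcomp g (hcomp f a)) a.
  apply: heq_trans (heq_sym (hcompA _ _ hg)) _.
  exact: heq_trans (hcomp_heql _ gf) (hcomp1f _).
have Hu : is_aut0 u.1 by apply: is_aut0_heq (gK _) _; apply: is_aut0_comp.
have R' := rel_hcomp hg (is_aut0_hom Hfu) R.
have R1 : rel_carried u.2 u.1 (hcomp g (hcomp f u.1)).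
  by apply: rel_heq; [exact: is_aut0_hom | apply: heq_sym].
have R2 : rel_carried u.2 (hcomp g (hcomp f v.1)) v.1.
  by apply: rel_heq => //; apply: is_aut0_hom; apply: is_aut0_comp.
by split=> //; apply: rel_trans Hu R1 _; apply: rel_trans R' R2; apply: is_aut0_comp.
Qed.

(** [pull f] moves points by the inverse of [f]. *)
Lemma pull_mk f u v w a b c : is_aut0 f -> valid_vtx u -> valid_vtx v -> valid_vtx w ->
  pull f (mk (vact f u) (vact f v) (vact f w) a b c) = mk u v w a b c.
Proof.
move=> Hf Hu Hv Hw; apply: functional_extensionality => x; rewrite /pull /mk.
have E y : valid_vtx y -> veq (hcomp f x.1, x.2) (vact f y) = veq x y.
  by move=> Hy; apply/veqP/veqP => /(vact_equiv x Hf Hy).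
by rewrite !E.
Qed.

Lemma vact_adj f u v : is_aut0 f -> adj u v -> adj (vact f u) (vact f v).
Proof.
move=> Hf [Hu Hv ne c]; split; try exact: vact_valid.
  by move=> /(vact_equiv _ Hf Hv).
have hf := is_aut0_hom Hf.
by case: c => -[H R]; [left | right]; split=> //=; apply: rel_hcomp R => //;
   apply: is_aut0_hom; [case: Hu | case: Hv].
Qed.

End Vertices.

Local Open Scope R_scope.

(** * Model planes *)

Definition vec := (R * R * R)%type.
(** Multiples are written [lin k V 0 V], so that one operation serves for convex combinations and
    for rescaling. *)
Definition lin (a : R) (V : vec) (b : R) (W : vec) : vec :=
  (a * V.1.1 + b * W.1.1, a * V.1.2 + b * W.1.2, a * V.2 + b * W.2).
Definition rot (t : R) (V : vec) : vec :=
  (V.1.1, V.1.2 * cos t - V.2 * sin t, V.1.2 * sin t + V.2 * cos t).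
(** A linear functional: its kernel is a line of the plane, and its sign tells the two sides
    apart. *)
Definition ev (k : vec) (V : vec) : R := k.1.1 * V.1.1 + k.1.2 * V.1.2 + k.2 * V.2.
Definition vsum n (s : seq (vtx n)) (p : vtx n -> R) (f : vtx n -> vec) : vec :=
  (\big[Rplus/0]_(a <- s) (p a * (f a).1.1), \big[Rplus/0]_(a <- s) (p a * (f a).1.2),
   \big[Rplus/0]_(a <- s) (p a * (f a).2)).

(* The Euclidean and the hyperbolic plane in homogeneous (projective) coordinates, so that the
   barycentric coordinates of both kinds of simplices are linear; pol is the polar
   parametrization around the point (1,0,0). *)
Record plane := Plane {
  md : vec -> vec -> R;
  dom : vec -> Prop;
  mC : R -> R;
  mS : R -> R;
  cosang : R -> R -> R -> R;
  pol := fun l t => (mC l, mS l * cos t, mS l * sin t) : vec;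
  md_ge0 : forall V W, dom V -> dom W -> 0 <= md V W;
  md_sym : forall V W, md V W = md W V;
  md_refl : forall V, dom V -> md V V = 0;
  md_tri : forall U V W, dom U -> dom V -> dom W -> md U W <= md U V + md V W;
  dom_lin : forall a b V W, 0 <= a -> 0 <= b -> 0 < a + b -> dom V -> dom W -> dom (lin a V b W);
  md_add : forall a b V W, 0 <= a -> 0 <= b -> 0 < a + b -> dom V -> dom W ->
    md V (lin a V b W) + md (lin a V b W) W = md V W;
  md_scale : forall k V W, 0 < k -> dom V -> dom W -> md (lin k V 0 V) W = md V W;
  md_pos : forall a b V W, 0 <= a -> 0 < b -> dom V -> dom W -> 0 < md V W -> 0 < md V (lin a V b W);
  md_rot : forall t V W, dom V -> dom W -> md (rot t V) (rot t W) = md V W;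
  md_gap : forall k c, dom c -> 0 < ev k c ->
    exists2 r, 0 < r & forall Y, dom Y -> ev k Y <= 0 -> r <= md c Y;
  md_cont : forall V W e, dom V -> dom W -> 0 < e ->
    exists2 r, 0 < r & forall t, 0 <= t <= 1 -> t < r -> md V (lin (1 - t) V t W) < e;
  mC_gt0 : forall l, 0 <= l -> 0 < mC l;
  mS_gt0 : forall l, 0 < l -> 0 < mS l;
  dom_pol : forall l t, 0 <= l -> dom (pol l t);
  dom_o : dom (1, 0, 0);
  md_o : forall l t, 0 <= l -> md (1, 0, 0) (pol l t) = l;
  md_pol : forall a b c s t, 0 < a -> 0 < b -> 0 < c -> cos (s - t) = cosang a b c ->
    md (pol a s) (pol b t) = c;
  cosang_sym : forall a b c, cosang a b c = cosang b a c;
  angle_sum : forall a b c, 0 < a -> 0 < b -> 0 < c -> -1 < cosang a b c < 1 ->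
    -1 < cosang a c b < 1 -> -1 < cosang b c a < 1 ->
    acos (cosang a b c) + acos (cosang a c b) + acos (cosang b c a) <= PI;
  md_inj : forall l l' t, 0 < l -> 0 < l' -> 0 < t < 1 -> t <> /2 ->
    md (lin (/2) (1, 0, 0) (/2) (pol l 0)) (lin (1 - t) (1, 0, 0) t (pol l 0)) =
    md (lin (/2) (1, 0, 0) (/2) (pol l' 0)) (lin (1 - t) (1, 0, 0) t (pol l' 0)) -> l = l'
}.

(** [- cos (x + y)] is the cosine of [PI - x - y]. If the sum exceeded [PI], each inequality would
    bound one angle by the sum of the other two minus [PI]; two such bounds give [x >= PI]. *)
Lemma trig_angle_sum x y z : 0 < x < PI -> 0 < y < PI -> 0 < z < PI ->
  - cos (x + y) <= cos z -> - cos (x + z) <= cos y -> - cos (y + z) <= cos x -> x + y + z <= PI.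
Proof.
move=> Hx Hy Hz Hxy Hxz Hyz.
have dec a b : 0 <= a <= PI -> 0 <= b <= PI -> cos b <= cos a -> a <= b.
  by move=> [? ?] [? ?] ?; apply: cos_decr_0.
case: (Rle_dec (x + y + z) PI) => // /Rnot_le_lt big.
have K a b c : 0 < a < PI -> 0 < b < PI -> 0 < c < PI -> PI < a + b + c ->
    - cos (a + b) <= cos c -> c <= a + b - PI.
  move=> Ha Hb Hc Hs; case: (Rle_dec (a + b) PI) => [le|/Rnot_le_lt gt] H.
    suff : c <= PI - (a + b) by lra.
    apply: dec; try lra.
    by rewrite Rtrigo_facts.cos_pi_minus.
  apply: dec; try lra.
  rewrite (_ : a + b - PI = - (PI - (a + b))); last lra.
  by rewrite cos_neg Rtrigo_facts.cos_pi_minus.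
have := K _ _ _ Hx Hy Hz big Hxy.
have := K _ _ _ Hx Hz Hy _ Hxz.
lra.
Qed.

(** The angle sum is reduced to one inequality: the cosine of the third angle is at least that of
    the supplement of the other two. In the Euclidean plane it is an equality. *)
Lemma angle_sum_of (cosang : R -> R -> R -> R) :
  (forall a b c, cosang a b c = cosang b a c) ->
  (forall a b c, 0 < a -> 0 < b -> 0 < c -> -1 < cosang a b c < 1 -> -1 < cosang a c b < 1 ->
    - cos (acos (cosang a b c) + acos (cosang a c b)) <= cosang b c a) ->
  forall a b c, 0 < a -> 0 < b -> 0 < c -> -1 < cosang a b c < 1 ->
    -1 < cosang a c b < 1 -> -1 < cosang b c a < 1 ->
    acos (cosang a b c) + acos (cosang a c b) + acos (cosang b c a) <= PI.
Proof.
move=> sym K a b c a0 b0 c0 Hc Hb Ha.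
apply: trig_angle_sum; try exact: acos_bound_lt; rewrite (cos_acos (cosang _ _ _)); try lra.
- exact: K.
- by rewrite (sym a b); apply: K; rewrite // -sym.
- by rewrite (sym a c) (sym b c); apply: K => //; rewrite -sym.
Qed.

(** * The Euclidean plane in homogeneous coordinates *)

Section EuclideanPlane.

Definition edom (V : vec) : Prop := 0 < V.1.1.
Definition emd (V W : vec) : R :=
  dist_euc (V.1.2 / V.1.1) (V.2 / V.1.1) (W.1.2 / W.1.1) (W.2 / W.1.1).
Definition ecosang (a b c : R) : R := (a ^ 2 + b ^ 2 - c ^ 2) / (2 * a * b).

Lemma dist_euc_mul x y x' y' u v u' v' t : 0 <= t -> x - x' = t * (u - u') ->
  y - y' = t * (v - v') -> dist_euc x y x' y' = t * dist_euc u v u' v'.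
Proof.
move=> t0 E1 E2; rewrite /dist_euc E1 E2 !Rsqr_mult -Rmult_plus_distr_l.
by rewrite sqrt_mult ?sqrt_Rsqr //; [apply: Rle_0_sqr | apply: Rplus_le_le_0_compat; apply: Rle_0_sqr].
Qed.

(** In the affine chart the combination is the centre of mass of two points with masses [a * V.1.1]
    and [b * W.1.1]. *)
Lemma emd_lin a b V W : 0 <= a -> 0 <= b -> 0 < a + b -> edom V -> edom W ->
  0 < a * V.1.1 + b * W.1.1 /\
  emd V (lin a V b W) = b * W.1.1 / (a * V.1.1 + b * W.1.1) * emd V W.
Proof.
rewrite /edom => a0 b0 ab HV HW.
have Z : 0 < a * V.1.1 + b * W.1.1.
  case: a0 => [a0|a0]; last by subst a; nra.
  by have := Rmult_lt_0_compat _ _ a0 HV; nra.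
split=> //; apply: dist_euc_mul => /=.
- by apply: Rle_mult_inv_pos => //; nra.
- field; lra.
- field; lra.
Qed.

Lemma emd_ge0 V W : edom V -> edom W -> 0 <= emd V W.
Proof. by move=> _ _; apply: sqrt_pos. Qed.

Lemma emd_sym V W : emd V W = emd W V.
Proof. exact: distance_symm. Qed.

Lemma emd_refl V : edom V -> emd V V = 0.
Proof. by move=> _; apply: distance_refl. Qed.

Lemma emd_tri U V W : edom U -> edom V -> edom W -> emd U W <= emd U V + emd V W.
Proof. by move=> _ _ _; apply: triangle. Qed.

Lemma edom_lin a b V W : 0 <= a -> 0 <= b -> 0 < a + b -> edom V -> edom W -> edom (lin a V b W).
Proof. by move=> a0 b0 ab HV HW; case: (emd_lin a0 b0 ab HV HW). Qed.

Lemma lin_sym a V b W : lin a V b W = lin b W a V.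
Proof. by rewrite /lin; congr (_, _, _); lra. Qed.

Lemma emd_add a b V W : 0 <= a -> 0 <= b -> 0 < a + b -> edom V -> edom W ->
  emd V (lin a V b W) + emd (lin a V b W) W = emd V W.
Proof.
move=> a0 b0 ab HV HW; have [Z ->] := emd_lin a0 b0 ab HV HW.
rewrite [emd (lin _ _ _ _) W]emd_sym lin_sym.
have ba : 0 < b + a by lra.
have [Z' ->] := emd_lin b0 a0 ba HW HV.
rewrite [emd W V]emd_sym; field; lra.
Qed.

Lemma emd_scale k V W : 0 < k -> edom V -> edom W -> emd (lin k V 0 V) W = emd V W.
Proof.
rewrite /edom => k0 HV HW; rewrite -[RHS]Rmult_1_l; apply: dist_euc_mul; first lra.
  by rewrite /=; field; lra.
by rewrite /=; field; lra.
Qed.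

Lemma emd_pos a b V W : 0 <= a -> 0 < b -> edom V -> edom W -> 0 < emd V W -> 0 < emd V (lin a V b W).
Proof.
move=> a0 b0 HV HW m0; have ab : 0 < a + b by lra.
have [Z ->] := emd_lin a0 (Rlt_le _ _ b0) ab HV HW.
apply: Rmult_lt_0_compat => //; apply: Rdiv_lt_0_compat => //; exact: Rmult_lt_0_compat.
Qed.

Lemma emd_rot t V W : edom V -> edom W -> emd (rot t V) (rot t W) = emd V W.
Proof.
rewrite /edom => HV HW; rewrite /emd /dist_euc /rot /=; congr sqrt.
have E : sin t * sin t + cos t * cos t = 1 := sin2_cos2 t.
set x := V.1.2; set y := V.2; set z := V.1.1; set x' := W.1.2; set y' := W.2; set z' := W.1.1.
rewrite /Rsqr -[RHS]Rmult_1_r -E; field; rewrite /z /z'; lra.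
Qed.

Lemma abs_le_dist x y x' y' : Rabs (x - x') <= dist_euc x y x' y'.
Proof.
rewrite /dist_euc -sqrt_Rsqr_abs; apply: sqrt_le_1_alt.
by have := Rle_0_sqr (y - y'); lra.
Qed.

Lemma abs_le_dist2 x y x' y' : Rabs (y - y') <= dist_euc x y x' y'.
Proof.
rewrite /dist_euc -sqrt_Rsqr_abs; apply: sqrt_le_1_alt.
by have := Rle_0_sqr (x - x'); lra.
Qed.

(** In the affine chart the functional [k] is Lipschitz with constant [Rabs k.1.2 + Rabs k.2]; the
    added 1 makes the divisor positive. *)
Lemma dist_gap k V W : edom V -> edom W -> ev k W <= 0 ->
  ev k V / V.1.1 / (Rabs k.1.2 + Rabs k.2 + 1) <= emd V W.
Proof.
rewrite /edom => HV HW H; set K := _ + 1.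
have K0 : 0 < K by rewrite /K; have := Rabs_pos k.1.2; have := Rabs_pos k.2; lra.
apply: (Rmult_le_reg_r K) => //; rewrite /Rdiv (Rmult_assoc _ (/ K)) Rinv_l ?Rmult_1_r; last lra.
have e1 : ev k V * / V.1.1 = k.1.1 + k.1.2 * (V.1.2 / V.1.1) + k.2 * (V.2 / V.1.1).
  by rewrite /ev; field; lra.
have e2 : k.1.1 + k.1.2 * (W.1.2 / W.1.1) + k.2 * (W.2 / W.1.1) <= 0.
  have -> : k.1.1 + k.1.2 * (W.1.2 / W.1.1) + k.2 * (W.2 / W.1.1) = ev k W / W.1.1.
    by rewrite /ev; field; lra.
  by have := Rinv_0_lt_compat _ HW; rewrite /Rdiv; nra.
rewrite e1.
have h1 := abs_le_dist (V.1.2 / V.1.1) (V.2 / V.1.1) (W.1.2 / W.1.1) (W.2 / W.1.1).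
have h2 := abs_le_dist2 (V.1.2 / V.1.1) (V.2 / V.1.1) (W.1.2 / W.1.1) (W.2 / W.1.1).
rewrite -/(emd V W) in h1 h2; set x := V.1.2 / _ in e1 h1 *; set y := V.2 / _ in e1 h2 *.
set x' := W.1.2 / _ in e2 h1; set y' := W.2 / _ in e2 h2.
have a1 : k.1.2 * (x - x') <= Rabs k.1.2 * emd V W.
  apply: Rle_trans (Rle_abs _) _; rewrite Rabs_mult; apply: Rmult_le_compat_l => //; exact: Rabs_pos.
have a2 : k.2 * (y - y') <= Rabs k.2 * emd V W.
  apply: Rle_trans (Rle_abs _) _; rewrite Rabs_mult; apply: Rmult_le_compat_l => //; exact: Rabs_pos.
have a3 : 0 <= emd V W by apply: sqrt_pos.
rewrite /K; nra.
Qed.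

Lemma emd_gap k c : edom c -> 0 < ev k c ->
  exists2 r, 0 < r & forall Y, edom Y -> ev k Y <= 0 -> r <= emd c Y.
Proof.
move=> Hc kc; exists (ev k c / c.1.1 / (Rabs k.1.2 + Rabs k.2 + 1)).
  have := Rabs_pos k.1.2; have := Rabs_pos k.2; move: Hc; rewrite /edom => ? ? ?.
  by apply: Rdiv_lt_0_compat; [exact: Rdiv_lt_0_compat | lra].
by move=> Y HY; apply: dist_gap.
Qed.

Lemma emd_cont V W e : edom V -> edom W -> 0 < e ->
  exists2 r, 0 < r & forall t, 0 <= t <= 1 -> t < r -> emd V (lin (1 - t) V t W) < e.
Proof.
move=> HV HW e0; have m0 : 0 <= emd V W by apply: sqrt_pos.
have HV' : 0 < V.1.1 := HV; have HW' : 0 < W.1.1 := HW.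
set q := W.1.1 / V.1.1; have q0 : 0 < q by apply: Rdiv_lt_0_compat.
(* For [t < /2] the total mass is at least [V.1.1 / 2], whence the factor [2 * q]. *)
exists (Rmin (/2) (e / (2 * q * emd V W + 1))).
  apply: Rmin_pos; first lra.
  by apply: Rdiv_lt_0_compat => //; nra.
move=> t [t0 t1] tr.
have t2 : t < /2 by apply: Rlt_le_trans tr (Rmin_l _ _).
have t3 : t * (2 * q * emd V W + 1) < e.
  apply: (Rmult_lt_reg_r (/ (2 * q * emd V W + 1))).
    by apply: Rinv_0_lt_compat; nra.
  rewrite Rmult_assoc Rinv_r ?Rmult_1_r; last nra.
  by apply: Rlt_le_trans tr (Rmin_r _ _).
have t4 : 0 <= 1 - t by lra.
have t5 : 0 < 1 - t + t by lra.
have [Z ->] := emd_lin t4 t0 t5 HV HW.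
apply: Rle_lt_trans t3.
suff : t * W.1.1 / ((1 - t) * V.1.1 + t * W.1.1) <= t * (2 * q) by nra.
apply: (Rmult_le_reg_r ((1 - t) * V.1.1 + t * W.1.1)) => //.
rewrite /Rdiv (Rmult_assoc (t * _)) Rinv_l ?Rmult_1_r; last lra.
have : W.1.1 <= 2 * q * ((1 - t) * V.1.1).
  rewrite /q /Rdiv (_ : 2 * _ * _ = W.1.1 * (2 * (1 - t))); last by field; lra.
  by rewrite -{1}(Rmult_1_r W.1.1); apply: Rmult_le_compat_l; lra.
have q1 : 0 <= 2 * q * (t * W.1.1).
  by apply: Rmult_le_pos; [lra | apply: Rmult_le_pos; lra].
move=> h; have := Rmult_le_compat_l _ _ _ t0 h; have := Rmult_le_compat_l _ _ _ t0 q1; nra.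
Qed.

Definition epol (l t : R) : vec := (1, l * cos t, l * sin t).

Lemma emd_o l t : 0 <= l -> emd (1, 0, 0) (epol l t) = l.
Proof.
move=> l0; rewrite /emd /dist_euc /epol /= -[RHS](sqrt_Rsqr l) //; congr sqrt.
have := sin2_cos2 t; rewrite /Rsqr => E.
by rewrite !Rdiv_1_r; transitivity (l * l * (sin t * sin t + cos t * cos t)); [ring | rewrite E; ring].
Qed.

Lemma emd_pol a b c s t : 0 < a -> 0 < b -> 0 < c -> cos (s - t) = ecosang a b c ->
  emd (epol a s) (epol b t) = c.
Proof.
move=> a0 b0 c0; rewrite cos_minus /ecosang => E.
rewrite /emd /dist_euc /epol /= -[RHS](sqrt_Rsqr c); last lra.
congr sqrt; rewrite !Rdiv_1_r /Rsqr.
have E2 : 2 * a * b * (cos s * cos t + sin s * sin t) = a ^ 2 + b ^ 2 - c ^ 2.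
  by rewrite E; field; lra.
have e1 := sin2_cos2 s; have e2 := sin2_cos2 t; rewrite /Rsqr in e1 e2.
transitivity (a * a * (sin s * sin s + cos s * cos s) + b * b * (sin t * sin t + cos t * cos t)
  - 2 * a * b * (cos s * cos t + sin s * sin t)); first ring.
rewrite e1 e2 E2; ring.
Qed.

Lemma ecosang_sym a b c : ecosang a b c = ecosang b a c.
Proof.
by rewrite /ecosang (_ : 2 * a * b = 2 * b * a) ?(Rplus_comm (a ^ 2)) //; ring.
Qed.

Lemma ecosang_dual a b c : 0 < a -> 0 < b -> 0 < c ->
  -1 < ecosang a b c < 1 -> -1 < ecosang a c b < 1 ->
  - cos (acos (ecosang a b c) + acos (ecosang a c b)) <= ecosang b c a.
Proof.
move=> a0 b0 c0 H1 H2; rewrite cos_plus !cos_acos ?sin_acos; try lra.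
set D := 1 - (ecosang a b c)²; set D' := 1 - (ecosang a c b)².
have D0 : 0 <= D by rewrite /D /Rsqr; nra.
have D0' : 0 <= D' by rewrite /D' /Rsqr; nra.
(* By Heron's formula the numerator is 16 times the squared area, which both sines share. *)
suff -> : sqrt D * sqrt D' =
    (4 * a ^ 2 * b ^ 2 - (a ^ 2 + b ^ 2 - c ^ 2) ^ 2) / (4 * a ^ 2 * b * c).
  by apply: Req_le; rewrite /ecosang; field; lra.
have p0 : 0 <= (4 * a ^ 2 * b ^ 2 - (a ^ 2 + b ^ 2 - c ^ 2) ^ 2) / (4 * a ^ 2 * b * c).
  have -> : (4 * a ^ 2 * b ^ 2 - (a ^ 2 + b ^ 2 - c ^ 2) ^ 2) / (4 * a ^ 2 * b * c) =
     D * (b / c) by rewrite /D /ecosang /Rsqr; field; lra.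
  by apply: Rmult_le_pos => //; apply: Rlt_le; apply: Rdiv_lt_0_compat.
rewrite -sqrt_mult // -[RHS](sqrt_Rsqr _ p0); congr sqrt.
by rewrite /D /D' /ecosang /Rsqr; field; lra.
Qed.

(** It lets an edge length be recovered from the distance between the midpoint of the edge and
    another point with given barycentric weights. *)
Lemma emd_inj l l' t : 0 < l -> 0 < l' -> 0 < t < 1 -> t <> /2 ->
  emd (lin (/2) (1, 0, 0) (/2) (epol l 0)) (lin (1 - t) (1, 0, 0) t (epol l 0)) =
  emd (lin (/2) (1, 0, 0) (/2) (epol l' 0)) (lin (1 - t) (1, 0, 0) t (epol l' 0)) -> l = l'.
Proof.
move=> l0 l'0 Ht t2.
have E x : 0 < x -> emd (lin (/2) (1, 0, 0) (/2) (epol x 0)) (lin (1 - t) (1, 0, 0) t (epol x 0))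
    = Rabs (/2 - t) * x.
  move=> x0; rewrite /emd /dist_euc /epol /lin /= cos_0 sin_0.
  rewrite -[in RHS](Rabs_pos_eq x) -?Rabs_mult; last lra.
  rewrite -sqrt_Rsqr_abs; congr sqrt; rewrite /Rsqr; field; lra.
rewrite !E // => H; apply: Rmult_eq_reg_l H _.
by apply: Rabs_no_R0; lra.
Qed.

Definition planeE : plane := @Plane emd edom (fun=> 1) (fun l => l) ecosang emd_ge0 emd_sym emd_refl
  emd_tri edom_lin emd_add emd_scale emd_pos emd_rot emd_gap emd_cont (fun _ _ => Rlt_0_1) (fun _ h => h)
  (fun _ _ _ => Rlt_0_1) Rlt_0_1 emd_o emd_pol ecosang_sym (angle_sum_of ecosang_sym ecosang_dual)
  emd_inj.

End EuclideanPlane.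

(** * Hyperbolic functions *)

Section HyperbolicFunctions.

Lemma cosh2_sinh2 x : cosh x * cosh x - sinh x * sinh x = 1.
Proof.
rewrite /cosh /sinh; have E : exp x * exp (- x) = 1 by rewrite -exp_plus Rplus_opp_r exp_0.
nra.
Qed.

Lemma cosh_plus x y : cosh (x + y) = cosh x * cosh y + sinh x * sinh y.
Proof. rewrite /cosh /sinh Ropp_plus_distr !exp_plus; lra. Qed.

Lemma sinh_ge0 x : 0 <= x -> 0 <= sinh x.
Proof.
move=> x0; rewrite -(arcsinh_sinh x) -arcsinh_0 in x0.
by case: (Rle_dec 0 (sinh x)) => // /Rnot_le_lt/arcsinh_lt; lra.
Qed.

Lemma sinh_gt0 x : 0 < x -> 0 < sinh x.
Proof.
move=> x0; rewrite -(arcsinh_sinh x) -arcsinh_0 in x0.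
by case: (Rlt_dec 0 (sinh x)) => // /Rnot_lt_le/arcsinh_le; lra.
Qed.

Lemma cosh_ge1 x : 1 <= cosh x.
Proof.
have := cosh2_sinh2 x; have : 0 < cosh x.
  by rewrite /cosh; have := exp_pos x; have := exp_pos (- x); lra.
nra.
Qed.

Lemma sinh_le_inv x y : sinh x <= sinh y -> x <= y.
Proof. by move=> /arcsinh_le; rewrite !arcsinh_sinh. Qed.

Lemma sinh_lt_inv x y : sinh x < sinh y -> x < y.
Proof. by move=> /arcsinh_lt; rewrite !arcsinh_sinh. Qed.

Lemma cosh_le_inv x y : 0 <= x -> 0 <= y -> cosh x <= cosh y -> x <= y.
Proof.
move=> /sinh_ge0 x0 /sinh_ge0 y0 H; apply: sinh_le_inv.
have := cosh2_sinh2 x; have := cosh2_sinh2 y; have := cosh_ge1 x; nra.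
Qed.

Lemma cosh_inj x y : 0 <= x -> 0 <= y -> cosh x = cosh y -> x = y.
Proof. by move=> x0 y0 E; apply: Rle_antisym; apply: cosh_le_inv => //; lra. Qed.

Lemma arcosh_spec z : 1 <= z -> 0 <= arcosh z /\ cosh (arcosh z) = z.
Proof.
move=> z1; rewrite /arcosh; set q := sqrt _.
have q0 : 0 <= q by apply: sqrt_pos.
have q2 : q * q = z ^ 2 - 1 by apply: sqrt_sqrt; nra.
have p0 : 0 < z + q by lra.
split.
  rewrite -ln_1; case: (Req_dec (z + q) 1) => [->|ne]; first lra.
  by apply: Rlt_le; apply: ln_increasing; lra.
rewrite /cosh exp_Ropp exp_ln //.
have -> : / (z + q) = z - q by apply: (Rmult_eq_reg_l (z + q)); rewrite ?Rinv_r; nra.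
lra.
Qed.

End HyperbolicFunctions.

(** * The hyperbolic plane as the projectivized forward light cone *)

Section HyperbolicPlane.
Implicit Types U V W : vec.

(** The form [lor] with the opposite sign, hence positive on timelike vectors. *)
Definition lo (V W : vec) : R := V.1.1 * W.1.1 - V.1.2 * W.1.2 - V.2 * W.2.
Definition hdom (V : vec) : Prop := 0 < V.1.1 /\ 0 < lo V V.
Definition hnorm (V : vec) : R := sqrt (lo V V).
Definition hch (V W : vec) : R := lo V W / (hnorm V * hnorm W).
Definition hmd (V W : vec) : R := arcosh (hch V W).
(** Minus the Gram determinant; up to the norms, its root is the hyperbolic sine of the distance. *)
Definition hgram (V W : vec) : R := lo V W ^ 2 - lo V V * lo W W.

Lemma hnorm_gt0 V : hdom V -> 0 < hnorm V.
Proof. by case=> _ H; apply: sqrt_lt_R0. Qed.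

Lemma hnorm2 V : hdom V -> hnorm V * hnorm V = lo V V.
Proof. by case=> _ H; apply: sqrt_sqrt; lra. Qed.

Lemma lo_sym V W : lo V W = lo W V.
Proof. rewrite /lo; ring. Qed.

(** A quantitative reversed Cauchy-Schwarz inequality: the sum of squares on the left is, up to
    scaling, the squared distance in the Klein model, and the difference of the two sides is the
    square handed to [nra]. *)
Lemma hgram_ge V W : hdom V -> hdom W ->
  lo V V * ((V.1.1 * W.1.2 - W.1.1 * V.1.2) ^ 2 + (V.1.1 * W.2 - W.1.1 * V.2) ^ 2)
  <= V.1.1 ^ 2 * hgram V W.
Proof.
case: V W => [[z x] y] [[z' x'] y'] [/= z0 N0] [/= z0' N0'].
rewrite /hgram /lo /= in N0 N0' *.
have := Rle_0_sqr (x * (z * x' - z' * x) + y * (z * y' - z' * y)); rewrite /Rsqr; nra.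
Qed.

Lemma hgram_ge0 V W : hdom V -> hdom W -> 0 <= hgram V W.
Proof.
move=> HV HW; have H := hgram_ge HV HW; case: HV => z0 N0.
have := pow2_ge_0 (V.1.1 * W.1.2 - W.1.1 * V.1.2); have := pow2_ge_0 (V.1.1 * W.2 - W.1.1 * V.2).
move=> ? ?; have ? : 0 < V.1.1 ^ 2 by apply: pow_lt.
nra.
Qed.

Lemma lo_gt0 V W : hdom V -> hdom W -> 0 < lo V W.
Proof.
case: V W => [[z x] y] [[z' x'] y'] [/= z0 N0] [/= z0' N0'].
rewrite /lo /= in N0 N0' *.
have zz : 0 < z * z' by nra.
have : (x * x' + y * y') ^ 2 < (z * z') ^ 2.
  have h := pow2_ge_0 (x * y' - y * x').
  have h1 : (x * x + y * y) * (x' * x' + y' * y') < z * z * (z' * z') by nra.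
  nra.
nra.
Qed.

Lemma hch_ge1 V W : hdom V -> hdom W -> 1 <= hch V W.
Proof.
move=> HV HW; have := hgram_ge0 HV HW; have := lo_gt0 HV HW; rewrite /hgram => l0 g0.
have := hnorm2 HV; have := hnorm2 HW; have := hnorm_gt0 HV; have := hnorm_gt0 HW.
rewrite /hch; set p := hnorm V; set q := hnorm W => q0 p0 Eq Ep.
have pq : 0 < p * q by nra.
apply: (Rmult_le_reg_r (p * q)) => //; rewrite /Rdiv Rmult_assoc Rinv_l; last lra.
rewrite -Ep -Eq in g0; nra.
Qed.

Lemma hmd_ge0 V W : hdom V -> hdom W -> 0 <= hmd V W.
Proof. by move=> HV HW; case: (arcosh_spec (hch_ge1 HV HW)). Qed.

Lemma cosh_hmd V W : hdom V -> hdom W -> cosh (hmd V W) = hch V W.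
Proof. by move=> HV HW; case: (arcosh_spec (hch_ge1 HV HW)). Qed.

Lemma hmdP V W r : hdom V -> hdom W -> 0 <= r -> cosh r = hch V W -> r = hmd V W.
Proof. by move=> HV HW r0 E; apply: cosh_inj; rewrite ?cosh_hmd //; apply: hmd_ge0. Qed.

Lemma sinh_hmd V W : hdom V -> hdom W -> sinh (hmd V W) = sqrt (hgram V W) / (hnorm V * hnorm W).
Proof.
move=> HV HW; have s0 := sinh_ge0 (hmd_ge0 HV HW); have := cosh2_sinh2 (hmd V W).
rewrite cosh_hmd //.
have := hnorm2 HV; have := hnorm2 HW; have := hnorm_gt0 HV; have := hnorm_gt0 HW.
have G0 := hgram_ge0 HV HW; have := sqrt_sqrt _ G0; have := sqrt_pos (hgram V W).
rewrite /hch; set p := hnorm V; set q := hnorm W; set g := sqrt _.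
move=> g0 Eg q0 p0 Eq Ep E.
have {}Eg : g * g = lo V W ^ 2 - p * p * (q * q) by rewrite Eg /hgram Ep Eq.
have pq : 0 < p * q by nra.
have : sinh (hmd V W) * sinh (hmd V W) = (g / (p * q)) * (g / (p * q)).
  have -> : sinh (hmd V W) * sinh (hmd V W) = lo V W / (p * q) * (lo V W / (p * q)) - 1 by lra.
  have -> : g / (p * q) * (g / (p * q)) = (g * g) / ((p * p) * (q * q)) by field; lra.
  rewrite Eg; field; lra.
have ? : 0 <= g / (p * q) by apply: Rle_mult_inv_pos.
by move=> H; apply: Rsqr_inj.
Qed.

Lemma hmd_sym V W : hmd V W = hmd W V.
Proof. by rewrite /hmd /hch lo_sym (Rmult_comm (hnorm V)). Qed.

Lemma hmd_refl V : hdom V -> hmd V V = 0.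
Proof.
move=> HV; apply/esym/hmdP => //; first lra.
rewrite cosh_0 /hch hnorm2 //; case: HV => _ ?; field; lra.
Qed.

(** The Gram expression of three vectors is a squared determinant, hence nonnegative. This says
    [(Z - X * Y)^2 <= (X^2 - 1) * (Y^2 - 1)], which bounds [Z] by the addition formula for the
    hyperbolic cosine. *)
Lemma hmd_tri U V W : hdom U -> hdom V -> hdom W -> hmd U W <= hmd U V + hmd V W.
Proof.
move=> HU HV HW; have a0 := hmd_ge0 HU HV; have b0 := hmd_ge0 HV HW.
apply: cosh_le_inv; [exact: hmd_ge0 | lra | rewrite cosh_plus].
have sa := sinh_ge0 a0; have sb := sinh_ge0 b0.
have := cosh2_sinh2 (hmd U V); have := cosh2_sinh2 (hmd V W).
rewrite !cosh_hmd //; set X := hch U V; set Y := hch V W; set Z := hch U W => Eb Ea.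
have D : 0 <= 1 - X ^ 2 - Y ^ 2 - Z ^ 2 + 2 * X * Y * Z.
  have hu := hnorm_gt0 HU; have hv := hnorm_gt0 HV; have hw := hnorm_gt0 HW.
  have -> : 1 - X ^ 2 - Y ^ 2 - Z ^ 2 + 2 * X * Y * Z =
      (hnorm U * hnorm U * (hnorm V * hnorm V) * (hnorm W * hnorm W)
       + 2 * lo U V * lo V W * lo U W - hnorm U * hnorm U * lo V W ^ 2
       - hnorm V * hnorm V * lo U W ^ 2 - hnorm W * hnorm W * lo U V ^ 2) *
      (/ (hnorm U * hnorm V * hnorm W)) ^ 2 by rewrite /X /Y /Z /hch; field; lra.
  apply: Rmult_le_pos (pow2_ge_0 _); rewrite !hnorm2 // /lo.
  have := pow2_ge_0 (U.1.1 * (V.1.2 * W.2 - V.2 * W.1.2) - U.1.2 * (V.1.1 * W.2 - V.2 * W.1.1)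
    + U.2 * (V.1.1 * W.1.2 - V.1.2 * W.1.1)).
  by move=> h; apply: Rle_trans h _; apply: Req_le; ring.
set s := sinh (hmd U V) in sa Ea *; set t := sinh (hmd V W) in sb Eb *.
have st : 0 <= s * t by apply: Rmult_le_pos.
have : (Z - X * Y) ^ 2 <= (s * t) ^ 2 by nra.
nra.
Qed.

Lemma lo_lin a b V W U : lo (lin a V b W) U = a * lo V U + b * lo W U.
Proof. rewrite /lo /lin /=; ring. Qed.

Lemma hdom_lin a b V W : 0 <= a -> 0 <= b -> 0 < a + b -> hdom V -> hdom W -> hdom (lin a V b W).
Proof.
move=> a0 b0 ab HV HW; have l0 := lo_gt0 HV HW; case: HV HW => [zV NV] [zW NW]; split.
  exact: (edom_lin a0 b0 ab zV zW).
rewrite lo_lin !(lo_sym _ (lin _ _ _ _)) !lo_lin (lo_sym W V).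
case: a0 => [a0|e]; last first.
  have b1 : 0 < b by lra.
  rewrite -e; have := Rmult_lt_0_compat _ _ b1 (Rmult_lt_0_compat _ _ b1 NW); nra.
have := Rmult_lt_0_compat _ _ a0 (Rmult_lt_0_compat _ _ a0 NV).
have : 0 <= a * b * lo V W by apply: Rmult_le_pos; [apply: Rmult_le_pos; lra | lra].
have : 0 <= b * b * lo W W by apply: Rmult_le_pos; [apply: Rle_0_sqr | lra].
nra.
Qed.

Lemma hgram_lin a b V W : 0 <= b -> hdom V -> hdom W ->
  sqrt (hgram V (lin a V b W)) = b * sqrt (hgram V W).
Proof.
move=> b0 HV HW; have -> : hgram V (lin a V b W) = b * b * hgram V W.
  rewrite /hgram (lo_sym V (lin _ _ _ _)) !lo_lin !(lo_sym _ (lin _ _ _ _)) !lo_lin (lo_sym W V).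
  ring.
rewrite sqrt_mult ?sqrt_square //; [nra | exact: hgram_ge0].
Qed.

Lemma hgram_sym V W : hgram V W = hgram W V.
Proof. rewrite /hgram lo_sym; ring. Qed.

Lemma hmd_add a b V W : 0 <= a -> 0 <= b -> 0 < a + b -> hdom V -> hdom W ->
  hmd V (lin a V b W) + hmd (lin a V b W) W = hmd V W.
Proof.
move=> a0 b0 ab HV HW; have HL := hdom_lin a0 b0 ab HV HW.
have p0 := hmd_ge0 HV HL; have q0 := hmd_ge0 HL HW.
apply: hmdP => //; first lra.
have S1 := hgram_lin a b0 HV HW.
have S2 : sqrt (hgram (lin a V b W) W) = a * sqrt (hgram V W).
  by rewrite lin_sym hgram_sym hgram_lin // hgram_sym.
rewrite cosh_plus !cosh_hmd // !sinh_hmd // S1 S2.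
have G := sqrt_sqrt _ (hgram_ge0 HV HW).
have hv := hnorm_gt0 HV; have hw := hnorm_gt0 HW; have hl := hnorm_gt0 HL.
rewrite /hch.
set g := sqrt _ in G *; set L := lin a V b W in HL hl *.
transitivity ((lo V L * lo L W + a * b * (g * g)) / (hnorm L * hnorm L) / (hnorm V * hnorm W)).
  by field; lra.
rewrite G hnorm2 //; congr (_ / _).
have N := HL.2; apply: (Rmult_eq_reg_r (lo L L)); last lra.
rewrite /Rdiv Rmult_assoc Rinv_l; last lra.
rewrite {N HL hl} /L /hgram !(lo_sym _ (lin _ _ _ _)) !lo_lin !(lo_sym _ (lin _ _ _ _)) !lo_lin (lo_sym W V).
ring.
Qed.

(** A multiple of [V] lies on the segment from [V] to [V], so [hmd_add] puts it at distance 0 from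
    [V]. *)
Lemma hmd_scale k V W : 0 < k -> hdom V -> hdom W -> hmd (lin k V 0 V) W = hmd V W.
Proof.
move=> k0 HV HW; have := hmd_add (Rlt_le _ _ k0) (Rle_refl 0) (_ : 0 < k + 0) HV HV.
have HL : hdom (lin k V 0 V) by apply: hdom_lin => //; lra.
rewrite hmd_refl // => /(_ ltac:(lra)) E.
have := hmd_ge0 HV HL; have := hmd_ge0 HL HV => ? ?.
have := hmd_tri HL HV HW; have := hmd_tri HV HL HW; lra.
Qed.

Lemma hmd_pos a b V W : 0 <= a -> 0 < b -> hdom V -> hdom W -> 0 < hmd V W -> 0 < hmd V (lin a V b W).
Proof.
move=> a0 b0 HV HW m0; have ab : 0 < a + b by lra.
have HL := hdom_lin a0 (Rlt_le _ _ b0) ab HV HW.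
apply: sinh_lt_inv; rewrite sinh_0 sinh_hmd // hgram_lin //; last lra.
have hv := hnorm_gt0 HV; have hl := hnorm_gt0 HL; have hw := hnorm_gt0 HW.
have := sinh_gt0 m0; rewrite sinh_hmd // => s0.
apply: Rdiv_lt_0_compat; last exact: Rmult_lt_0_compat.
apply: Rmult_lt_0_compat => //.
have -> : sqrt (hgram V W) = sqrt (hgram V W) / (hnorm V * hnorm W) * (hnorm V * hnorm W) by field; lra.
by apply: Rmult_lt_0_compat => //; apply: Rmult_lt_0_compat.
Qed.

Lemma lo_rot t V W : lo (rot t V) (rot t W) = lo V W.
Proof.
have E : sin t * sin t + cos t * cos t = 1 := sin2_cos2 t.
rewrite /lo /rot /=.
transitivity (V.1.1 * W.1.1 - (V.1.2 * W.1.2 + V.2 * W.2) * (sin t * sin t + cos t * cos t)); first ring.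
by rewrite E; ring.
Qed.

Lemma hmd_rot t V W : hdom V -> hdom W -> hmd (rot t V) (rot t W) = hmd V W.
Proof. by move=> _ _; rewrite /hmd /hch /hnorm !lo_rot. Qed.

Lemma hdom_edom V : hdom V -> edom V. Proof. by case. Qed.

(** The comparison of the Klein model with the hyperbolic metric, by which the gap between a point
    and a half-plane is inherited from the Euclidean case. *)
Lemma emd_le_sinh V W : hdom V -> hdom W -> emd V W <= sinh (hmd V W).
Proof.
move=> HV HW; have s0 := sinh_ge0 (hmd_ge0 HV HW).
have := cosh2_sinh2 (hmd V W); rewrite cosh_hmd // => E.
rewrite /emd /dist_euc -[X in _ <= X](sqrt_Rsqr _ s0); apply: sqrt_le_1_alt.
have -> : (sinh (hmd V W))² = hch V W * hch V W - 1 by rewrite /Rsqr; lra.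
have := hgram_ge HV HW.
have := hnorm2 HV; have := hnorm2 HW; have hv := hnorm_gt0 HV; have hw := hnorm_gt0 HW.
move=> EW EV G.
have -> : hch V W * hch V W - 1 = hgram V W / (lo V V * lo W W).
  rewrite /hch /hgram -EV -EW; field; lra.
have [zV NV] := HV; have [zW NW] := HW.
set A := _ ^ 2 + _ ^ 2 in G.
have A0 : 0 <= A by rewrite /A; apply: Rplus_le_le_0_compat; apply: pow2_ge_0.
have -> : (V.1.2 / V.1.1 - W.1.2 / W.1.1)² + (V.2 / V.1.1 - W.2 / W.1.1)² =
    A / (V.1.1 ^ 2 * W.1.1 ^ 2) by rewrite /A /Rsqr; field; lra.
have zV2 : 0 < V.1.1 ^ 2 by apply: pow_lt.
have zW2 : 0 < W.1.1 ^ 2 by apply: pow_lt.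
have NWz : lo W W <= W.1.1 ^ 2.
  by rewrite /lo; have := Rle_0_sqr W.1.2; have := Rle_0_sqr W.2; rewrite /Rsqr; lra.
apply: (@Rle_trans _ (A / (V.1.1 ^ 2 * lo W W))).
  apply: Rmult_le_compat_l => //; apply: Rinv_le_contravar; first nra.
  by apply: Rmult_le_compat_l; lra.
apply: (Rmult_le_reg_r (V.1.1 ^ 2 * (lo V V * lo W W))).
  by apply: Rmult_lt_0_compat => //; apply: Rmult_lt_0_compat.
have -> : A / (V.1.1 ^ 2 * lo W W) * (V.1.1 ^ 2 * (lo V V * lo W W)) = lo V V * A by field; lra.
have -> : hgram V W / (lo V V * lo W W) * (V.1.1 ^ 2 * (lo V V * lo W W)) = V.1.1 ^ 2 * hgram V W.
  by field; lra.
exact: G.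
Qed.

Lemma hmd_gap k c : hdom c -> 0 < ev k c ->
  exists2 r, 0 < r & forall Y, hdom Y -> ev k Y <= 0 -> r <= hmd c Y.
Proof.
move=> Hc kc; have [r r0 H] := emd_gap (hdom_edom Hc) kc.
exists (arcsinh r); first by rewrite -arcsinh_0; apply: arcsinh_lt.
move=> Y HY kY; rewrite -(arcsinh_sinh (hmd c Y)); apply: arcsinh_le.
by apply: Rle_trans (emd_le_sinh Hc HY); apply: H => //; apply: hdom_edom.
Qed.

Lemma hmd_cont V W e : hdom V -> hdom W -> 0 < e ->
  exists2 r, 0 < r & forall t, 0 <= t <= 1 -> t < r -> hmd V (lin (1 - t) V t W) < e.
Proof.
move=> HV HW e0; have g0 := sqrt_pos (hgram V W); have NV := HV.2; have NW := HW.2.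
have se := sinh_gt0 e0; set g := sqrt _ in g0.
have K0 : 0 < 2 * g / lo V V + 1 by have : 0 <= 2 * g / lo V V by [apply: Rle_mult_inv_pos; lra]; lra.
exists (Rmin (/2) (sinh e / (2 * g / lo V V + 1))).
  by apply: Rmin_pos; [lra | apply: Rdiv_lt_0_compat].
move=> t [t0 t1] tr.
have t2 : t < /2 by apply: Rlt_le_trans tr (Rmin_l _ _).
have t3 : t * (2 * g / lo V V + 1) < sinh e.
  apply: (Rmult_lt_reg_r (/ (2 * g / lo V V + 1))); first exact: Rinv_0_lt_compat.
  rewrite Rmult_assoc Rinv_r ?Rmult_1_r; last lra.
  by apply: Rlt_le_trans tr (Rmin_r _ _).
have s0 : 0 <= 1 - t by lra.
have st : 0 < 1 - t + t by lra.
have HL := hdom_lin s0 t0 st HV HW.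
apply: sinh_lt_inv; rewrite sinh_hmd // hgram_lin //; apply: Rle_lt_trans t3.
have hv := hnorm_gt0 HV; have hl := hnorm_gt0 HL.
(* The mixed term is nonnegative, so for [t < /2] the square norm is at least a quarter of that of
   [V]. *)
have hh : hnorm V / 2 <= hnorm (lin (1 - t) V t W).
  have -> : hnorm V / 2 = sqrt (lo V V / (2 * 2)) by rewrite sqrt_div_alt ?sqrt_square /hnorm; lra.
  apply: sqrt_le_1_alt; rewrite lo_lin !(lo_sym _ (lin _ _ _ _)) !lo_lin (lo_sym W V).
  have l0 := lo_gt0 HV HW.
  have : /4 * lo V V <= (1 - t) * (1 - t) * lo V V by apply: Rmult_le_compat_r; nra.
  have : 0 <= (1 - t) * t * lo V W by apply: Rmult_le_pos; [apply: Rmult_le_pos; lra | lra].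
  have : 0 <= t * t * lo W W by apply: Rmult_le_pos; [apply: Rle_0_sqr | lra].
  lra.
apply: (@Rle_trans _ (t * g / (hnorm V * (hnorm V / 2)))).
  apply: Rmult_le_compat_l; first by apply: Rmult_le_pos.
  apply: Rinv_le_contravar; first by apply: Rmult_lt_0_compat; lra.
  by apply: Rmult_le_compat_l; lra.
have -> : t * g / (hnorm V * (hnorm V / 2)) = t * (2 * g / (hnorm V * hnorm V)) by field; lra.
rewrite hnorm2 //; nra.
Qed.

Definition hcosang (a b c : R) : R := (cosh a * cosh b - cosh c) / (sinh a * sinh b).
Definition hpol (l t : R) : vec := (cosh l, sinh l * cos t, sinh l * sin t).

Lemma lo_pol a b s t : lo (hpol a s) (hpol b t) = cosh a * cosh b - sinh a * sinh b * cos (s - t).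
Proof. by rewrite /lo /hpol /= cos_minus; ring. Qed.

Lemma lo_pol1 a s : lo (hpol a s) (hpol a s) = 1.
Proof. by rewrite lo_pol Rminus_diag cos_0 Rmult_1_r cosh2_sinh2. Qed.

Lemma hdom_pol l t : 0 <= l -> hdom (hpol l t).
Proof. by move=> _; split; [have := cosh_ge1 l; rewrite /hpol /=; lra | rewrite lo_pol1; lra]. Qed.

Lemma hdom_o : hdom (1, 0, 0).
Proof. by split; rewrite /lo /=; lra. Qed.

Lemma hch_pol a b s t : hch (hpol a s) (hpol b t) = lo (hpol a s) (hpol b t).
Proof. by rewrite /hch /hnorm !lo_pol1 sqrt_1 Rmult_1_r Rdiv_1_r. Qed.

Lemma hpol0 t : hpol 0 t = (1, 0, 0).
Proof. by rewrite /hpol cosh_0 sinh_0 !Rmult_0_l. Qed.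

Lemma hmd_o l t : 0 <= l -> hmd (1, 0, 0) (hpol l t) = l.
Proof.
move=> l0; apply/esym/hmdP => //; [exact: hdom_o | exact: hdom_pol |].
by rewrite -(hpol0 0) hch_pol lo_pol cosh_0 sinh_0; ring.
Qed.

Lemma hmd_pol a b c s t : 0 < a -> 0 < b -> 0 < c -> cos (s - t) = hcosang a b c ->
  hmd (hpol a s) (hpol b t) = c.
Proof.
move=> a0 b0 c0 E; apply/esym/hmdP; try (apply: hdom_pol); try lra.
have := sinh_gt0 a0; have := sinh_gt0 b0 => ? ?.
by rewrite hch_pol lo_pol E /hcosang; field; lra.
Qed.

Lemma hcosang_sym a b c : hcosang a b c = hcosang b a c.
Proof. by rewrite /hcosang (Rmult_comm (sinh a)) (Rmult_comm (cosh a)). Qed.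

(** Up to a positive factor the difference of the two sides is [(cosh a - 1) * Q] with the Gram
    expression [Q]; this is the dual law of cosines, and the term accounts for the angle defect. *)
Lemma hcosang_dual a b c : 0 < a -> 0 < b -> 0 < c ->
  -1 < hcosang a b c < 1 -> -1 < hcosang a c b < 1 ->
  - cos (acos (hcosang a b c) + acos (hcosang a c b)) <= hcosang b c a.
Proof.
move=> a0 b0 c0 H1 H2; rewrite cos_plus !cos_acos ?sin_acos; try lra.
set D := 1 - (hcosang a b c)²; set D' := 1 - (hcosang a c b)².
have D0 : 0 <= D by rewrite /D /Rsqr; nra.
have sa := sinh_gt0 a0; have sb := sinh_gt0 b0; have sc := sinh_gt0 c0.
have := cosh2_sinh2 a; have := cosh2_sinh2 b; have := cosh2_sinh2 c.
have A1 := cosh_ge1 a.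
rewrite /D /D' /hcosang {H1 H2 D D'} in D0 *.
move: (cosh a) (cosh b) (cosh c) (sinh a) (sinh b) (sinh c) A1 sa sb sc D0 => A B C a' b' c'.
move=> A1 sa sb sc D0 Ec Eb Ea.
set Q := 1 - A ^ 2 - B ^ 2 - C ^ 2 + 2 * A * B * C.
have E1 : 1 - ((A * B - C) / (a' * b'))² = Q / (a' * b') ^ 2.
  apply: (Rmult_eq_reg_r ((a' * b') ^ 2)); last by apply: pow_nonzero; nra.
  rewrite /Rsqr; transitivity ((a' * a') * (b' * b') - (A * B - C) ^ 2); first by field; lra.
  transitivity Q; last by field; lra.
  have -> : a' * a' = A * A - 1 by lra.
  have -> : b' * b' = B * B - 1 by lra.
  by rewrite /Q; ring.
have E2 : 1 - ((A * C - B) / (a' * c'))² = Q / (a' * c') ^ 2.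
  apply: (Rmult_eq_reg_r ((a' * c') ^ 2)); last by apply: pow_nonzero; nra.
  rewrite /Rsqr; transitivity ((a' * a') * (c' * c') - (A * C - B) ^ 2); first by field; lra.
  transitivity Q; last by field; lra.
  have -> : a' * a' = A * A - 1 by lra.
  have -> : c' * c' = C * C - 1 by lra.
  by rewrite /Q; ring.
have ab : 0 < a' * b' by nra.
have ac : 0 < a' * c' by nra.
have Q0 : 0 <= Q.
  have -> : Q = Q / (a' * b') ^ 2 * (a' * b') ^ 2 by field; lra.
  by rewrite -E1; apply: Rmult_le_pos => //; apply: pow2_ge_0.
have -> : sqrt (1 - ((A * B - C) / (a' * b'))²) * sqrt (1 - ((A * C - B) / (a' * c'))²) =
    Q / ((a' * b') * (a' * c')).
  rewrite E1 E2 !sqrt_div_alt ?sqrt_pow2; try lra; try (by apply: pow_lt).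
  transitivity ((sqrt Q * sqrt Q) / ((a' * b') * (a' * c'))); first by field; lra.
  by rewrite sqrt_sqrt.
have aa : A * A - 1 = a' * a' by lra.
suff : 0 <= (B * C - A) / (b' * c') +
   ((A * B - C) / (a' * b') * ((A * C - B) / (a' * c')) - Q / (a' * b' * (a' * c'))) by lra.
have -> : (B * C - A) / (b' * c') +
   ((A * B - C) / (a' * b') * ((A * C - B) / (a' * c')) - Q / (a' * b' * (a' * c'))) =
   ((B * C - A) * (a' * a') + (A * B - C) * (A * C - B) - Q) / (a' * b' * (a' * c')) by field; lra.
rewrite -aa (_ : _ - Q = (A - 1) * Q); last by rewrite /Q; ring.
by apply: Rle_mult_inv_pos; nra.
Qed.

Lemma hmd_inj l l' t : 0 < l -> 0 < l' -> 0 < t < 1 -> t <> /2 ->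
  hmd (lin (/2) (1, 0, 0) (/2) (hpol l 0)) (lin (1 - t) (1, 0, 0) t (hpol l 0)) =
  hmd (lin (/2) (1, 0, 0) (/2) (hpol l' 0)) (lin (1 - t) (1, 0, 0) t (hpol l' 0)) -> l = l'.
Proof.
move=> l0 l0' Ht t2 H.
have K x : 0 < x -> 2 * (1 - 2 * t * (1 - t) + 2 * t * (1 - t) * cosh x) *
   cosh (hmd (lin (/2) (1, 0, 0) (/2) (hpol x 0)) (lin (1 - t) (1, 0, 0) t (hpol x 0))) ^ 2 =
   1 + cosh x.
  move=> x0; have Ho := hdom_o; have Hp := hdom_pol 0 (Rlt_le _ _ x0).
  have C1 := cosh_ge1 x.
  have Ex : cosh x * cosh x - sinh x * sinh x * 1 = 1 by rewrite Rmult_1_r cosh2_sinh2.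
  rewrite cosh_hmd; try (apply: hdom_lin => //; lra).
  have H1 : hdom (lin (/2) (1, 0, 0) (/2) (hpol x 0)) by apply: hdom_lin => //; lra.
  have H2 : hdom (lin (1 - t) (1, 0, 0) t (hpol x 0)) by apply: hdom_lin => //; lra.
  rewrite /hch; have n1 := hnorm_gt0 H1; have n2 := hnorm_gt0 H2.
  have E1 := hnorm2 H1; have E2 := hnorm2 H2.
  set p := hnorm _ in n1 E1 *; set q := hnorm _ in n2 E2 *; set L := lo _ _.
  have EL : L = (1 + cosh x) / 2.
    rewrite /L lo_lin !(lo_sym _ (lin _ _ _ _)) !lo_lin.
    rewrite -(hpol0 0) !lo_pol Rminus_diag cos_0 cosh_0 sinh_0 Ex; field.
  have e1 : p * p = (1 + cosh x) / 2.
    rewrite E1 lo_lin !(lo_sym _ (lin _ _ _ _)) !lo_lin.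
    rewrite -(hpol0 0) !lo_pol Rminus_diag cos_0 cosh_0 sinh_0 Ex; field.
  have e2 : q * q = 1 - 2 * t * (1 - t) + 2 * t * (1 - t) * cosh x.
    rewrite E2 lo_lin !(lo_sym _ (lin _ _ _ _)) !lo_lin.
    rewrite -(hpol0 0) !lo_pol Rminus_diag cos_0 cosh_0 sinh_0 Ex; ring.
  rewrite -e2 (_ : 1 + cosh x = 2 * (p * p)); last lra.
  transitivity (2 * (q * q) * (L * L) / ((p * p) * (q * q))); first by field; lra.
  by rewrite EL -e1; field; lra.
have := K l l0; have := K l' l0'; rewrite -H.
set M := cosh (hmd _ _) ^ 2; set k := 2 * t * (1 - t) => E' E.
have k0 : 0 < k by rewrite /k; nra.
have k1 : k < /2.
  have : 0 < (t - /2) * (t - /2) by have : t - / 2 <> 0 by [lra]; move=> h; nra.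
  by rewrite /k; nra.
apply: cosh_inj; try lra.
have C1 := cosh_ge1 l; have C1' := cosh_ge1 l'.
set X := cosh l in E C1 *; set Y := cosh l' in E' C1' *.
(* This amounts to [(X - Y) * (1 - 2 * k) = 0], and [k < /2] because [t <> /2]. *)
have : (1 + X) * (1 - k + k * Y) = (1 + Y) * (1 - k + k * X) by rewrite -E -E'; ring.
nra.
Qed.

Definition planeH : plane := @Plane hmd hdom cosh sinh hcosang hmd_ge0 hmd_sym hmd_refl
  hmd_tri hdom_lin hmd_add hmd_scale hmd_pos hmd_rot hmd_gap hmd_cont
  (fun l _ => Rlt_le_trans _ _ _ Rlt_0_1 (cosh_ge1 l)) sinh_gt0
  hdom_pol hdom_o hmd_o hmd_pol hcosang_sym (angle_sum_of hcosang_sym hcosang_dual)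
  hmd_inj.

End HyperbolicPlane.

(** All that the rest of the proof knows about the two kinds of simplices. By [sdP], distances in a
    simplex can be read off from any placement of its vertices in the plane with the right edge
    lengths; [unit] singles out the representatives to which barycentric weights refer. *)
Record geom (n : nat) := Geom {
  pl : plane;
  real : (vtx n -> vtx n -> R) -> seq (vtx n) -> nat -> (vtx n -> nat -> R) -> Prop;
  sd : (vtx n -> vtx n -> R) -> seq (vtx n) -> (vtx n -> R) -> (vtx n -> R) -> R -> Prop;
  unit : vec -> Prop;
  unit_pol : forall l t, 0 <= l -> unit (pol pl l t);
  unit_o : unit (1, 0, 0);
  unit_dom : forall V, unit V -> dom pl V;
  len_adj : forall len v u, piecewise_metric real len -> adj v u ->
    0 < len v u /\ len u v = len v u;
  len_refl : forall len v, piecewise_metric real len -> valid_vtx v -> len v v = 0;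
  len_chain3 : forall len v u w, piecewise_metric real len -> is_chain [:: v; u; w] ->
    -1 < cosang pl (len v u) (len v w) (len u w) < 1;
  sd_ge0 : forall len s p q a, piecewise_metric real len -> is_chain s -> s <> [::] ->
    sd len s p q a -> 0 <= a;
  sd_sym : forall len s p q a, sd len s p q a -> sd len s q p a;
  sdP : forall len s p q (f : vtx n -> vec) r, piecewise_metric real len -> is_chain s -> s <> [::] ->
    is_point p -> is_point q -> supported p s -> supported q s ->
    (forall a, List.In a s -> unit (f a)) ->
    (forall a b, List.In a s -> List.In b s -> md pl (f a) (f b) = len a b) ->
    sd len s p q r <-> r = md pl (vsum s p f) (vsum s q f)
}.

Lemma dom_vsum (pl : plane) n (s : seq (vtx n)) p (f : vtx n -> vec) :
  (forall a, List.In a s -> dom pl (f a)) ->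
  (forall a, List.In a s -> 0 <= p a) -> 0 < \big[Rplus/0]_(a <- s) p a -> dom pl (vsum s p f).
Proof.
move=> Hu Hp.
have E a r : vsum (a :: r) p f = lin (p a) (f a) 1 (vsum r p f).
  by rewrite /vsum !big_cons /lin /= !Rmult_1_l.
elim: s Hu Hp => [|a r IH] Hu Hp; first by rewrite big_nil; lra.
rewrite big_cons E => S0.
have Ha : dom pl (f a) by apply: Hu; left.
have pa : 0 <= p a by apply: Hp; left.
have Hu' b : List.In b r -> dom pl (f b) by move=> br; apply: Hu; right.
have Hp' b : List.In b r -> 0 <= p b by move=> br; apply: Hp; right.
have : 0 <= \big[Rplus/0]_(b <- r) p b.
  elim: (r) Hp' => [|b t IHt] H; first by rewrite big_nil; lra.
  rewrite big_cons; apply: Rplus_le_le_0_compat; first by apply: H; left.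
  by apply: IHt => c ct; apply: H; right.
case=> [r0|r0].
  by apply: dom_lin; [ | lra | lra | | exact: IH].
have Z b : List.In b r -> p b = 0.
  elim: (r) Hp' r0 => // c t IHt H; rewrite big_cons => E0.
  have c0 : 0 <= p c by apply: H; left.
  have t0 : 0 <= \big[Rplus/0]_(b <- t) p b.
    elim: (t) H => [|b' t' IHt'] H; first by rewrite big_nil; lra.
    rewrite big_cons; apply: Rplus_le_le_0_compat; first by apply: H; right; left.
    by apply: IHt' => e' [<-|et]; apply: H; [left | right; right].
  case=> [<-|bt]; first lra.
  by apply: IHt => //; [move=> e et; apply: H; right | lra].
have -> : lin (p a) (f a) 1 (vsum r p f) = lin (p a) (f a) 0 (f a).
  have V0 : vsum r p f = (0, 0, 0).
    rewrite /vsum; congr (_, _, _).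
    - rewrite (@sum_ext _ _ (fun=> 0)) => [|b /Z ->]; [exact: big1 | lra].
    - rewrite (@sum_ext _ _ (fun=> 0)) => [|b /Z ->]; [exact: big1 | lra].
    - rewrite (@sum_ext _ _ (fun=> 0)) => [|b /Z ->]; [exact: big1 | lra].
  by rewrite V0 /lin /=; congr (_, _, _); ring.
by apply: dom_lin => //; lra.
Qed.

(** * Quadratic forms on combinations of vertices *)

Section RealSums.

Lemma sum_scal (I : Type) (r : seq I) c (F : I -> R) :
  \big[Rplus/0]_(i <- r) (c * F i) = c * \big[Rplus/0]_(i <- r) F i.
Proof. by elim: r => [|i r IH]; rewrite ?big_nil ?big_cons ?IH; lra. Qed.

Lemma sum_ge0 (I : Type) (r : seq I) (F : I -> R) : (forall i, 0 <= F i) ->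
  0 <= \big[Rplus/0]_(i <- r) F i.
Proof. by move=> H; apply: big_ind => //; [lra | move=> x y; lra]. Qed.

Lemma edot_ge0 N x : 0 <= edot N x x.
Proof. by apply: sum_ge0 => i; apply: Rle_0_sqr. Qed.

Lemma edot_eq0 N x : edot N x x = 0 -> forall i, (i < N)%N -> x i = 0.
Proof.
move=> E i iN; pose T := \big[Rplus/0]_(j < N | j != Ordinal iN) (x j * x j).
have D : edot N x x = x i * x i + T by rewrite /edot (bigD1 (Ordinal iN)).
have T0 : 0 <= T by apply: big_ind => [|a b ? ?|j _]; [lra | lra | apply: Rle_0_sqr].
apply: Rsqr_0_uniq; have := Rle_0_sqr (x i); rewrite /Rsqr; lra.
Qed.

Lemma enorm2 N x : enorm N x * enorm N x = edot N x x.
Proof. by apply: sqrt_sqrt; apply: edot_ge0. Qed.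

Lemma edot_lin N a x b y z : edot N (fun i => a * x i + b * y i) z = a * edot N x z + b * edot N y z.
Proof.
rewrite /edot -!sum_scal -big_split /=; apply: eq_bigr => i _; ring.
Qed.

Lemma edot_sym N x y : edot N x y = edot N y x.
Proof. by apply: eq_bigr => i _; ring. Qed.

Lemma edot_ext N x x' y y' : (forall i, x i = x' i) -> (forall i, y i = y' i) ->
  edot N x y = edot N x' y'.
Proof. by move=> H H'; apply: eq_bigr => i _; rewrite H H'. Qed.

Lemma edot_lin2 N a x b y : edot N (fun i => a * x i + b * y i) (fun i => a * x i + b * y i) =
  a * a * edot N x x + 2 * a * b * edot N x y + b * b * edot N y y.
Proof.
set z := (fun i => a * x i + b * y i).
rewrite /z edot_lin (edot_sym N x) (edot_sym N y) !edot_lin (edot_sym N y x); ring.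
Qed.

Variable n : nat.
Implicit Types (s : seq (vtx n)) (u v w : vtx n).

Lemma edot_combl N s c (e : vtx n -> nat -> R) y :
  edot N (comb s c e) y = \big[Rplus/0]_(a <- s) (c a * edot N (e a) y).
Proof.
rewrite /edot (eq_bigr (fun i : 'I_N => \big[Rplus/0]_(a <- s) (c a * (e a i * y i)))).
  by rewrite exchange_big; apply: eq_bigr => a _; rewrite sum_scal.
by move=> i _; rewrite /comb Rmult_comm -sum_scal; apply: eq_bigr => a _; ring.
Qed.

Lemma lor_combl N s c (e : vtx n -> nat -> R) y :
  lor N (comb s c e) y = \big[Rplus/0]_(a <- s) (c a * lor N (e a) y).
Proof.
rewrite /lor -/(edot N (fun i => comb s c e i.+1) (fun i => y i.+1)).
rewrite (_ : edot N _ _ = \big[Rplus/0]_(a <- s) (c a * edot N (fun i => e a i.+1) (fun i => y i.+1))).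
  rewrite [RHS](eq_bigr (fun a => (- y 0%N) * (c a * e a 0%N) +
    c a * edot N (fun i => e a i.+1) (fun i => y i.+1))).
    by rewrite big_split /= sum_scal /comb; ring.
  by move=> a _; rewrite /edot; ring.
exact: (@edot_combl N s c (fun a i => e a i.+1)).
Qed.

Lemma lor_sym N x y : lor N x y = lor N y x.
Proof. by rewrite /lor (Rmult_comm (x 0%N)); congr (_ + _); apply: eq_bigr => i _; ring. Qed.

Lemma edot_comb N s c c' (e : vtx n -> nat -> R) :
  edot N (comb s c e) (comb s c' e) =
  \big[Rplus/0]_(a <- s) (c a * \big[Rplus/0]_(b <- s) (c' b * edot N (e a) (e b))).
Proof.
rewrite edot_combl; apply: eq_bigr => a _; rewrite edot_sym edot_combl; congr (_ * _).
by apply: eq_bigr => b _; rewrite edot_sym.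
Qed.

Lemma lor_comb N s c c' (e : vtx n -> nat -> R) :
  lor N (comb s c e) (comb s c' e) =
  \big[Rplus/0]_(a <- s) (c a * \big[Rplus/0]_(b <- s) (c' b * lor N (e a) (e b))).
Proof.
rewrite lor_combl; apply: eq_bigr => a _; rewrite lor_sym lor_combl; congr (_ * _).
by apply: eq_bigr => b _; rewrite lor_sym.
Qed.

Lemma edot_polar N (x y : nat -> R) :
  edot N x y = /2 * (edot N x x + edot N y y - edot N (fun i => x i - y i) (fun i => x i - y i)).
Proof.
rewrite (@edot_ext N (fun i => x i - y i) (fun i => 1 * x i + (-1) * y i)
  (fun i => x i - y i) (fun i => 1 * x i + (-1) * y i)); try by move=> i; ring.
rewrite edot_lin2; field.
Qed.

(** By polarization, for weights of sum 0 the norm depends only on the mutual distances of the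
    vertices, so all realizations of a simplex give the same [sd_E]. *)
Lemma edot_comb_len N s c (e : vtx n -> nat -> R) : \big[Rplus/0]_(a <- s) c a = 0 ->
  edot N (comb s c e) (comb s c e) =
  \big[Rplus/0]_(a <- s) (c a * \big[Rplus/0]_(b <- s) (c b *
    (- /2 * (enorm N (fun i => e a i - e b i) * enorm N (fun i => e a i - e b i))))).
Proof.
move=> c0; rewrite edot_comb.
pose K := \big[Rplus/0]_(b <- s) (c b * edot N (e b) (e b)).
transitivity (\big[Rplus/0]_(a <- s) (/2 * K * c a + c a * \big[Rplus/0]_(b <- s) (c b *
    (- /2 * (enorm N (fun i => e a i - e b i) * enorm N (fun i => e a i - e b i)))))).
  apply: eq_bigr => a _.
  rewrite (eq_bigr (fun b => /2 * edot N (e a) (e a) * c b + (/2 * (c b * edot N (e b) (e b)) +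
    c b * (- /2 * (enorm N (fun i => e a i - e b i) * enorm N (fun i => e a i - e b i)))))).
    by rewrite !big_split /= !sum_scal c0 -/K; ring.
  by move=> b _; rewrite enorm2 edot_polar; field.
by rewrite big_split /= sum_scal c0; ring.
Qed.

Lemma sum_sub s (p q : vtx n -> R) : \big[Rplus/0]_(a <- s) (p a - q a) =
  \big[Rplus/0]_(a <- s) p a - \big[Rplus/0]_(a <- s) q a.
Proof.
rewrite (eq_bigr (fun a => p a + (-1) * q a)) ?big_split /= ?sum_scal; first lra.
by move=> a _; lra.
Qed.

End RealSums.

(** * Euclidean simplices *)

Section EuclideanComplex.
Variable n : nat.
Implicit Types (s : seq (vtx n)) (u v w : vtx n).

Definition eunit (V : vec) : Prop := V.1.1 = 1.

Lemma emd_unit V W : eunit V -> eunit W ->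
  emd V W = dist_euc V.1.2 V.2 W.1.2 W.2.
Proof. by rewrite /eunit /emd => -> ->; rewrite !Rdiv_1_r. Qed.

Let flat (f : vtx n -> vec) (a : vtx n) (i : nat) : R := if i is 0%N then (f a).1.2 else (f a).2.

Let flat_norm (V W : vec) : enorm 2 (fun i => (if i is 0%N then V.1.2 else V.2) -
  (if i is 0%N then W.1.2 else W.2)) = dist_euc V.1.2 V.2 W.1.2 W.2.
Proof.
rewrite /enorm /edot !big_ord_recl big_ord0 /= /dist_euc; congr sqrt; rewrite /Rsqr; ring.
Qed.

Lemma sdP_E len s p q (f : vtx n -> vec) r : piecewise_metric (@eucl_real n) len -> is_chain s ->
  s <> [::] -> is_point p -> is_point q -> supported p s -> supported q s ->
  (forall a, List.In a s -> eunit (f a)) ->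
  (forall a b, List.In a s -> List.In b s -> emd (f a) (f b) = len a b) ->
  sd_E len s p q r <-> r = emd (vsum s p f) (vsum s q f).
Proof.
move=> [_ HP] Hs s0 Pp Pq Sp Sq Hu Hl.
have p1 := point_sum1 Pp Hs Sp; have q1 := point_sum1 Pq Hs Sq.
have c0 : \big[Rplus/0]_(a <- s) (p a - q a) = 0 by rewrite sum_sub p1 q1; lra.
have U t : \big[Rplus/0]_(a <- s) t a = 1 -> eunit (vsum s t f).
  move=> t1; rewrite /eunit /vsum /= -[RHS]t1; apply: sum_ext => a /Hu ->; lra.
have K N e : eucl_real len s N e ->
    enorm N (comb s (fun u => p u - q u) e) = emd (vsum s p f) (vsum s q f).
  move=> [He _]; rewrite emd_unit; try exact: U.
  rewrite -flat_norm /enorm.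
  rewrite (edot_comb_len N e c0) [RHS](_ : _ = sqrt (edot 2 (comb s (fun u => p u - q u) (flat f))
    (comb s (fun u => p u - q u) (flat f)))).
    rewrite (edot_comb_len 2 (flat f) c0); congr sqrt; apply: sum_ext => a ai; congr (_ * _).
    apply: sum_ext => b bi; congr (_ * (_ * _)).
    by rewrite He // -Hl // emd_unit; try exact: Hu; rewrite -flat_norm.
  congr sqrt; apply: eq_bigr => i _; congr (_ * _);
    rewrite /comb (eq_bigr (fun a => p a * flat f a i - q a * flat f a i)) ?sum_sub;
    try (by move=> a _; ring); by case: i => -[].
split=> [H|-> N e /K //].
by have [N [e He]] := HP s Hs s0; rewrite (H N e He) K.
Qed.

Lemma len_refl_E len v : piecewise_metric (@eucl_real n) len -> valid_vtx v -> len v v = 0.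
Proof.
move=> [_ HP] Hv; have Hc : is_chain [:: v].
  by apply: (proj2 (is_chain_cons v [::])); split=> //; exact: (@is_chain_nil n).
have s0 : [:: v] <> [::] by [].
have [N [e [He _]]] := HP _ Hc s0.
rewrite -He; try by left.
rewrite /enorm -[RHS]sqrt_0; congr sqrt; by apply: big1 => i _; ring.
Qed.

(** At [(- B, A)] the form takes the value [A * (A * C - B * B)]. *)
Lemma sum_sq_pos (A B C : R) :
  (forall s t : R, s <> 0 \/ t <> 0 -> 0 < s * s * A + 2 * s * t * B + t * t * C) ->
  [/\ 0 < A, 0 < C & B * B < A * C].
Proof.
move=> H; have A0 : 0 < A by have := H 1 0 (or_introl R1_neq_R0); lra.
have C0 : 0 < C by have := H 0 1 (or_intror R1_neq_R0); lra.
split=> //; have := H (- B) A (or_intror (Rgt_not_eq _ _ A0)); nra.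
Qed.

Lemma len_adj_E len v u : piecewise_metric (@eucl_real n) len -> adj v u ->
  0 < len v u /\ len u v = len v u.
Proof.
move=> [_ HP] a; have s0 : [:: v; u] <> [::] by [].
have [N [e [He Hn]]] := HP _ (proj2 (is_chain2 v u) a) s0.
have vi : List.In v [:: v; u] by left.
have ui : List.In u [:: v; u] by right; left.
have S : len u v = len v u.
  rewrite -!He //; congr sqrt; apply: eq_bigr => i _; ring.
split=> //; rewrite -He //.
have n0 := sqrt_pos (edot N (fun i => e v i - e u i) (fun i => e v i - e u i)).
case: n0 => // /esym n0; exfalso.
have /edot_eq0 Z : edot N (fun i => e v i - e u i) (fun i => e v i - e u i) = 0.
  by rewrite -enorm2 /enorm n0; ring.
have [Hv Hu _ _] := a; have va := adj_veqF a; have au := adj_veqF (adj_sym a).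
(* A length 0 makes the two vertices coincide, which is an affine dependence with weights 1 and
   -1. *)
have := Hn (mk v u u 1 (-1) 0) _ _ v vi; rewrite /mk veq_refl // va => H.
suff : 1 + 0 + 0 = 0 by lra.
apply: H; first by rewrite !big_cons big_nil /mk !veq_refl // va au; lra.
move=> i iN; rewrite /comb !big_cons big_nil /mk !veq_refl // va au.
by have := Z i iN; lra.
Qed.

(** Nondegeneracy of the simplex makes the Cauchy-Schwarz inequality strict for the two sides at
    [v]. *)
Lemma len_chain3_E len v u w : piecewise_metric (@eucl_real n) len -> is_chain [:: v; u; w] ->
  -1 < ecosang (len v u) (len v w) (len u w) < 1.
Proof.
move=> HPL Hs; have [_ HP] := HPL; have s0 : [:: v; u; w] <> [::] by [].
have [N [e [He Hn]]] := HP _ Hs s0.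
have [vu vw uw] := proj1 (is_chain3 _ _ _) Hs.
have [a0 _] := len_adj_E HPL vu; have [b0 _] := len_adj_E HPL vw; have [c0 _] := len_adj_E HPL uw.
have vi : List.In v [:: v; u; w] by left.
have ui : List.In u [:: v; u; w] by right; left.
have wi : List.In w [:: v; u; w] by right; right; left.
pose x i := e v i - e u i; pose y i := e v i - e w i.
have Ex : edot N x x = len v u ^ 2 by rewrite -enorm2 He //; ring.
have Ey : edot N y y = len v w ^ 2 by rewrite -enorm2 He //; ring.
have Exy : 2 * edot N x y = len v u ^ 2 + len v w ^ 2 - len u w ^ 2.
  rewrite edot_polar Ex Ey (@edot_ext _ _ (fun i => e w i - e u i) _ (fun i => e w i - e u i)).
  - rewrite -enorm2 He //; have [_ ->] := len_adj_E HPL uw; field.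
  - by move=> i; rewrite /x /y; ring.
  - by move=> i; rewrite /x /y; ring.
have [A0 C0 D] : [/\ 0 < edot N x x, 0 < edot N y y & edot N x y * edot N x y < edot N x x * edot N y y].
  apply: sum_sq_pos => s t st.
  have E : edot N (fun i => s * x i + t * y i) (fun i => s * x i + t * y i) =
      s * s * edot N x x + 2 * s * t * edot N x y + t * t * edot N y y.
    rewrite edot_lin2; ring.
  rewrite -E; case: (edot_ge0 N (fun i => s * x i + t * y i)) => // /esym/edot_eq0 Z; exfalso.
  (* [s x + t y] is the combination of the three vertices with these weights, whose sum is 0. *)
  have Hc r (ri : List.In r [:: v; u; w]) : mk v u w (s + t) (-s) (-t) r = 0.
    apply: (Hn _ _ _ r ri).
      transitivity (\big[Rplus/0]_(a <- [:: v; u; w]) (mk v u w (s + t) (-s) (-t) a * 1)).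
        by apply: eq_bigr => a _; ring.
      rewrite (mk_sum _ _ _ (fun=> 1)) //; ring.
    move=> i iN; rewrite /comb (mk_sum _ _ _ (fun a => e a i)) //.
    by rewrite -(Z i iN) /x /y; ring.
  have [_ E2 E3] := mk_at (s + t) (-s) (-t) Hs.
  have := Hc u ui; have := Hc w wi; rewrite E2 E3; lra.
have -> : ecosang (len v u) (len v w) (len u w) = edot N x y / (len v u * len v w).
  rewrite /ecosang -Exy; field; lra.
have ab : 0 < len v u * len v w by apply: Rmult_lt_0_compat.
rewrite Ex Ey in D.
have {}D : edot N x y * edot N x y < (len v u * len v w) * (len v u * len v w) by nra.
split; apply: (Rmult_lt_reg_r (len v u * len v w)) => //;
  rewrite /Rdiv ?(Rmult_assoc (edot _ _ _)) Rinv_l; nra.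
Qed.

Lemma sd_ge0_E len s p q a : piecewise_metric (@eucl_real n) len -> is_chain s -> s <> [::] ->
  sd_E len s p q a -> 0 <= a.
Proof. by move=> [_ HP] Hs s0 H; have [N [e /H ->]] := HP s Hs s0; apply: sqrt_pos. Qed.

Lemma sd_sym_E (len : vtx n -> vtx n -> R) s p q a : sd_E len s p q a -> sd_E len s q p a.
Proof.
move=> H N e /H ->; rewrite /enorm; congr sqrt.
have E i : comb s (fun u => q u - p u) e i = (-1) * comb s (fun u => p u - q u) e i.
  by rewrite /comb -sum_scal; apply: eq_bigr => b _; ring.
by apply: eq_bigr => i _; rewrite E; ring.
Qed.

Definition geomE : geom n := @Geom n planeE (@eucl_real n) (@sd_E n) eunit
  (fun _ _ _ => erefl) erefl (fun V (E : eunit V) => eq_ind_r (fun x => 0 < x) Rlt_0_1 E)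
  len_adj_E len_refl_E len_chain3_E sd_ge0_E sd_sym_E sdP_E.

End EuclideanComplex.

(** * Hyperbolic simplices *)

Section HyperbolicComplex.
Variable n : nat.
Implicit Types (s : seq (vtx n)) (u v w : vtx n).

Definition hunit (V : vec) : Prop := 0 < V.1.1 /\ lo V V = 1.

Lemma hunit_dom V : hunit V -> hdom V.
Proof. by case=> ? E; split=> //; lra. Qed.

Lemma lor_ext N x x' y y' : (forall i, x i = x' i) -> (forall i, y i = y' i) ->
  lor N x y = lor N x' y'.
Proof.
move=> H H'; rewrite /lor H H'; congr (_ + _).
by apply: eq_bigr => i _; rewrite H H'.
Qed.

Lemma lor_edot N x y : lor N x y = - (x 0%N * y 0%N) + edot N (fun i => x i.+1) (fun i => y i.+1).
Proof. by []. Qed.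

Lemma lor_lin N a x b y z : lor N (fun i => a * x i + b * y i) z = a * lor N x z + b * lor N y z.
Proof. rewrite !lor_edot (edot_lin N a (fun i => x i.+1) b (fun i => y i.+1)); ring. Qed.

Lemma lor_lin2 N a x b y : lor N (fun i => a * x i + b * y i) (fun i => a * x i + b * y i) =
  a * a * lor N x x + 2 * a * b * lor N x y + b * b * lor N y y.
Proof. rewrite !lor_edot (edot_lin2 N a (fun i => x i.+1) b (fun i => y i.+1)); ring. Qed.

Lemma edot_cs N x y : edot N x y * edot N x y <= edot N x x * edot N y y.
Proof.
have X0 := edot_ge0 N x; have Y0 := edot_ge0 N y.
case: Y0 => [Y0|/esym Y0].
  have := edot_ge0 N (fun i => edot N y y * x i + (- edot N x y) * y i); rewrite edot_lin2.
  nra.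
suff -> : edot N x y = 0 by nra.
by have Z := edot_eq0 Y0; rewrite /edot; apply: big1 => i _; rewrite Z //; ring.
Qed.

(** The complement of a timelike unit vector is positive definite, by the Cauchy-Schwarz inequality
    for the spatial parts. *)
Lemma lor_orth N x y : lor N y y = -1 -> lor N x y = 0 ->
  0 <= lor N x x /\ (lor N x x = 0 -> forall i, (i <= N)%N -> x i = 0).
Proof.
rewrite !lor_edot => Ey Exy; have cs := edot_cs N (fun i => x i.+1) (fun i => y i.+1).
have X0 := edot_ge0 N (fun i => x i.+1); have Y0 := edot_ge0 N (fun i => y i.+1).
set X := edot N (fun i => x i.+1) (fun i => x i.+1) in cs X0 *.
set Y := edot N (fun i => y i.+1) (fun i => y i.+1) in cs Y0 Ey *.
set P := edot N (fun i => x i.+1) (fun i => y i.+1) in cs Exy *.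
have EY : Y = y 0%N * y 0%N - 1 by lra.
have EP : P = x 0%N * y 0%N by lra.
rewrite EP EY in cs.
have K : X <= y 0%N * y 0%N * (X - x 0%N * x 0%N) by nra.
split; first by nra.
move=> E.
have XE : X = 0 by nra.
have x0 : x 0%N = 0 by nra.
by case=> [//|i iN]; apply: (edot_eq0 XE).
Qed.

Let flat (V : vec) (i : nat) : R := if i is i'.+1 then (if i' is 0%N then V.1.2 else V.2) else V.1.1.

Let lor_flat V W : lor 2 (flat V) (flat W) = - lo V W.
Proof. rewrite /lor !big_ord_recl big_ord0 /lo /=; ring. Qed.

Let flat_vsum s p (f : vtx n -> vec) i : comb s p (fun a => flat (f a)) i = flat (vsum s p f) i.
Proof. by case: i => [|[|i]]. Qed.

Lemma sdP_H len s p q (f : vtx n -> vec) r : piecewise_metric (@hyp_real n) len -> is_chain s ->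
  s <> [::] -> is_point p -> is_point q -> supported p s -> supported q s ->
  (forall a, List.In a s -> hunit (f a)) ->
  (forall a b, List.In a s -> List.In b s -> hmd (f a) (f b) = len a b) ->
  sd_H len s p q r <-> r = hmd (vsum s p f) (vsum s q f).
Proof.
move=> [_ HP] Hs s0 Pp Pq Sp Sq Hu Hl.
have Hd t : is_point t -> supported t s -> hdom (vsum s t f).
  move=> Pt St; apply: (@dom_vsum planeH) => [a /Hu /hunit_dom //|a _|]; first exact: point_ge0.
  by rewrite (point_sum1 Pt Hs St); lra.
have K N e p1 q1 : hyp_real len s N e -> lor N (comb s p1 e) (comb s q1 e) =
    - lo (vsum s p1 f) (vsum s q1 f).
  move=> [_ He _].
  rewrite -lor_flat -(lor_ext 2 (flat_vsum s p1 f) (flat_vsum s q1 f)) !lor_comb.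
  apply: sum_ext => a ai; congr (_ * _); apply: sum_ext => b bi; congr (_ * _).
  have [Ha Hb] := (hunit_dom (Hu a ai), hunit_dom (Hu b bi)).
  have [_ E] := He a b ai bi; rewrite lor_flat.
  have : hch (f a) (f b) = lo (f a) (f b).
    by rewrite /hch /hnorm; have [_ ->] := Hu a ai; have [_ ->] := Hu b bi; rewrite sqrt_1; field.
  by rewrite -cosh_hmd // Hl // E => <-; ring.
have N0 t : is_point t -> supported t s -> 0 < lo (vsum s t f) (vsum s t f).
  by move=> Pt St; case: (Hd t Pt St).
have V N e : hyp_real len s N e -> forall a,
    (0 <= a /\ cosh a * sqrt (lor N (comb s p e) (comb s p e) * lor N (comb s q e) (comb s q e))
      = - lor N (comb s p e) (comb s q e)) <-> a = hmd (vsum s p f) (vsum s q f).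
  move=> He a; rewrite !(K N e) // Rmult_opp_opp Ropp_involutive.
  have np := N0 p Pp Sp; have nq := N0 q Pq Sq.
  rewrite sqrt_mult; try lra.
  have Dp := Hd p Pp Sp; have Dq := Hd q Pq Sq.
  have hp := hnorm_gt0 Dp; have hq := hnorm_gt0 Dq.
  rewrite -/(hnorm (vsum s p f)) -/(hnorm (vsum s q f)); split.
    move=> [a0 E]; apply: hmdP => //; rewrite /hch -E; field; lra.
  move=> ->; split; first exact: hmd_ge0.
  by rewrite cosh_hmd // /hch; field; lra.
split=> [H|-> N e He]; last exact/(V N e He).
have [N [e He]] := HP s Hs s0; apply/(V N e He); exact: H.
Qed.

Lemma len_refl_H len v : piecewise_metric (@hyp_real n) len -> valid_vtx v -> len v v = 0.
Proof.
move=> [_ HP] Hv; have Hc : is_chain [:: v].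
  by apply: (proj2 (is_chain_cons v [::])); split=> //; exact: (@is_chain_nil n).
have s0 : [:: v] <> [::] by [].
have [N [e [H1 H2 _]]] := HP _ Hc s0.
have vi : List.In v [:: v] by left.
have [l0 E] := H2 v v vi vi; have [E' _] := H1 v vi.
by apply: cosh_inj; rewrite ?cosh_0; lra.
Qed.

(** The vector is tangent at [e v] and points to [e u]; its length is the hyperbolic sine of the
    edge length. *)
Lemma hyp_gram len v u N e s (c : R) (X : nat -> R) :
  hyp_real len s N e -> List.In v s -> List.In u s -> c = cosh (len v u) ->
  lor N (fun i => 1 * e u i + (- c) * e v i) (e v) = 0.
Proof.
move=> [H1 H2 _] vi ui ->; rewrite lor_lin.
have [E _] := H1 v vi; have [_ E'] := H2 v u vi ui; rewrite E lor_sym; lra.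
Qed.

Lemma len_adj_H len v u : piecewise_metric (@hyp_real n) len -> adj v u ->
  0 < len v u /\ len u v = len v u.
Proof.
move=> [_ HP] a; have s0 : [:: v; u] <> [::] by [].
have [N [e He]] := HP _ (proj2 (is_chain2 v u) a) s0; have [H1 H2 Hn] := He.
have vi : List.In v [:: v; u] by left.
have ui : List.In u [:: v; u] by right; left.
have [lv Ev] := H2 v u vi ui; have [lu Eu] := H2 u v ui vi.
have S : len u v = len v u by apply: cosh_inj => //; rewrite Ev Eu lor_sym.
split=> //; case: lv => // /esym l0; exfalso.
have O := hyp_gram (e v) He vi ui erefl.
have [E1 _] := H1 v vi; have [E2 _] := H1 u ui.
have [_ Z] := lor_orth E1 O.
have [Hv Hu _ _] := a; have va := adj_veqF a; have au := adj_veqF (adj_sym a).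
have := Hn (mk v u u (-1) 1 0) _ v vi; rewrite /mk veq_refl // va => H.
suff : -1 + 0 + 0 = 0 by lra.
apply: H => i iN; rewrite /comb !big_cons big_nil /mk !veq_refl // va au.
have := Z _ i iN; rewrite l0 cosh_0 => HZ.
suff : 1 * e u i + - (1) * e v i = 0 by lra.
apply: HZ; rewrite lor_lin2 E1 E2 lor_sym; rewrite l0 cosh_0 in Ev; lra.
Qed.

(** The Euclidean argument in the tangent space at [e v], where the form is positive definite:
    [hcosang] is the cosine of the angle between the tangent vectors [x] and [y]. *)
Lemma len_chain3_H len v u w : piecewise_metric (@hyp_real n) len -> is_chain [:: v; u; w] ->
  -1 < hcosang (len v u) (len v w) (len u w) < 1.
Proof.
move=> HPL Hs; have [_ HP] := HPL; have s0 : [:: v; u; w] <> [::] by [].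
have [N [e He]] := HP _ Hs s0; have [H1 H2 Hn] := He.
have [vu vw uw] := proj1 (is_chain3 _ _ _) Hs.
have [a0 _] := len_adj_H HPL vu; have [b0 _] := len_adj_H HPL vw.
have vi : List.In v [:: v; u; w] by left.
have ui : List.In u [:: v; u; w] by right; left.
have wi : List.In w [:: v; u; w] by right; right; left.
have [E1 _] := H1 v vi; have [E2 _] := H1 u ui; have [E3 _] := H1 w wi.
have [_ F1] := H2 v u vi ui; have [_ F2] := H2 v w vi wi; have [_ F3] := H2 u w ui wi.
pose x i := 1 * e u i + (- cosh (len v u)) * e v i.
pose y i := 1 * e w i + (- cosh (len v w)) * e v i.
have Ox : lor N x (e v) = 0 by apply: (hyp_gram (e v) He vi ui).
have Oy : lor N y (e v) = 0 by apply: (hyp_gram (e v) He vi wi).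
have Ex : lor N x x = sinh (len v u) * sinh (len v u).
  have := cosh2_sinh2 (len v u); rewrite /x lor_lin2 E1 E2 (lor_sym N (e u)); nra.
have Ey : lor N y y = sinh (len v w) * sinh (len v w).
  have := cosh2_sinh2 (len v w); rewrite /y lor_lin2 E1 E3 (lor_sym N (e w)); nra.
have Exy : lor N x y = cosh (len v u) * cosh (len v w) - cosh (len u w).
  rewrite /x lor_lin (lor_sym N (e v)) Oy (lor_sym N (e u)) /y lor_lin (lor_sym N (e w)).
  by rewrite F3 F1; ring.
have [A0 C0 D] : [/\ 0 < lor N x x, 0 < lor N y y & lor N x y * lor N x y < lor N x x * lor N y y].
  apply: sum_sq_pos => s t st; rewrite -lor_lin2.
  have O : lor N (fun i => s * x i + t * y i) (e v) = 0 by rewrite lor_lin Ox Oy; ring.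
  have [[//|/esym /[swap] /[apply] Z]] := lor_orth E1 O; exfalso.
  have Hc r (ri : List.In r [:: v; u; w]) :
      mk v u w (- s * cosh (len v u) - t * cosh (len v w)) s t r = 0.
    apply: (Hn _ _ r ri) => i iN; rewrite /comb (mk_sum _ _ _ (fun a => e a i)) //.
    by rewrite -(Z i iN) /x /y; ring.
  have [_ G2 G3] := mk_at (- s * cosh (len v u) - t * cosh (len v w)) s t Hs.
  have := Hc u ui; have := Hc w wi; rewrite G2 G3; lra.
have sa := sinh_gt0 a0; have sb := sinh_gt0 b0.
rewrite /hcosang -Exy; have ab := Rmult_lt_0_compat _ _ sa sb.
rewrite Ex Ey in D.
have {}D : lor N x y * lor N x y <
  (sinh (len v u) * sinh (len v w)) * (sinh (len v u) * sinh (len v w)) by nra.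
split; apply: (Rmult_lt_reg_r (sinh (len v u) * sinh (len v w))) => //;
  rewrite /Rdiv ?(Rmult_assoc (lor _ _ _)) Rinv_l; nra.
Qed.

Lemma hunit_pol l t : 0 <= l -> hunit (hpol l t).
Proof. by move=> l0; split; [case: (hdom_pol t l0) | apply: lo_pol1]. Qed.

Lemma hunit_o : hunit (1, 0, 0).
Proof. by rewrite -(hpol0 0); apply: hunit_pol; lra. Qed.

Lemma sd_ge0_H len s p q a : piecewise_metric (@hyp_real n) len -> is_chain s -> s <> [::] ->
  sd_H len s p q a -> 0 <= a.
Proof. by move=> [_ HP] Hs s0 H; have [N [e /H[]]] := HP s Hs s0. Qed.

Lemma sd_sym_H (len : vtx n -> vtx n -> R) s p q a : sd_H len s p q a -> sd_H len s q p a.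
Proof. by move=> H N e /H[a0]; rewrite lor_sym (Rmult_comm (lor N (comb s p e) (comb s p e))). Qed.

Definition geomH : geom n := @Geom n planeH (@hyp_real n) (@sd_H n) hunit
  hunit_pol hunit_o hunit_dom len_adj_H len_refl_H len_chain3_H sd_ge0_H sd_sym_H sdP_H.

End HyperbolicComplex.

(** * Comparison geometry *)

Section Comparison.
Variables (M : Type) (XM : M -> Prop) (dM : M -> M -> R).
Variables (P : Type) (X : P -> Prop) (d : P -> P -> R).
Hypothesis CAT : CAT_wrt XM dM X d.
Hypothesis d_ge0 : forall x y, X x -> X y -> 0 <= d x y.
Hypothesis d_sym : forall x y, X x -> X y -> d x y = d y x.
Hypothesis d_tri : forall x y z, X x -> X y -> X z -> d x z <= d x y + d y z.
Variable ax : R -> M.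
Hypothesis axX : forall t, XM (ax t).
Hypothesis axd : forall s t, dM (ax s) (ax t) = Rabs (s - t).
(** The model plane has to supply, besides the line [ax], a comparison triangle with a point [y] on
    its side [[p, a]], and rigidity: if the way from [y] to [q] through [a] is shortest, the
    triangle is flat. *)
Hypothesis cmp : forall A B C t, 0 <= t < A -> 0 <= B -> A <= B + C -> B <= A + C -> C <= A + B ->
  0 <= C -> exists p a q y, [/\ XM p, XM a, XM q & XM y] /\
    [/\ dM p a = A, dM a q = B & dM q p = C] /\
    [/\ dM p y = t, dM y a = A - t, dM q q = 0 & (A - t + B <= dM y q -> C = A + B)].

(** The comparison triangle of [p], [q], [m] is flat and can be laid on the line [ax]; there [m] and
    the point of the geodesic at time [t] have the same comparison point. *)
Lemma geod_meets p q m g t : X p -> X q -> X m -> geod X d p q g -> d p m = t ->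
  d m q = d p q - t -> d (g t) m = 0.
Proof.
move=> Xp Xq Xm G tE mE; have [ex C] := CAT.
have [g2 G2] := ex q m Xq Xm; have [g3 G3] := ex m p Xm Xp.
have t0 : 0 <= t by rewrite -tE; apply: d_ge0.
have m0 := d_ge0 Xm Xq.
have qm : d q m = d p q - t by rewrite d_sym.
have [_ [g2e _]] := G2; have [_ [_ Gg]] := G.
have tI : 0 <= t <= d p q by lra.
have [Xg _] := Gg t t tI tI.
apply: Rle_antisym; last exact: d_ge0.
have E1 : dM (ax 0) (ax (d p q)) = d p q by rewrite axd Rabs_left1; lra.
have E2 : dM (ax (d p q)) (ax t) = d q m by rewrite axd Rabs_right; lra.
have E3 : dM (ax t) (ax 0) = d m p by rewrite axd Rabs_right ?(d_sym Xm) //; lra.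
have H := C p q m g g2 g3 Xp Xq Xm G G2 G3 (ax 0) (ax (d p q)) (ax t)
  (axX _) (axX _) (axX _) E1 E2 E3
  g (ax 0) (ax (d p q)) (d p q) g2 (ax (d p q)) (ax t) (d q m).
rewrite -g2e -[X in _ <= X](_ : dM (ax t) (ax t) = 0); last by rewrite axd Rminus_diag Rabs_R0.
rewrite g2e -{1}g2e; apply: H; rewrite /= ?axd; try tauto; try lra.
- exact: axX.
- exact: axX.
- by rewrite Rabs_left1; lra.
- by rewrite Rabs_left1; lra.
- by rewrite qm Rabs_right; lra.
- by rewrite Rminus_diag Rabs_R0; lra.
Qed.

(** Both points coincide with the point of one fixed geodesic at the time [d p m]. *)
Lemma CAT_unique p q m m' : X p -> X q -> X m -> X m' -> d p m = d p m' ->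
  d p m + d m q = d p q -> d p m' + d m' q = d p q -> d m m' = 0.
Proof.
move=> Xp Xq Xm Xm' E E1 E2; have [ex _] := CAT; have [g G] := ex p q Xp Xq.
have Z1 : d (g (d p m)) m = 0 by apply: (geod_meets Xp Xq Xm G) => //; lra.
have Z2 : d (g (d p m)) m' = 0 by apply: (geod_meets Xp Xq Xm' G) => //; lra.
have tI : 0 <= d p m <= d p q by have := d_ge0 Xp Xm; have := d_ge0 Xm Xq; lra.
have [_ [_ Gg]] := G; have [Xg _] := Gg _ _ tI tI.
have := d_tri Xm Xg Xm'; rewrite (d_sym Xm Xg) Z1 Z2; have := d_ge0 Xm Xm'; lra.
Qed.

(* Compare in the triangle p, a, q the points y and q, of which y lies on the side [p, a]: their
   distance forces the comparison triangle to be degenerate. *)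
Lemma CAT_glue p y a q : X p -> X y -> X a -> X q -> d p y + d y a = d p a ->
  d y a + d a q = d y q -> 0 < d y a -> d p a + d a q = d p q.
Proof.
move=> Xp Xy Xa Xq E1 E2 ya; have [ex C] := CAT.
have [g1 G1] := ex p a Xp Xa; have [g2 G2] := ex a q Xa Xq; have [g3 G3] := ex q p Xq Xp.
have t0 := d_ge0 Xp Xy; have B0 := d_ge0 Xa Xq; have C0 := d_ge0 Xp Xq.
have Z : d (g1 (d p y)) y = 0 by apply: (geod_meets Xp Xa Xy G1) => //; lra.
have tI : 0 <= d p y <= d p a by lra.
have [_ [_ Gg]] := G1; have [Xg _] := Gg _ _ tI tI; have [_ [g2e _]] := G2.
have I : 0 <= d p y < d p a by lra.
have T1 : d p a <= d a q + d p q.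
  by have := d_tri Xp Xq Xa; rewrite (d_sym Xq Xa); lra.
have T2 : d a q <= d p a + d p q.
  by have := d_tri Xa Xp Xq; rewrite (d_sym Xa Xp).
have T3 := d_tri Xp Xa Xq.
have [p' [a' [q' [y' [[Xp' Xa' Xq' Xy'] [[F1 F2 F3] [F4 F5 F6 F7]]]]]]] := cmp I B0 T1 T2 T3 C0.
rewrite (d_sym Xp Xq) in F3.
have H := C p a q g1 g2 g3 Xp Xa Xq G1 G2 G3 p' a' q' Xp' Xa' Xq' F1 F2 F3
  g1 p' a' (d p a) g2 a' q' (d a q).
apply/esym/F7; rewrite -(_ : d (g1 (d p y)) (g2 (d a q)) = d p a - d p y + d a q).
  by apply: H => //=; try tauto; lra.
rewrite g2e; apply: Rle_antisym.
  have := d_tri Xg Xy Xq; lra.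
have := d_tri Xy Xg Xq; rewrite (d_sym Xy Xg); lra.
Qed.

End Comparison.

(** * Comparison triangles in the two model planes *)

Lemma Rdiv_mulK x y : y <> 0 -> x / y * y = x.
Proof. by move=> ?; field. Qed.

Lemma law_of_cosines_bound A B C : 0 < A -> 0 < B -> A <= B + C -> B <= A + C -> C <= A + B ->
  -1 <= (A ^ 2 + B ^ 2 - C ^ 2) / (2 * A * B) <= 1.
Proof.
move=> A0 B0 H1 H2 H3; have D : 0 < 2 * A * B by nra.
by split; apply: (Rmult_le_reg_r (2 * A * B)) => //; rewrite Rdiv_mulK; nra.
Qed.

Definition axE (t : R) : E2 := (t, 0).

Lemma E2dist_sq x y r : 0 <= r -> (x.1 - y.1) ^ 2 + (x.2 - y.2) ^ 2 = r ^ 2 -> E2dist x y = r.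
Proof. by move=> r0 E; rewrite /E2dist E sqrt_pow2. Qed.

Lemma axE_dist s t : E2dist (axE s) (axE t) = Rabs (s - t).
Proof. by apply: E2dist_sq (Rabs_pos _) _; rewrite pow2_abs /=; ring. Qed.

Lemma cmpE A B C t : 0 <= t < A -> 0 <= B -> A <= B + C -> B <= A + C -> C <= A + B ->
  0 <= C -> exists p a q y, [/\ E2pt p, E2pt a, E2pt q & E2pt y] /\
    [/\ E2dist p a = A, E2dist a q = B & E2dist q p = C] /\
    [/\ E2dist p y = t, E2dist y a = A - t, E2dist q q = 0 & (A - t + B <= E2dist y q -> C = A + B)].
Proof.
move=> It B0 H1 H2 H3 C0; have A0 : 0 < A by lra.
(* The vertex [a] is the origin and [k] the cosine of the angle there. For [B = 0] there is no
   angle, but then [C = A], so that the law of cosines [kE] holds with the value 1. *)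
pose k := if Req_dec_T B 0 then 1 else (A ^ 2 + B ^ 2 - C ^ 2) / (2 * A * B).
have k1 : -1 <= k <= 1.
  rewrite /k; case: (Req_dec_T B 0) => [E|ne] /=; first lra.
  by apply: law_of_cosines_bound => //; lra.
have kE : 2 * A * B * k = A ^ 2 + B ^ 2 - C ^ 2.
  rewrite /k; case: (Req_dec_T B 0) => [E|ne] /=; last by field; lra.
  have -> : C = A by lra.
  by rewrite E; ring.
have [s s0 sE] : exists2 s, 0 <= s & s * s = 1 - k * k.
  by exists (sqrt (1 - k * k)); [apply: sqrt_pos | apply: sqrt_sqrt; nra].
exists (A, 0), (0, 0), (B * k, B * s), (A - t, 0); split=> //.
have E3 : E2dist (B * k, B * s) (A, 0) = C.
  apply: E2dist_sq => //=; transitivity (B * B * (s * s) + B * B * (k * k) - 2 * A * B * k + A ^ 2).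
    ring.
  by rewrite sE kE; ring.
split.
  split=> //; apply: E2dist_sq => //=; try lra.
  by transitivity (B * B * (s * s) + B * B * (k * k)); [ring | rewrite sE; ring].
split; try (apply: E2dist_sq => /=; (lra || ring)).
have [B1|B1] := Req_dec B 0; first by lra.
(* By the law of cosines for the triangle [y], [a], [q] the bound forces a straight angle at [a]. *)
move=> H; suff : k = -1 by move=> kk; rewrite kk in kE; nra.
have : (A - t + B) ^ 2 <= (A - t) ^ 2 + B ^ 2 - 2 * (A - t) * B * k.
  have h0 : 0 <= A - t + B by lra.
  rewrite (_ : (A - t) ^ 2 + B ^ 2 - 2 * (A - t) * B * k = E2dist (A - t, 0) (B * k, B * s) ^ 2).
    by apply: pow_incr.
  rewrite /E2dist pow2_sqrt; last by apply: Rplus_le_le_0_compat; apply: pow2_ge_0.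
  rewrite /=.
  transitivity ((A - t) ^ 2 + B * B * (s * s) + B * B * (k * k) - 2 * (A - t) * B * k); last ring.
  by rewrite sE; ring.
have : 0 < (A - t) * B by apply: Rmult_lt_0_compat; lra.
nra.
Qed.

Definition axH (t : R) : H2 := (cosh t, sinh t, 0).
(** [k] and [s] stand for the cosine and the sine of the polar angle. *)
Definition polH (r k s : R) : H2 := (cosh r, sinh r * k, sinh r * s).

Lemma H2pt_polH r k s : k * k + s * s = 1 -> H2pt (polH r k s).
Proof.
move=> E; split; rewrite /polH /=; last by have := cosh_ge1 r; lra.
have E1 := cosh2_sinh2 r.
transitivity (cosh r * cosh r - sinh r * sinh r * (k * k + s * s)); first ring.
by rewrite E; lra.
Qed.

Lemma H2distP x y r : 0 <= r -> x.1.1 * y.1.1 - x.1.2 * y.1.2 - x.2 * y.2 = cosh r -> H2dist x y = r.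
Proof.
move=> r0; rewrite /H2dist => ->; have [a0 E] := arcosh_spec (cosh_ge1 r).
exact: cosh_inj.
Qed.

Lemma H2pt_axH t : H2pt (axH t).
Proof.
have -> : axH t = polH t 1 0 by rewrite /axH /polH; congr (_, _, _); ring.
by apply: H2pt_polH; ring.
Qed.

Lemma cosh_abs x : cosh (Rabs x) = cosh x.
Proof.
case: (Rle_dec 0 x) => [x0|/Rnot_le_lt x0]; first by rewrite Rabs_pos_eq.
by rewrite Rabs_left // /cosh Ropp_involutive Rplus_comm.
Qed.

Lemma sinh_opp x : sinh (- x) = - sinh x.
Proof. by rewrite /sinh Ropp_involutive; field. Qed.

Lemma cosh_opp x : cosh (- x) = cosh x.
Proof. by rewrite /cosh Ropp_involutive Rplus_comm. Qed.

Lemma axH_dist s t : H2dist (axH s) (axH t) = Rabs (s - t).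
Proof.
apply: H2distP (Rabs_pos _) _; rewrite cosh_abs /= /Rminus cosh_plus cosh_opp sinh_opp; ring.
Qed.

Lemma cosh_le x y : 0 <= x -> x <= y -> cosh x <= cosh y.
Proof.
move=> x0 xy; case: (Rle_dec (cosh x) (cosh y)) => // /Rnot_le_lt H.
have /(cosh_le_inv _ _) : cosh y <= cosh x by lra.
by move=> h; have e : x = y by [have := h ltac:(lra) x0; lra]; rewrite e in H; lra.
Qed.

Lemma cmpH A B C t : 0 <= t < A -> 0 <= B -> A <= B + C -> B <= A + C -> C <= A + B ->
  0 <= C -> exists p a q y, [/\ H2pt p, H2pt a, H2pt q & H2pt y] /\
    [/\ H2dist p a = A, H2dist a q = B & H2dist q p = C] /\
    [/\ H2dist p y = t, H2dist y a = A - t, H2dist q q = 0 & (A - t + B <= H2dist y q -> C = A + B)].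
Proof.
move=> It B0 H1 H2 H3 C0; have A0 : 0 < A by lra.
have sA := sinh_gt0 A0.
have [k [k1 kE]] : exists k, -1 <= k <= 1 /\ sinh A * sinh B * k = cosh A * cosh B - cosh C.
  case: B0 => [B0|B0]; last first.
    exists 1; split; first lra.
    have -> : C = A by lra.
    by rewrite -B0 sinh_0 cosh_0; ring.
  have sB := sinh_gt0 B0; have sAB := Rmult_lt_0_compat _ _ sA sB.
  exists ((cosh A * cosh B - cosh C) / (sinh A * sinh B)); split; last by field; lra.
  have h1 : cosh C <= cosh A * cosh B + sinh A * sinh B by rewrite -cosh_plus; apply: cosh_le; lra.
  have h2 : cosh A * cosh B - sinh A * sinh B <= cosh C.
    rewrite (_ : cosh A * cosh B - sinh A * sinh B = cosh (Rabs (A - B))).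
      by apply: cosh_le; [apply: Rabs_pos | apply: Rabs_le; lra].
    by rewrite cosh_abs /Rminus cosh_plus cosh_opp sinh_opp; ring.
  by split; apply: (Rmult_le_reg_r (sinh A * sinh B)) => //; rewrite Rdiv_mulK; lra.
have [s s0 sE] : exists2 s, 0 <= s & s * s = 1 - k * k.
  by exists (sqrt (1 - k * k)); [apply: sqrt_pos | apply: sqrt_sqrt; nra].
exists (axH A), (axH 0), (polH B k s), (axH (A - t)); split.
  by split; try exact: H2pt_axH; apply: H2pt_polH; lra.
have qd r : 0 <= r -> H2dist (axH r) (polH B k s) =
    H2dist (axH r) (polH B k s) by [].
split.
  split.
  - by rewrite axH_dist Rabs_right; lra.
  - by apply: H2distP => //=; rewrite sinh_0 cosh_0; ring.
  - apply: H2distP => //=; have : cosh B * cosh A - sinh B * k * sinh A = cosh C by nra.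
    by move=> <-; ring.
split; rewrite ?axH_dist.
- by rewrite Rabs_right; lra.
- by rewrite Rabs_right; lra.
- apply: H2distP => /=; first lra.
  rewrite cosh_0; transitivity (cosh B * cosh B - sinh B * sinh B); last exact: cosh2_sinh2.
  transitivity (cosh B * cosh B - sinh B * sinh B * (s * s) - sinh B * sinh B * (k * k)); first ring.
  by rewrite sE; ring.
case: B0 => [B0|B0]; last by lra.
move=> H; have sB := sinh_gt0 B0; have at0 : 0 < A - t by lra.
have sT := sinh_gt0 at0.
set z := cosh (A - t) * cosh B - sinh (A - t) * sinh B * k.
have z1 : 1 <= z.
  have h : 1 <= cosh (A - t) * cosh B - sinh (A - t) * sinh B.
    have -> : cosh (A - t) * cosh B - sinh (A - t) * sinh B = cosh (A - t - B).
      by rewrite /Rminus (cosh_plus (A + - t)) cosh_opp sinh_opp; ring.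
    exact: cosh_ge1.
  have := Rmult_lt_0_compat _ _ sT sB; rewrite /z; nra.
have [y0 yE] := arcosh_spec z1.
have E : H2dist (axH (A - t)) (polH B k s) = arcosh z by rewrite /H2dist /z /=; congr arcosh; ring.
rewrite E in H; have := cosh_le _ H; rewrite yE cosh_plus => /(_ ltac:(lra)) h.
have := Rmult_lt_0_compat _ _ sT sB => st.
have kk : k = -1 by rewrite /z in h; nra.
by apply: cosh_inj; rewrite ?cosh_plus; try lra; rewrite kk in kE; lra.
Qed.

(** * The length metric as an infimum over strings *)

Section LengthMetric.
Variables (n : nat) (G : geom n) (len : vtx n -> vtx n -> R) (d : (vtx n -> R) -> (vtx n -> R) -> R).
Hypothesis PM : piecewise_metric (real G) len.
Hypothesis LM : is_length_metric (sd G len) d.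
Implicit Types (p q r : vtx n -> R).

Lemma supported_nonnil p s : is_point p -> is_chain s -> supported p s -> s <> [::].
Proof. by move=> Pp Hs S e; have := point_sum1 Pp Hs S; rewrite e big_nil; lra. Qed.

Lemma str_len_point p q L : str_len (sd G len) p q L -> is_point p /\ is_point q.
Proof. by elim=> // {}p {}q r s a {}L Pp _ _ _ _ _ [_ Pr]. Qed.

Lemma str_len_ge0 p q L : str_len (sd G len) p q L -> 0 <= L.
Proof.
elim=> [{}p _|{}p {}q r s a {}L Pp Hs Sp Sq H _ IH]; first lra.
have s0 := supported_nonnil Pp Hs Sp; have := sd_ge0 PM Hs s0 H; lra.
Qed.

Lemma str_len_cat p q r L L' : str_len (sd G len) p q L -> str_len (sd G len) q r L' ->
  str_len (sd G len) p r (L + L').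
Proof.
elim=> [{}p _ H|{}p {}q z s a {}L Pp Hs Sp Sq H _ IH H']; first by rewrite Rplus_0_l.
by rewrite Rplus_assoc; apply: str_cons Pp Hs Sp Sq H (IH H').
Qed.

Lemma str_len_rev p q L : str_len (sd G len) p q L -> str_len (sd G len) q p L.
Proof.
elim=> [{}p Pp|{}p {}q r s a {}L Pp Hs Sp Sq H HL IH]; first exact: str_nil.
have [Pq _] := str_len_point HL; rewrite Rplus_comm; apply: str_len_cat IH _.
rewrite -(Rplus_0_r a); apply: str_cons Pq Hs Sq Sp (sd_sym H) (str_nil _ Pp).
Qed.

Lemma d_le p q L : str_len (sd G len) p q L -> d p q <= L.
Proof. by move=> H; have [Pp Pq] := str_len_point H; case: (LM Pp Pq) => + _; apply. Qed.

Lemma d_ge p q c : is_point p -> is_point q ->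
  (forall L, str_len (sd G len) p q L -> c <= L) -> c <= d p q.
Proof.
move=> Pp Pq H; case: (Rle_dec c (d p q)) => // /Rnot_le_lt lt.
have [_ /(_ (c - d p q))] := LM Pp Pq; case; first lra.
by move=> L [/H ? ?]; lra.
Qed.

Lemma d_ge0 p q : is_point p -> is_point q -> 0 <= d p q.
Proof. by move=> Pp Pq; apply: d_ge => // L; apply: str_len_ge0. Qed.

Lemma d_sym p q : is_point p -> is_point q -> d p q = d q p.
Proof.
by move=> Pp Pq; apply: Rle_antisym; apply: d_ge => // L /str_len_rev; apply: d_le.
Qed.

Lemma d_tri p q r : is_point p -> is_point q -> is_point r -> d p r <= d p q + d q r.
Proof.
move=> Pp Pq Pr; suff H e : 0 < e -> d p r - d p q - d q r <= e.
  have K := le_epsilon (d p r - d p q - d q r) 0.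
  have : d p r - d p q - d q r <= 0 by [apply: K => e /H; lra]; lra.
move=> e0; have [_ /(_ (e / 2))] := LM Pp Pq; case=> [|L [HL lL]]; first lra.
have [_ /(_ (e / 2))] := LM Pq Pr; case=> [|L' [HL' lL']]; first lra.
have := d_le (str_len_cat HL HL'); lra.
Qed.

Lemma d_sd s p q a : is_chain s -> is_point p -> is_point q -> supported p s -> supported q s ->
  sd G len s p q a -> d p q <= a.
Proof.
move=> Hs Pp Pq Sp Sq H; rewrite -(Rplus_0_r a); apply: d_le.
by apply: str_cons Pp Hs Sp Sq H (str_nil _ Pq).
Qed.

End LengthMetric.

(** Two geodesics overlapping in the nondegenerate segment from [y] to [a] join to a geodesic; the
    overlap rules out a corner. *)
Definition cat_glue n (d : (vtx n -> R) -> (vtx n -> R) -> R) :=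
  forall p y a q, is_point p -> is_point y -> is_point a -> is_point q ->
    d p y + d y a = d p a -> d y a + d a q = d y q -> 0 < d y a -> d p a + d a q = d p q.
Definition cat_unique n (d : (vtx n -> R) -> (vtx n -> R) -> R) :=
  forall p q m m', is_point p -> is_point q -> is_point m -> is_point m' -> d p m = d p m' ->
    d p m + d m q = d p q -> d p m' + d m' q = d p q -> d m m' = 0.

Lemma CAT0_glue n (len : vtx n -> vtx n -> R) d : piecewise_metric (@eucl_real n) len ->
  is_length_metric (sd_E len) d -> CAT0 (@is_point n) d -> cat_glue d /\ cat_unique d.
Proof.
move=> PM LM C; have D0 := @d_ge0 n (geomE n) len d PM LM; have Ds := @d_sym n (geomE n) len d LM.
have Dt := @d_tri n (geomE n) len d LM; split.
  move=> p y a q; exact: (CAT_glue C D0 Ds Dt (fun _ => I) axE_dist cmpE).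
move=> p q m m'; exact: (CAT_unique C D0 Ds Dt (fun _ => I) axE_dist).
Qed.

Lemma CATm1_glue n (len : vtx n -> vtx n -> R) d : piecewise_metric (@hyp_real n) len ->
  is_length_metric (sd_H len) d -> CATm1 (@is_point n) d -> cat_glue d /\ cat_unique d.
Proof.
move=> PM LM C; have D0 := @d_ge0 n (geomH n) len d PM LM; have Ds := @d_sym n (geomH n) len d LM.
have Dt := @d_tri n (geomH n) len d LM; split.
  move=> p y a q; exact: (CAT_glue C D0 Ds Dt H2pt_axH axH_dist cmpH).
move=> p q m m'; exact: (CAT_unique C D0 Ds Dt H2pt_axH axH_dist).
Qed.

(** Phrased relative to an edge: at most one further class, so the simplices to be unfolded round an
    edge are triangles. *)
Definition two_dimensional n := forall (s : seq (vtx n)) (v u x y : vtx n), is_chain s ->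
  List.In v s -> List.In u s -> List.In x s -> List.In y s -> ~ vequiv v u ->
  ~ vequiv x v -> ~ vequiv x u -> ~ vequiv y v -> ~ vequiv y u -> vequiv x y.

(** * Unfolding the star of an edge *)

Section Development.
Variables (n : nat) (G : geom n) (len : vtx n -> vtx n -> R) (d : (vtx n -> R) -> (vtx n -> R) -> R).
Hypothesis PM : piecewise_metric (real G) len.
Hypothesis LM : is_length_metric (sd G len) d.
Hypothesis dim2 : two_dimensional n.
Implicit Types (v u w a b x y : vtx n) (s : seq (vtx n)) (p q : vtx n -> R).

Let D := md (pl G).
Let C := mC (pl G).
Let S := mS (pl G).

Definition angle v u w : R := acos (cosang (pl G) (len v u) (len v w) (len u w)).

Lemma len_equiv a a' b b' : vequiv a a' -> vequiv b b' -> len a b = len a' b'.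
Proof. by case: PM => H _; apply: H. Qed.

Lemma len_sym v u : adj v u -> len u v = len v u.
Proof. by move=> /(len_adj PM)[]. Qed.

Lemma ang_sym v u w : is_chain [:: v; u; w] -> angle v u w = angle v w u.
Proof. by move=> /is_chain3[_ _ uw]; rewrite /angle cosang_sym (len_sym uw). Qed.

Lemma ang_bound v u w : is_chain [:: v; u; w] ->
  0 < angle v u w < PI /\ cos (angle v u w) = cosang (pl G) (len v u) (len v w) (len u w).
Proof.
move=> H; have K := len_chain3 PM H; split; first exact: acos_bound_lt.
by apply: cos_acos; lra.
Qed.

Section Edge.
Variables v u w0 : vtx n.
Hypothesis vu : adj v u.
Hypothesis Hw0 : valid_vtx w0.

Let Hv : valid_vtx v. Proof. by case: vu. Qed.
Let Hu : valid_vtx u. Proof. by case: vu. Qed.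

(* Triangles containing the edge are unfolded into the plane: the one with apex w0 on the positive
   side of the edge, all the others on top of each other on the negative side. *)
Definition place a : vec :=
  if veq a v then (1, 0, 0) else if veq a u then pol (pl G) (len v u) 0
  else if veq a w0 then pol (pl G) (len v a) (angle v u a)
  else pol (pl G) (len v a) (- angle v u a).

Lemma place_equiv a b : vequiv a b -> place a = place b.
Proof.
move=> ab; have e := len_equiv (vequiv_refl Hv) ab; have e' := len_equiv (vequiv_refl Hu) ab.
by rewrite /place !(veq_congl _ ab) // /angle e e'.
Qed.

Variables (s : seq (vtx n)) (v' u' : vtx n).
Hypothesis Hs : is_chain s.
Hypothesis v's : List.In v' s.
Hypothesis u's : List.In u' s.
Hypothesis vv' : vequiv v v'.
Hypothesis uu' : vequiv u u'.

Let nvu' : ~ vequiv v' u'.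
Proof.
case: vu => _ _ ne _ e; apply: ne; have Hv' := chain_valid Hs v's; have Hu' := chain_valid Hs u's.
by apply: (vequiv_trans Hv' vv'); apply: (vequiv_trans Hu' e); apply: vequiv_sym.
Qed.

Lemma third_chain a : List.In a s -> ~ vequiv a v -> ~ vequiv a u -> is_chain [:: v'; u'; a].
Proof.
move=> as' av au; have Hv' := chain_valid Hs v's; have Hu' := chain_valid Hs u's.
have Ha := chain_valid Hs as'.
apply/is_chain3; split; apply: (chain_In Hs) => // e.
  by apply: av; apply: (vequiv_sym Hv (vequiv_trans Hv' vv' e)).
by apply: au; apply: (vequiv_sym Hu (vequiv_trans Hu' uu' e)).
Qed.

Let len_va a : List.In a s -> len v a = len v' a.
Proof. by move=> as'; apply: len_equiv => //; apply: vequiv_refl; apply: chain_valid as'. Qed.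
Let len_ua a : List.In a s -> len u a = len u' a.
Proof. by move=> as'; apply: len_equiv => //; apply: vequiv_refl; apply: chain_valid as'. Qed.
Let len_vu : len v u = len v' u'.
Proof. exact: len_equiv. Qed.

Lemma third_pos a : List.In a s -> ~ vequiv a v -> ~ vequiv a u ->
  [/\ 0 < len v a, 0 < len u a & 0 < angle v u a < PI /\
      cos (angle v u a) = cosang (pl G) (len v u) (len v a) (len u a)].
Proof.
move=> as' av au; have H := third_chain as' av au; have [_ va ua] := proj1 (is_chain3 _ _ _) H.
rewrite (len_va as') (len_ua as'); have [va0 _] := len_adj PM va; have [ua0 _] := len_adj PM ua.
by split=> //; have := ang_bound H; rewrite /angle len_vu (len_va as') (len_ua as').
Qed.

Let third_eq a b : List.In a s -> List.In b s -> ~ vequiv a v -> ~ vequiv a u ->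
  ~ vequiv b v -> ~ vequiv b u -> vequiv a b.
Proof.
move=> as' bs av au bv bu; have Hv' := chain_valid Hs v's; have Hu' := chain_valid Hs u's.
have K (c z z' : vtx n) : valid_vtx c -> valid_vtx z -> vequiv z z' -> ~ vequiv c z -> ~ vequiv c z'.
  move=> Hc Hz zz' nc e; apply: nc; have Hz' := proj1 (vequiv_valid zz') Hz.
  by apply: (vequiv_trans Hz' e); apply: vequiv_sym.
have Ha := chain_valid Hs as'; have Hb := chain_valid Hs bs.
exact: (dim2 Hs v's u's as' bs nvu' (K _ _ _ Ha Hv vv' av) (K _ _ _ Ha Hu uu' au)
  (K _ _ _ Hb Hv vv' bv) (K _ _ _ Hb Hu uu' bu)).
Qed.

Let lvu0 : 0 < len v u. Proof. by case: (len_adj PM vu). Qed.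

Lemma place_unit a : List.In a s -> unit G (place a).
Proof.
move=> as'; rewrite /place; case: veqP => av; first exact: unit_o.
case: veqP => au; first by apply: unit_pol; lra.
have [l0 _ _] := third_pos as' av au.
by case: ifP => _; apply: unit_pol; lra.
Qed.

Lemma place_len a b : List.In a s -> List.In b s -> D (place a) (place b) = len a b.
Proof.
move=> as' bs; have Ha := chain_valid Hs as'; have Hb := chain_valid Hs bs.
have Dr c : List.In c s -> D (place c) (place c) = 0.
  by move=> cs; apply: md_refl; apply: unit_dom; apply: place_unit.
have lr (c c' : vtx n) : valid_vtx c -> valid_vtx c' -> vequiv c c' -> len c c' = 0.
  by move=> Hc Hc' e; rewrite (len_equiv e (vequiv_refl Hc')) (len_refl PM).
have same : vequiv a b -> D (place a) (place b) = len a b.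
  by move=> e; rewrite (place_equiv e) Dr // lr.
have Lab : ~ vequiv a b -> len b a = len a b by move=> ne; apply: len_sym; apply: (chain_In Hs).
have case_v c e : List.In c s -> List.In e s -> vequiv c v -> ~ vequiv c e ->
    D (place c) (place e) = len c e.
  move=> cs es cv ne; have Hc := chain_valid Hs cs; have He := chain_valid Hs es.
  have -> : len c e = len v e by apply: len_equiv => //; apply: vequiv_refl.
  have ev' : ~ vequiv e v.
    by move=> ev'; apply: ne; apply: (vequiv_trans Hv cv); apply: vequiv_sym.
  rewrite {1}/place; case: veqP => // _; rewrite /place; case: veqP => // _.
  case: veqP => [eu|eu].
    by rewrite /D md_o; [apply: len_equiv; [apply: vequiv_refl | apply: vequiv_sym] | lra].
  have [l0 _ _] := third_pos es ev' eu.
  by case: ifP => _; rewrite /D md_o //; lra.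
have case_u c e : List.In c s -> List.In e s -> vequiv c u -> ~ vequiv c v -> ~ vequiv e v ->
    ~ vequiv c e -> D (place c) (place e) = len c e.
  move=> cs es cu cv ev' ne; have Hc := chain_valid Hs cs; have He := chain_valid Hs es.
  have -> : len c e = len u e by apply: len_equiv => //; apply: vequiv_refl.
  have eu : ~ vequiv e u.
    by move=> eu; apply: ne; apply: (vequiv_trans Hu cu); apply: vequiv_sym.
  rewrite {1}/place; case: veqP => // _; case: veqP => // _.
  rewrite /place; case: veqP => // _; case: veqP => // _.
  have [l0 l1 [_ ce]] := third_pos es ev' eu.
  case: ifP => _; apply: md_pol => //.
    by rewrite Rminus_0_l cos_neg.
  by rewrite Rminus_0_l Ropp_involutive.
case: (excluded_middle_informative (vequiv a b)) => [|ne]; first exact: same.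
have ne' : ~ vequiv b a by move=> /(vequiv_sym Hb).
case: (excluded_middle_informative (vequiv a v)) => av; first exact: case_v.
case: (excluded_middle_informative (vequiv b v)) => bv; first by rewrite /D md_sym -Lab //; apply: case_v.
case: (excluded_middle_informative (vequiv a u)) => au; first exact: case_u.
case: (excluded_middle_informative (vequiv b u)) => bu; first by rewrite /D md_sym -Lab //; apply: case_u.
by case: ne; apply: third_eq.
Qed.

Lemma sd_place p q r : is_point p -> is_point q -> supported p s -> supported q s ->
  sd G len s p q r <-> r = D (vsum s p place) (vsum s q place).
Proof.
move=> Pp Pq Sp Sq; apply: sdP => //; first exact: supported_nonnil Sp.
- exact: place_unit.
- exact: place_len.
Qed.

Lemma dom_place p : is_point p -> supported p s -> dom (pl G) (vsum s p place).
Proof.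
move=> Pp Sp; apply: dom_vsum => [a as'|a _|]; last by rewrite point_sum1 //; lra.
  by apply: unit_dom; apply: place_unit.
exact: point_ge0.
Qed.

End Edge.

Definition is_supp p s := is_chain s /\ supported p s.

Lemma point_supp p : exists s, is_point p -> is_supp p s.
Proof.
case: (excluded_middle_informative (is_point p)) => [[_ [s [H1 H2 _ _]]]|]; first by exists s.
by exists [::].
Qed.

Definition supp p := sval (constructive_indefinite_description _ (point_supp p)).

Lemma suppP p : is_point p -> is_chain (supp p) /\ supported p (supp p).
Proof. exact: (svalP (constructive_indefinite_description _ (point_supp p))). Qed.

(** The supporting chain is chosen once and for all; by [devl_supp] any other gives the same
    vector. *)
Definition develop v u w0 p : vec := vsum (supp p) p (place v u w0).

Lemma devl_supp v u w0 p s : adj v u -> valid_vtx w0 -> is_point p -> is_chain s -> supported p s ->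
  develop v u w0 p = vsum s p (place v u w0).
Proof.
move=> vu Hw0 Pp Hs Sp; have [Hs' Sp'] := suppP Pp; have [pE _] := Pp.
have E := place_equiv vu Hw0.
by congr (_, _, _); apply: sum_switch => // a b /E ->.
Qed.

Lemma ev_vsum k s p (f : vtx n -> vec) :
  ev k (vsum s p f) = \big[Rplus/0]_(a <- s) (p a * ev k (f a)).
Proof.
rewrite /ev /vsum /= -!sum_scal -!big_split /=; apply: eq_bigr => a _; ring.
Qed.

Lemma sum_le0 s (F : vtx n -> R) : (forall a, List.In a s -> F a <= 0) ->
  \big[Rplus/0]_(a <- s) F a <= 0.
Proof.
elim: s => [|a s IH] H; first by rewrite big_nil; lra.
rewrite big_cons; have := H a (or_introl erefl).
have : \big[Rplus/0]_(j <- s) F j <= 0 by apply: IH => b bs; apply: H; right.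
lra.
Qed.

Lemma finite_gap (K : seq vec) c : dom (pl G) c ->
  exists2 r, 0 < r & forall k, List.In k K -> 0 < ev k c ->
    forall Y, dom (pl G) Y -> ev k Y <= 0 -> r <= D c Y.
Proof.
move=> Hc; elim: K => [|k K [r r0 IH]]; first by exists 1 => //; lra.
case: (Rlt_dec 0 (ev k c)) => kc; last by exists r => // k' [<-|]; [lra | apply: IH].
have [r' r'0 H] := md_gap Hc kc; exists (Rmin r r'); first exact: Rmin_pos.
move=> k' [<-|kK] kc' Y HY kY.
  by apply: Rle_trans (Rmin_r _ _) _; apply: H.
by apply: Rle_trans (Rmin_l _ _) _; apply: (IH k').
Qed.

(** The point with weights [a], [b], [g] in the triangle with one corner at the origin of polar
    coordinates and the others at [(l, 0)] and [(l', t)]. *)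
Definition tvec (l l' t a b g : R) : vec := lin 1 (lin a (1, 0, 0) b (pol (pl G) l 0)) g (pol (pl G) l' t).

Lemma devl_mk v u w0 (a b g : R) : is_chain [:: v; u; w0] -> 0 <= a -> 0 <= b -> 0 <= g -> a + b + g = 1 ->
  develop v u w0 (mk v u w0 a b g) = tvec (len v u) (len v w0) (angle v u w0) a b g.
Proof.
move=> H a0 b0 g0 E; have [vu vw uw] := proj1 (is_chain3 _ _ _) H.
have [Hv Hu _ _] := vu; have [_ Hw _ _] := vw.
rewrite (@devl_supp _ _ _ _ [:: v; u; w0]) //; [ | exact: mk_point | exact: mk_supported].
have P1 : place v u w0 v = (1, 0, 0) by rewrite /place veq_refl.
have P2 : place v u w0 u = pol (pl G) (len v u) 0.
  by rewrite /place (adj_veqF (adj_sym vu)) veq_refl.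
have P3 : place v u w0 w0 = pol (pl G) (len v w0) (angle v u w0).
  by rewrite /place (adj_veqF (adj_sym vw)) (adj_veqF (adj_sym uw)) veq_refl.
rewrite /vsum !mk_sum // P1 P2 P3 /tvec /lin; congr (_, _, _) => /=; ring.
Qed.

Lemma devl_mk_other v u w0 w (a b g : R) : is_chain [:: v; u; w] -> valid_vtx w0 -> ~ vequiv w w0 ->
  0 <= a -> 0 <= b -> 0 <= g -> a + b + g = 1 ->
  develop v u w0 (mk v u w a b g) = tvec (len v u) (len v w) (- angle v u w) a b g.
Proof.
move=> H Hw0 ne a0 b0 g0 E; have [vu vw uw] := proj1 (is_chain3 _ _ _) H.
have [Hv Hu _ _] := vu; have [_ Hw _ _] := vw.
rewrite (@devl_supp _ _ _ _ [:: v; u; w]) //; [ | exact: mk_point | exact: mk_supported].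
have P1 : place v u w0 v = (1, 0, 0) by rewrite /place veq_refl.
have P2 : place v u w0 u = pol (pl G) (len v u) 0.
  by rewrite /place (adj_veqF (adj_sym vu)) veq_refl.
have P3 : place v u w0 w = pol (pl G) (len v w) (- angle v u w).
  by rewrite /place (adj_veqF (adj_sym vw)) (adj_veqF (adj_sym uw)); case: veqP.
rewrite /vsum !mk_sum // P1 P2 P3 /tvec /lin; congr (_, _, _) => /=; ring.
Qed.

(* The complex is not locally finite; this replaces it where a uniform radius is needed. *)
Definition finite_shapes v u := exists l : seq (R * R), forall v' u' w, vequiv v v' -> vequiv u u' ->
  is_chain [:: v'; u'; w] -> List.In (len v w, len u w) l.

(* Linear functionals vanishing on the sides of the two kinds of unfolded triangles (sg = 1 on the
   positive and sg = -1 on the negative side). *)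
Let ku (t sg : R) : vec := (0, sin t, - sg * cos t).
Let kv (l l' t sg : R) : vec :=
  (S l * S l' * sin t, - C l * S l' * sin t, - sg * (C l' * S l - C l * S l' * cos t)).

(** A simplex containing the edge leaves the open star only through a side opposite [v] or [u]. By
    [finite_shapes] finitely many lines are enough to separate the centre from such sides, so they
    have a common positive distance from it. *)
Lemma star_gap v u w0 (a b g : R) : is_chain [:: v; u; w0] -> finite_shapes v u ->
  0 < a -> 0 < b -> 0 <= g -> a + b + g = 1 ->
  exists2 r, 0 < r & forall s p q, is_chain s -> is_point p -> is_point q ->
    supported p s -> supported q s -> 0 < p v -> 0 < p u -> ~ (0 < q v /\ 0 < q u) ->
    r <= D (develop v u w0 (mk v u w0 a b g)) (develop v u w0 q).
Proof.
move=> H3 [sh Hsh] a0 b0 g0 abg; have [vu vw uw] := proj1 (is_chain3 _ _ _) H3.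
have [Hv Hu _ _] := vu; have [_ Hw _ _] := vw.
have Px : is_point (mk v u w0 a b g) by apply: mk_point => //; lra.
have [At At0] := ang_bound H3; set al := angle v u w0 in At At0.
have [l0 _] := len_adj PM vu; have [l0' _] := len_adj PM vw.
set l := len v u in l0; set l' := len v w0 in l0'.
have Sl := mS_gt0 (pl G) l0; have Sl' := mS_gt0 (pl G) l0'; rewrite -/S in Sl Sl'.
have Cl := mC_gt0 (pl G) (Rlt_le _ _ l0); have sal : 0 < sin al by apply: sin_gt_0; lra.
rewrite devl_mk //; try lra.
rewrite -/l -/l' -/al; set c := tvec _ _ _ _ _ _.
have Hc : dom (pl G) c.
  apply: dom_lin; try lra; last by apply: dom_pol; lra.
  by apply: dom_lin; try lra; [apply: dom_o | apply: dom_pol; lra].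
pose K := (0, 0, 1) :: ku al 1 :: kv l l' al 1 ::
  flatten [seq (let t := acos (cosang (pl G) l z.1 z.2) in [:: ku t (-1); kv l z.1 t (-1)]) | z <- sh].
have [r r0 HK] := finite_gap K Hc; exists r => // s p q Hs Pp Pq Sp Sq pv pu nq.
rewrite (devl_supp _ _ _ Hs Sq) //.
have [_ [v' [v's vv']]] := Sp v (Rgt_not_eq _ _ pv); have [_ [u' [u's uu']]] := Sp u (Rgt_not_eq _ _ pu).
have q0 x : 0 <= q x by apply: point_ge0.
have nq' : q v = 0 \/ q u = 0.
  case: (Req_dec (q v) 0) => [|qv]; first by left.
  right; case: (Req_dec (q u) 0) => // qu; case: nq; have := q0 v; have := q0 u; lra.
have qeq x y : vequiv x y -> q x = q y by case: Pq => + _; apply.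
have HD := dom_place w0 vu Hs v's u's vv' uu' Pq Sq.
have T := third_pos vu Hs v's u's vv' uu'.
have [y] : exists k, [/\ List.In k K, 0 < ev k c & forall x, List.In x s -> q x * ev k (place v u w0 x) <= 0].
  case: (excluded_middle_informative (exists2 z, List.In z s &
      [/\ ~ vequiv z v, ~ vequiv z u & ~ vequiv z w0])) => [[z zs [zv zu zw]]|none].
    have [lz luz [Tz Ez]] := T z zs zv zu.
    have only x : List.In x s -> ~ vequiv x v -> ~ vequiv x u -> vequiv x z.
      have Hv' := chain_valid Hs v's; have Hu' := chain_valid Hs u's.
      have nE e : ~ vequiv e v -> ~ vequiv e v'.
        by move=> h k; apply: h; apply: (vequiv_trans Hv' k); apply: vequiv_sym.
      have nE' e : ~ vequiv e u -> ~ vequiv e u'.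
        by move=> h k; apply: h; apply: (vequiv_trans Hu' k); apply: vequiv_sym.
      move=> xs xv xu; apply: (dim2 Hs v's u's xs zs); auto.
      case: vu => _ _ ne _ e; apply: ne.
      by apply: (vequiv_trans Hv' vv'); apply: (vequiv_trans Hu' e); apply: vequiv_sym.
    have Pz : place v u w0 z = pol (pl G) (len v z) (- angle v u z).
      by rewrite /place; case: veqP => // _; case: veqP => // _; case: veqP.
    have Pv x : vequiv x v -> place v u w0 x = (1, 0, 0) by rewrite /place; case: veqP.
    have Pu x : ~ vequiv x v -> vequiv x u -> place v u w0 x = pol (pl G) l 0.
      by rewrite /place; case: veqP => // _; case: veqP.
    set lz' := len v z in lz Ez Pz; set t := angle v u z in Tz Ez Pz.
    have Slz := mS_gt0 (pl G) lz; rewrite -/S in Slz.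
    have st : 0 < sin t by apply: sin_gt_0; lra.
    have cases k : 0 < ev k c -> List.In k K ->
        q v * ev k (1, 0, 0) <= 0 -> q u * ev k (pol (pl G) l 0) <= 0 ->
        ev k (pol (pl G) lz' (- t)) <= 0 ->
        exists k, [/\ List.In k K, 0 < ev k c & forall x, List.In x s -> q x * ev k (place v u w0 x) <= 0].
      move=> kc kK k1 k2 k3; exists k; split=> // x xs.
      case: (excluded_middle_informative (vequiv x v)) => xv; first by rewrite (qeq _ _ xv) Pv.
      case: (excluded_middle_informative (vequiv x u)) => xu; first by rewrite (qeq _ _ xu) Pu.
      by rewrite (place_equiv vu Hw (only x xs xv xu)) Pz; have := q0 x; nra.
    have zK k : k = ku t (-1) \/ k = kv l lz' t (-1) -> List.In k K.
      move=> kE; do 3!right; have : List.In (len v z, len u z) sh.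
        by apply: (Hsh v' u') => //; apply: (third_chain vu Hs).
      rewrite /t /angle in kE; elim: (sh) => //= z' sh' IH [->|/IH]; last by tauto.
      by rewrite /=; case: kE => ->; [left | right; left].
    (* A centre off the edge is separated from every triangle on the negative side by the line of
       the edge itself. *)
    case: g0 => [g0|g0].
      apply: (cases (0, 0, 1)); rewrite /ev /c /tvec /lin /pol /= ?sin_0 ?sin_neg -/S.
      + have := Rmult_lt_0_compat _ _ g0 (Rmult_lt_0_compat _ _ Sl' sal); rewrite /l' /al; lra.
      + by left.
      + by have := q0 v; lra.
      + by have := q0 u; lra.
      + have := Rmult_lt_0_compat _ _ Slz st; lra.
    (* A centre on the edge also belongs to the triangle with apex [z]; the line of the side on
       which [q] lies separates. *)
    case: nq' => nq'.
      apply: (cases (kv l lz' t (-1))); rewrite ?nq' ?Rmult_0_l; try lra; last first.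
      + rewrite /ev /kv /pol /= -/C -/S cos_neg sin_neg; apply: Req_le; ring.
      + rewrite /ev /kv /pol /= -/C -/S cos_0 sin_0; apply: Req_le; ring.
      + by apply: zK; right.
      rewrite /ev /kv /c /tvec /lin /pol /= -/C -/S -g0 cos_0 sin_0.
      have := Rmult_lt_0_compat _ _ a0 (Rmult_lt_0_compat _ _ (Rmult_lt_0_compat _ _ Sl Slz) st).
      rewrite -/l; nra.
    apply: (cases (ku t (-1))); rewrite ?nq' ?Rmult_0_l; try lra; last first.
    + rewrite /ev /ku /pol /= -/C -/S cos_neg sin_neg; apply: Req_le; ring.
    + rewrite /ev /ku /=; apply: Req_le; ring.
    + by apply: zK; left.
    rewrite /ev /ku /c /tvec /lin /pol /= -/C -/S -g0 cos_0 sin_0.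
    have := Rmult_lt_0_compat _ _ b0 (Rmult_lt_0_compat _ _ Sl st); rewrite -/l; lra.
  have Px' x : List.In x s -> [\/ vequiv x v, ~ vequiv x v /\ vequiv x u |
      [/\ ~ vequiv x v, ~ vequiv x u & vequiv x w0]].
    move=> xs; case: (excluded_middle_informative (vequiv x v)) => xv; first by constructor 1.
    case: (excluded_middle_informative (vequiv x u)) => xu; first by constructor 2.
    constructor 3; split=> //; case: (excluded_middle_informative (vequiv x w0)) => // xw.
    by case: none; exists x.
  have Pl x : List.In x s -> [\/ (vequiv x v /\ place v u w0 x = (1, 0, 0)),
      (vequiv x u /\ place v u w0 x = pol (pl G) l 0) | place v u w0 x = pol (pl G) l' al].
    move=> /Px'[xv|[xv xu]|[xv xu xw]].
    - by constructor 1; split=> //; rewrite /place; case: veqP.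
    - by constructor 2; split=> //; rewrite /place; case: veqP => // _; case: veqP.
    - constructor 3; rewrite (place_equiv vu Hw xw) /place.
      by rewrite (adj_veqF (adj_sym vw)) (adj_veqF (adj_sym uw)) veq_refl.
  case: nq' => nq'.
    exists (kv l l' al 1); split; first by right; right; left.
      rewrite /ev /kv /c /tvec /lin /pol /= -/C -/S cos_0 sin_0.
      have := Rmult_lt_0_compat _ _ a0 (Rmult_lt_0_compat _ _ (Rmult_lt_0_compat _ _ Sl Sl') sal).
      rewrite -/l -/l' -/al; nra.
    move=> x /Pl[[/qeq -> ->]|[_ ->]|->].
    + by rewrite nq'; lra.
    + rewrite /ev /kv /pol /= -/C -/S cos_0 sin_0; apply: Req_le; ring.
    + rewrite /ev /kv /pol /= -/C -/S; apply: Req_le; ring.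
  exists (ku al 1); split; first by right; left.
    rewrite /ev /ku /c /tvec /lin /pol /= -/C -/S cos_0 sin_0.
    have := Rmult_lt_0_compat _ _ b0 (Rmult_lt_0_compat _ _ Sl sal); rewrite -/l -/l' -/al; nra.
  move=> x /Pl[[_ ->]|[/qeq -> ->]|->].
  + rewrite /ev /ku /=; apply: Req_le; ring.
  + by rewrite nq'; lra.
  + rewrite /ev /ku /pol /= -/C -/S; apply: Req_le; ring.
case=> yK yc yn; apply: (HK y yK yc) => //.
by rewrite ev_vsum; apply: sum_le0.
Qed.

(* The unfolding of the open star of an edge is locally 1-Lipschitz for the length metric. *)
Lemma star_lower v u w0 (a b g : R) : is_chain [:: v; u; w0] -> finite_shapes v u ->
  0 < a -> 0 < b -> 0 <= g -> a + b + g = 1 ->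
  exists2 r, 0 < r & forall p q, is_point p -> is_point q ->
    0 < p v -> 0 < p u -> 0 < q v -> 0 < q u ->
    D (develop v u w0 (mk v u w0 a b g)) (develop v u w0 p) < r ->
    D (develop v u w0 (mk v u w0 a b g)) (develop v u w0 q) < r ->
    D (develop v u w0 p) (develop v u w0 q) <= d p q.
Proof.
move=> H3 Hsh a0 b0 g0 abg; have [vu vw uw] := proj1 (is_chain3 _ _ _) H3.
have [Hv Hu _ _] := vu; have [_ Hw _ _] := vw.
have Px : is_point (mk v u w0 a b g) by apply: mk_point => //; lra.
have [R R0 HR] := star_gap H3 Hsh a0 b0 g0 abg.
set c := develop v u w0 (mk v u w0 a b g) in HR *.
have supp_in p s x : is_point p -> supported p s -> 0 < p x ->
    exists2 x', List.In x' s & vequiv x x'.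
  by move=> Pp Sp px; have [_ [x' [x's xx']]] := Sp x (Rgt_not_eq _ _ px); exists x'.
have star s p q : is_chain s -> is_point p -> is_point q -> supported p s -> supported q s ->
    0 < p v -> 0 < p u -> [/\ dom (pl G) (develop v u w0 p), dom (pl G) (develop v u w0 q) &
      forall r, sd G len s p q r -> r = D (develop v u w0 p) (develop v u w0 q)].
  move=> Hs Pp Pq Sp Sq pv pu; have [v' v's vv'] := supp_in _ _ _ Pp Sp pv.
  have [u' u's uu'] := supp_in _ _ _ Pp Sp pu.
  rewrite !(devl_supp _ _ _ Hs) //; split; try exact: (dom_place w0 vu Hs v's u's vv' uu').
  by move=> r /(sd_place vu Hw Hs v's u's vv' uu' _ Pp Pq Sp Sq).
have domU p : is_point p -> 0 < p v -> 0 < p u -> dom (pl G) (develop v u w0 p).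
  by move=> Pp pv pu; have [Hs Sp] := suppP Pp; have [] := star _ p p Hs Pp Pp Sp Sp pv pu.
have [Ev Eu _] := mk_at a b g H3.
have Hc : dom (pl G) c by apply: domU => //; rewrite ?Ev ?Eu.
(* Induction along the string: either unfolding bounds its length directly, or it leaves the open
   star and has then spent what separates [p] from radius [R]. *)
have K p q L : str_len (sd G len) p q L -> 0 < q v -> 0 < q u -> 0 < p v -> 0 < p u ->
    D (develop v u w0 p) (develop v u w0 q) <= L \/ R - D c (develop v u w0 p) <= L.
  elim=> [{}p Pp|{}p {}q z s r {}L Pp Hs Sp Sq Hr HL IH] zv zu pv pu.
    by left; rewrite /D md_refl; [lra | apply: domU].
  have [Pq Pz] := str_len_point HL.
  have [dp dq /(_ _ Hr) ->] := star s p q Hs Pp Pq Sp Sq pv pu.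
  case: (excluded_middle_informative (0 < q v /\ 0 < q u)) => [[qv qu]|nq].
    have dz := domU z Pz zv zu.
    case: (IH zv zu qv qu) => [le|le].
      by left; have := md_tri dp dq dz; rewrite -/D; lra.
    by right; have := md_tri Hc dp dq; rewrite -/D; lra.
  right; have := HR s p q Hs Pp Pq Sp Sq pv pu nq.
  have := md_tri Hc dp dq; have := str_len_ge0 PM HL; rewrite -/D; lra.
(* Within [R / 3] of the centre the unfolded distance is below [2 * R / 3], while leaving the star
   costs more than that. *)
exists (R / 3); first lra.
move=> p q Pp Pq pv pu qv qu cp cq; apply: (d_ge LM) => // L HL.
have := K _ _ _ HL qv qu pv pu.
have := md_tri (domU p Pp pv pu) Hc (domU q Pq qv qu); rewrite (md_sym _ _ c) -/D; lra.
Qed.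

Lemma tri_upper v u w p q : is_chain [:: v; u; w] -> is_point p -> is_point q ->
  supported p [:: v; u; w] -> supported q [:: v; u; w] ->
  d p q <= D (develop v u w p) (develop v u w q).
Proof.
move=> H3 Pp Pq Sp Sq; have [vu vw uw] := proj1 (is_chain3 _ _ _) H3.
have [Hv Hu _ _] := vu; have [_ Hw _ _] := vw.
rewrite !(devl_supp _ _ _ H3) //; apply: (d_sd LM H3 Pp Pq Sp Sq).
have vs : List.In v [:: v; u; w] by left.
have us : List.In u [:: v; u; w] by right; left.
by apply/(sd_place vu Hw H3 vs us (vequiv_refl Hv) (vequiv_refl Hu) _ Pp Pq Sp Sq).
Qed.

Lemma devl_swap v u w p q : is_chain [:: v; u; w] -> is_point p -> is_point q ->
  supported p [:: v; u; w] -> supported q [:: v; u; w] ->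
  D (develop v u w p) (develop v u w q) = D (develop v w u p) (develop v w u q).
Proof.
move=> H3 Pp Pq Sp Sq; have [vu vw uw] := proj1 (is_chain3 _ _ _) H3.
have [Hv Hu _ _] := vu; have [_ Hw _ _] := vw.
rewrite !(devl_supp _ _ _ H3) //.
have vs : List.In v [:: v; u; w] by left.
have us : List.In u [:: v; u; w] by right; left.
have ws : List.In w [:: v; u; w] by right; right; left.
apply/(sd_place vw Hu H3 vs ws (vequiv_refl Hv) (vequiv_refl Hw) _ Pp Pq Sp Sq).
by apply/(sd_place vu Hw H3 vs us (vequiv_refl Hv) (vequiv_refl Hu) _ Pp Pq Sp Sq).
Qed.

End Development.

(** * Segments in homogeneous coordinates *)

Section Segments.
Variable pl : plane.
Implicit Types (V W : vec).

Definition seg V W (t : R) : vec := lin (1 - t) V t W.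

Lemma dom_seg V W t : dom pl V -> dom pl W -> 0 <= t <= 1 -> dom pl (seg V W t).
Proof. by move=> HV HW Ht; apply: dom_lin => //; lra. Qed.

Lemma seg_seg V W r t th : seg (seg V W r) (seg V W t) th = seg V W ((1 - th) * r + th * t).
Proof. by rewrite /seg /lin /=; congr (_, _, _); ring. Qed.

Lemma seg0 V W : seg V W 0 = V.
Proof. by case: V => [[z x] y]; rewrite /seg /lin /=; congr (_, _, _); ring. Qed.

Lemma seg1 V W : seg V W 1 = W.
Proof. by case: W => [[z x] y]; rewrite /seg /lin /=; congr (_, _, _); ring. Qed.

Lemma seg_rev V W t : seg V W t = seg W V (1 - t).
Proof. by rewrite /seg /lin /=; congr (_, _, _); ring. Qed.

Lemma seg_add V W r s t : dom pl V -> dom pl W -> 0 <= r <= s -> s <= t <= 1 ->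
  md pl (seg V W r) (seg V W s) + md pl (seg V W s) (seg V W t) = md pl (seg V W r) (seg V W t).
Proof.
move=> HV HW rs st; have Hr : dom pl (seg V W r) by apply: dom_seg => //; lra.
have Ht : dom pl (seg V W t) by apply: dom_seg => //; lra.
case: (Req_dec r t) => [e|ne].
  have -> : s = r by lra.
  by rewrite md_refl //; lra.
have E : s = (1 - (s - r) / (t - r)) * r + (s - r) / (t - r) * t by field; lra.
have H : 0 <= (s - r) / (t - r) by apply: Rle_mult_inv_pos; lra.
have H' : (s - r) / (t - r) <= 1.
  by apply: (Rmult_le_reg_r (t - r)); rewrite ?Rdiv_mulK; lra.
rewrite {1 2}E -seg_seg; apply: md_add => //; lra.
Qed.

Lemma seg_pos V W s t : dom pl V -> dom pl W -> 0 < md pl V W -> 0 <= s < t -> t <= 1 ->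
  0 < md pl (seg V W s) (seg V W t).
Proof.
move=> HV HW m0 st t1.
have Hs : dom pl (seg V W s) by apply: dom_seg => //; lra.
have p1 : 0 < md pl (seg V W s) W.
  rewrite md_sym seg_rev; apply: md_pos => //; try lra.
  by rewrite md_sym.
have -> : seg V W t = seg (seg V W s) (seg V W 1) ((t - s) / (1 - s)).
  by rewrite seg_seg; congr seg; field; lra.
rewrite seg1; apply: md_pos => //.
  suff : (t - s) / (1 - s) <= 1 by lra.
  by apply: (Rmult_le_reg_r (1 - s)); rewrite ?Rdiv_mulK; lra.
by apply: Rdiv_lt_0_compat; lra.
Qed.

Lemma seg_cont V W t0 eps : dom pl V -> dom pl W -> 0 <= t0 <= 1 -> 0 < eps ->
  exists2 e, 0 < e & forall t, 0 <= t <= 1 -> Rabs (t - t0) < e ->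
    md pl (seg V W t0) (seg V W t) < eps.
Proof.
move=> HV HW Ht0 e0; have H0 := dom_seg HV HW Ht0.
have up V' W' x : dom pl V' -> dom pl W' -> 0 <= x <= 1 -> exists2 e, 0 < e &
    forall t, x <= t <= 1 -> t - x < e -> md pl (seg V' W' x) (seg V' W' t) < eps.
  move=> HV' HW' Hx; have Hs := dom_seg HV' HW' Hx.
  have [r r0 H] := md_cont Hs HW' e0.
  case: (Req_dec x 1) => [x1|x1].
    exists 1; first lra.
    move=> t xt _; have -> : t = x by lra.
    by rewrite md_refl.
  exists (r * (1 - x)); first by apply: Rmult_lt_0_compat; lra.
  move=> t xt tx; have -> : seg V' W' t = seg (seg V' W' x) (seg V' W' 1) ((t - x) / (1 - x)).
    by rewrite seg_seg; congr seg; field; lra.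
  rewrite seg1; apply: H.
    split; first by apply: Rle_mult_inv_pos; lra.
    by apply: (Rmult_le_reg_r (1 - x)); rewrite ?Rdiv_mulK; lra.
  by apply: (Rmult_lt_reg_r (1 - x)); rewrite ?Rdiv_mulK; lra.
have [e1 e10 H1] := up V W t0 HV HW Ht0.
have Ht1 : 0 <= 1 - t0 <= 1 by lra.
have [e2 e20 H2] := up W V (1 - t0) HW HV Ht1.
exists (Rmin e1 e2); first exact: Rmin_pos.
move=> t Ht lt; have lt1 := Rlt_le_trans _ _ _ lt (Rmin_l _ _).
have lt2 := Rlt_le_trans _ _ _ lt (Rmin_r _ _).
case: (Rle_dec t0 t) => [le|/Rnot_le_lt gt].
  by apply: H1; [lra | rewrite Rabs_right in lt1; lra].
rewrite !(seg_rev V W); apply: H2; first lra.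
by rewrite Rabs_left in lt2; lra.
Qed.

End Segments.

(** * Distances inside a triangle *)

Section Triangles.
Variables (n : nat) (G : geom n) (len : vtx n -> vtx n -> R) (d : (vtx n -> R) -> (vtx n -> R) -> R).
Hypothesis PM : piecewise_metric (real G) len.
Hypothesis LM : is_length_metric (sd G len) d.
Hypothesis dim2 : two_dimensional n.
Hypothesis glue : cat_glue d.
Implicit Types (v u w : vtx n) (p q : vtx n -> R).

Let D := md (pl G).
Let dge0 := d_ge0 PM LM.
Let ang := angle G len.
Let devl := develop G len.
Let tv := tvec G.

(** Let [T] be the supremum of the times up to which the path is geodesic from 0. The geodesic
    before [T] and the local one round [T] overlap, so [glue] carries on past [T]. The paths are not
    parametrized by arc length, hence the additive length [dl]. *)
Lemma local_global (c : R -> vtx n -> R) (dl : R -> R -> R) :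
  (forall t, 0 <= t <= 1 -> is_point (c t)) ->
  (forall r s t, 0 <= r <= s -> s <= t <= 1 -> dl r s + dl s t = dl r t) ->
  (forall s t, 0 <= s < t -> t <= 1 -> 0 < dl s t) ->
  (forall t0, 0 <= t0 <= 1 -> exists2 e, 0 < e & forall s t, 0 <= s <= t -> t <= 1 ->
     Rabs (s - t0) < e -> Rabs (t - t0) < e -> d (c s) (c t) = dl s t) ->
  d (c 0) (c 1) = dl 0 1.
Proof.
move=> Pc add pos loc.
pose E t := 0 <= t <= 1 /\ forall s, 0 <= s <= t -> d (c 0) (c s) = dl 0 s.
have E0 : E 0.
  split; first lra.
  move=> s s0; have -> : s = 0 by lra.
  have H0 : 0 <= 0 <= 1 by lra.
  have [e e0 H] := loc 0 H0; apply: H; rewrite ?Rminus_diag ?Rabs_R0; lra.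
have [T [Tub Tlub]] : {m | is_lub E m}.
  apply: completeness; last by exists 0.
  by exists 1 => t [[]].
have T0 : 0 <= T by apply: Tub.
have T1 : T <= 1 by apply: Tlub => t [[]].
have HT : 0 <= T <= 1 by [].
have [e e0 He] := loc T HT.
have below z : 0 <= z < T -> d (c 0) (c z) = dl 0 z.
  move=> zT; case: (excluded_middle_informative (exists2 t, E t & z < t)) => [[t [_ Et] zt]|no].
    by apply: Et; lra.
  have : T <= z; last lra.
  apply: Tlub => t Et; case: (Rle_dec t z) => // /Rnot_le_lt zt.
  by case: no; exists t.
have claim z : 0 <= z <= 1 -> z < T + e -> d (c 0) (c z) = dl 0 z.
  move=> Hz zT; case: (Rlt_dec z T) => [lt|/Rnot_lt_le ge]; first by apply: below; lra.
  case: T0 => [T0|T0]; last first.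
    by apply: He; rewrite -?T0 ?Rminus_diag ?Rabs_R0 ?Rabs_right; lra.
  pose m := Rmin T e; have m0 : 0 < m by apply: Rmin_pos.
  have mT : m <= T by apply: Rmin_l.
  have me : m <= e by apply: Rmin_r.
  (* Two times before [T], so that the overlap is a nondegenerate segment. *)
  pose y := T - m / 2; pose y2 := T - m / 4.
  have ay : Rabs (y - T) < e by rewrite /y Rabs_left; lra.
  have ay2 : Rabs (y2 - T) < e by rewrite /y2 Rabs_left; lra.
  have az : Rabs (z - T) < e by rewrite Rabs_right; lra.
  have Hy : d (c 0) (c y) = dl 0 y by apply: below; rewrite /y; lra.
  have Hy2 : d (c 0) (c y2) = dl 0 y2 by apply: below; rewrite /y2; lra.
  have K1 : d (c y) (c y2) = dl y y2 by apply: He => //; rewrite /y /y2; lra.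
  have K2 : d (c y) (c z) = dl y z by apply: He => //; rewrite /y; lra.
  have K3 : d (c y2) (c z) = dl y2 z by apply: He => //; rewrite /y2; lra.
  have P : d (c 0) (c y2) + d (c y2) (c z) = d (c 0) (c z).
    apply: (@glue _ (c y)); try (apply: Pc; rewrite /y /y2; lra).
    - by rewrite Hy Hy2 K1; apply: add; rewrite /y /y2; lra.
    - by rewrite K1 K2 K3; apply: add; rewrite /y /y2; lra.
    - by rewrite K1; apply: pos; rewrite /y /y2; lra.
  by rewrite -P Hy2 K3; apply: add; rewrite /y2; lra.
have T1' : T = 1.
  case: (Req_dec T 1) => // ne.
  pose t := Rmin 1 (T + e / 2).
  have t1 : t <= 1 by apply: Rmin_l.
  have t2 : t <= T + e / 2 by apply: Rmin_r.
  have t3 : T < t by apply: Rmin_glb_lt; lra.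
  suff : t <= T by lra.
  by apply: Tub; split; [lra | move=> s Hs; apply: claim; lra].
by apply: claim; lra.
Qed.

Lemma dom_tv (l l' t a b g : R) : 0 <= l -> 0 <= l' -> 0 < a -> 0 <= b -> 0 <= g ->
  dom (pl G) (tv l l' t a b g).
Proof.
move=> l0 l0' a0 b0 g0; apply: dom_lin; try lra; last exact: dom_pol.
by apply: dom_lin; try lra; [apply: dom_o | apply: dom_pol].
Qed.

Lemma tv_seg (l l' al a b g a' b' g' t : R) :
  tv l l' al ((1 - t) * a + t * a') ((1 - t) * b + t * b') ((1 - t) * g + t * g') =
  seg (tv l l' al a b g) (tv l l' al a' b' g') t.
Proof. by rewrite /tv /tvec /seg /lin /=; congr (_, _, _); ring. Qed.

Definition cmk v u w (a b g a' b' g' t : R) : vtx n -> R :=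
  mk v u w ((1 - t) * a + t * a') ((1 - t) * b + t * b') ((1 - t) * g + t * g').

Lemma convex_ge0 (a a' t : R) : 0 <= a -> 0 <= a' -> 0 <= t <= 1 -> 0 <= (1 - t) * a + t * a'.
Proof. by move=> ? ? ?; apply: Rplus_le_le_0_compat; apply: Rmult_le_pos; lra. Qed.

Lemma convex_gt0 (a a' t : R) : 0 < a -> 0 < a' -> 0 <= t <= 1 -> 0 < (1 - t) * a + t * a'.
Proof.
move=> a0 a0' [[t0|<-] t1]; last by lra.
have := Rmult_lt_0_compat _ _ t0 a0'; have : 0 <= (1 - t) * a by apply: Rmult_le_pos; lra.
lra.
Qed.

Section Chord.
Variables (v u w : vtx n) (a b g a' b' g' : R).
Hypothesis H3 : is_chain [:: v; u; w].
Hypotheses (a0 : 0 < a) (a0' : 0 < a') (b0 : 0 <= b) (b0' : 0 <= b') (g0 : 0 <= g) (g0' : 0 <= g').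
Hypotheses (E : a + b + g = 1) (E' : a' + b' + g' = 1).

Let c := cmk v u w a b g a' b' g'.

Lemma cmk_point t : 0 <= t <= 1 -> is_point (c t) /\ supported (c t) [:: v; u; w].
Proof.
move=> Ht; split; last exact: mk_supported.
apply: mk_point => //; try (apply: convex_ge0 => //; lra).
transitivity ((1 - t) * (a + b + g) + t * (a' + b' + g')); first ring.
by rewrite E E'; ring.
Qed.

Lemma devl_cmk t : 0 <= t <= 1 -> devl v u w (c t) =
  seg (tv (len v u) (len v w) (ang v u w) a b g) (tv (len v u) (len v w) (ang v u w) a' b' g') t.
Proof.
move=> Ht; rewrite -tv_seg /devl /c /cmk devl_mk //; try (apply: convex_ge0 => //; lra).
transitivity ((1 - t) * (a + b + g) + t * (a' + b' + g')); first ring.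
by rewrite E E'; ring.
Qed.

(** A positive weight of [u] puts the point into the open star of [[v, u]], where the upper bound
    [tri_upper] and the lower bound [star_lower] meet. *)
Lemma chord_local t0 : finite_shapes len v u -> 0 <= t0 <= 1 -> 0 < (1 - t0) * b + t0 * b' ->
  exists2 e, 0 < e & forall s t, 0 <= s <= t -> t <= 1 -> Rabs (s - t0) < e -> Rabs (t - t0) < e ->
     d (c s) (c t) = D (devl v u w (c s)) (devl v u w (c t)).
Proof.
move=> fin Ht0 bt0; have [vu vw uw] := proj1 (is_chain3 _ _ _) H3.
have [l0 _] := len_adj PM vu; have [l0' _] := len_adj PM vw.
have Et : (1 - t0) * a + t0 * a' + ((1 - t0) * b + t0 * b') + ((1 - t0) * g + t0 * g') = 1.
  transitivity ((1 - t0) * (a + b + g) + t0 * (a' + b' + g')); first ring.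
  by rewrite E E'; ring.
have at0 := convex_gt0 a0 a0' Ht0; have gt0 := convex_ge0 g0 g0' Ht0.
have [r r0 H] := star_lower PM LM dim2 H3 fin at0 bt0 gt0 Et.
have dV : dom (pl G) (tv (len v u) (len v w) (ang v u w) a b g) by apply: dom_tv => //; lra.
have dV' : dom (pl G) (tv (len v u) (len v w) (ang v u w) a' b' g') by apply: dom_tv => //; lra.
have [e1 e10 H1] := seg_cont dV dV' Ht0 r0.
have K0 : 0 < Rabs (b' - b) + 1 by have := Rabs_pos (b' - b); lra.
(* Weights are affine in [t]; within [e2] of [t0] that of [u] stays positive. *)
pose e2 := ((1 - t0) * b + t0 * b') / (Rabs (b' - b) + 1).
have e20 : 0 < e2 by apply: Rdiv_lt_0_compat.
have near t : 0 <= t <= 1 -> Rabs (t - t0) < Rmin e1 e2 ->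
    0 < c t v /\ 0 < c t u /\ D (devl v u w (c t0)) (devl v u w (c t)) < r.
  move=> Ht lt; have lt1 := Rlt_le_trans _ _ _ lt (Rmin_l _ _).
  have lt2 := Rlt_le_trans _ _ _ lt (Rmin_r _ _).
  have [Ev Eu _] := mk_at ((1 - t) * a + t * a') ((1 - t) * b + t * b') ((1 - t) * g + t * g') H3.
  rewrite [c t v]Ev [c t u]Eu.
  split; first exact: convex_gt0.
  split; last by rewrite !devl_cmk //; apply: H1.
  have : Rabs (t - t0) * (Rabs (b' - b) + 1) < (1 - t0) * b + t0 * b'.
    by rewrite -[X in _ < X](@Rdiv_mulK _ (Rabs (b' - b) + 1)); [apply: Rmult_lt_compat_r | lra].
  have : - ((t - t0) * (b' - b)) <= Rabs (t - t0) * Rabs (b' - b).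
    by rewrite -Rabs_mult -Rabs_Ropp; apply: Rle_abs.
  have := Rabs_pos (t - t0); nra.
exists (Rmin e1 e2); first exact: Rmin_pos.
move=> s t st t1 ls lt; have Hs : 0 <= s <= 1 by lra.
have Ht : 0 <= t <= 1 by lra.
have [sv [su sr]] := near s Hs ls; have [tv' [tu tr]] := near t Ht lt.
have [Ps Ss] := cmk_point Hs; have [Pt St] := cmk_point Ht.
apply: Rle_antisym; first exact: (tri_upper PM LM dim2).
exact: H.
Qed.

End Chord.

(** Shortcuts through other simplices have to be excluded. Away from [v] and from the side [[u, w]],
    every point of the chord lies in the open star of [[v, u]] or of [[v, w]], so the chord is a
    local geodesic. *)
Lemma tri_exact v u w (a b g a' b' g' : R) : is_chain [:: v; u; w] ->
  finite_shapes len v u -> finite_shapes len v w ->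
  0 < a -> 0 < a' -> 0 <= b -> 0 <= b' -> 0 <= g -> 0 <= g' ->
  a + b + g = 1 -> a' + b' + g' = 1 -> 0 < b + g -> 0 < b' + g' ->
  d (mk v u w a b g) (mk v u w a' b' g') =
  D (tv (len v u) (len v w) (ang v u w) a b g) (tv (len v u) (len v w) (ang v u w) a' b' g').
Proof.
move=> H3 fu fw a0 a0' b0 b0' g0 g0' E E' bg bg'.
have [vu vw uw] := proj1 (is_chain3 _ _ _) H3.
have [l0 _] := len_adj PM vu; have [l0' _] := len_adj PM vw.
pose c := cmk v u w a b g a' b' g'.
set V := tv _ _ _ a b g; set V' := tv _ _ _ a' b' g'.
have dV : dom (pl G) V by apply: dom_tv => //; lra.
have dV' : dom (pl G) V' by apply: dom_tv => //; lra.
have c0E : c 0 = mk v u w a b g by rewrite /c /cmk; congr mk; ring.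
have c1E : c 1 = mk v u w a' b' g' by rewrite /c /cmk; congr mk; ring.
have dev t : 0 <= t <= 1 -> devl v u w (c t) = seg V V' t by exact: devl_cmk.
have pt t : 0 <= t <= 1 -> is_point (c t) /\ supported (c t) [:: v; u; w] by exact: cmk_point.
have I0 : 0 <= 0 <= 1 by lra.
have I1 : 0 <= 1 <= 1 by lra.
have [P0 S0] := pt 0 I0; have [P1 S1] := pt 1 I1.
rewrite -c0E -c1E.
case: (md_ge0 dV dV') => [m0|m0]; last first.
  rewrite /D -m0; apply: Rle_antisym; last exact: dge0.
  have := tri_upper PM LM dim2 H3 P0 P1 S0 S1; rewrite -/devl !dev // seg0 seg1 m0 //.
have -> : D V V' = D (seg V V' 0) (seg V V' 1) by rewrite seg0 seg1.
apply: (local_global (dl := fun s t => D (seg V V' s) (seg V V' t))).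
- by move=> t /pt[].
- by move=> r s t rs st; apply: seg_add.
- by move=> s t st t1; apply: seg_pos.
move=> t0 Ht0; have bg0 := convex_gt0 bg bg' Ht0.
case: (Rlt_dec 0 ((1 - t0) * b + t0 * b')) => [bt|/Rnot_lt_le bt].
  have [e e0 H] := chord_local H3 a0 a0' b0 b0' g0 g0' E E' fu Ht0 bt.
  exists e => // s t st t1 ls lt; rewrite H // -/c !dev //; lra.
have H3' : is_chain [:: v; w; u] by apply/is_chain3; split=> //; apply: adj_sym.
have gt : 0 < (1 - t0) * g + t0 * g'.
  have := convex_ge0 b0 b0' Ht0; lra.
have E2 : a + g + b = 1 by lra.
have E2' : a' + g' + b' = 1 by lra.
have [e e0 H] := chord_local H3' a0 a0' g0 g0' b0 b0' E2 E2' fw Ht0 gt.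
exists e => // s t st t1 ls lt.
have sw r : cmk v w u a g b a' g' b' r = c r by rewrite /c /cmk mk_132.
rewrite -!sw H //; rewrite !sw.
have Hs : 0 <= s <= 1 by lra.
have Ht : 0 <= t <= 1 by lra.
have [Ps Ss] := pt s Hs; have [Pt St] := pt t Ht.
by rewrite -(dev s Hs) -(dev t Ht) /D /devl (devl_swap PM dim2 H3).
Qed.

End Triangles.

(** * Cycles of triangles round a vertex *)

Section Polar.
Variables (n : nat) (G : geom n) (len : vtx n -> vtx n -> R) (d : (vtx n -> R) -> (vtx n -> R) -> R).
Hypothesis PM : piecewise_metric (real G) len.
Hypothesis LM : is_length_metric (sd G len) d.
Hypothesis dim2 : two_dimensional n.
Hypothesis glue : cat_glue d.
Hypothesis uniq : cat_unique d.
Implicit Types (v u w : vtx n) (p q : vtx n -> R).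

Let D := md (pl G).
Let C := mC (pl G).
Let S := mS (pl G).
Let ang := angle G len.
Let devl := develop G len.
Let tv := tvec G.

(** [rho] is the radius in the affine chart: the distance itself in the Euclidean plane, its
    hyperbolic tangent in the hyperbolic plane. *)
Definition kvec (rho t : R) : vec := (1, rho * cos t, rho * sin t).

(** For [rho] below the inverse of this number the point at radius [rho] stays short of the side
    opposite [v], at every angle of the triangle; see [wv_gt0]. *)
Definition polar_bound v u w : R :=
  C (len v u) / (S (len v u) * sin (ang v u w)) + C (len v w) / (S (len v w) * sin (ang v u w)).
(** The weights [wu], [ww] and [wv] solve for [kvec rho t] as a combination of the three corners
    (Cramer's rule); [wn] is their sum. *)
Definition wu v u w (rho t : R) : R := rho * sin (ang v u w - t) / (S (len v u) * sin (ang v u w)).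
Definition ww v u w (rho t : R) : R := rho * sin t / (S (len v w) * sin (ang v u w)).
Definition wv v u w (rho t : R) : R :=
  1 - wu v u w rho t * C (len v u) - ww v u w rho t * C (len v w).
Definition wn v u w (rho t : R) : R := wv v u w rho t + wu v u w rho t + ww v u w rho t.

(* The point of the triangle [v; u; w] at angle t from the edge [v; u] and at (projective) radius rho. *)
Definition polar v u w (rho t : R) : vtx n -> R :=
  mk v u w (wv v u w rho t / wn v u w rho t) (wu v u w rho t / wn v u w rho t)
           (ww v u w rho t / wn v u w rho t).

Section OneTriangle.
Variables (v u w : vtx n).
Hypothesis H3 : is_chain [:: v; u; w].

Let al := ang v u w.
Let lu := len v u.
Let lw := len v w.

Lemma tri_data : [/\ 0 < lu, 0 < lw, 0 < al < PI & 0 < sin al] /\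
  [/\ 0 < S lu, 0 < S lw, 0 < C lu & 0 < C lw].
Proof.
have [vu vw uw] := proj1 (is_chain3 _ _ _) H3.
have [l0 _] := len_adj PM vu; have [l0' _] := len_adj PM vw.
have [A _] := ang_bound PM H3; split; split=> //.
- by apply: sin_gt_0; rewrite /al /ang; lra.
- exact: mS_gt0.
- exact: mS_gt0.
- by apply: mC_gt0; rewrite /lu; lra.
- by apply: mC_gt0; rewrite /lw; lra.
Qed.

Lemma bnd_gt0 : 0 < polar_bound v u w.
Proof.
have [[? ? ? ?] [? ? ? ?]] := tri_data.
by apply: Rplus_lt_0_compat; apply: Rdiv_lt_0_compat => //; apply: Rmult_lt_0_compat.
Qed.

Lemma wu_ge0 rho t : 0 < rho -> 0 <= t <= al -> 0 <= wu v u w rho t.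
Proof.
move=> r0 Ht; have [[? ? ? ?] [? ? ? ?]] := tri_data.
apply: Rle_mult_inv_pos; last exact: Rmult_lt_0_compat.
by apply: Rmult_le_pos; [lra | apply: sin_ge_0; rewrite -/al; lra].
Qed.

Lemma wu_gt0 rho t : 0 < rho -> 0 <= t < al -> 0 < wu v u w rho t.
Proof.
move=> r0 Ht; have [[? ? ? ?] [? ? ? ?]] := tri_data.
apply: Rdiv_lt_0_compat; last exact: Rmult_lt_0_compat.
by apply: Rmult_lt_0_compat; [lra | apply: sin_gt_0; rewrite -/al; lra].
Qed.

Lemma ww_ge0 rho t : 0 < rho -> 0 <= t <= al -> 0 <= ww v u w rho t.
Proof.
move=> r0 Ht; have [[? ? ? ?] [? ? ? ?]] := tri_data.
apply: Rle_mult_inv_pos; last exact: Rmult_lt_0_compat.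
by apply: Rmult_le_pos; [lra | apply: sin_ge_0; lra].
Qed.

Lemma wuw_gt0 rho t : 0 < rho -> 0 <= t <= al -> 0 < wu v u w rho t + ww v u w rho t.
Proof.
move=> r0 Ht; have [[? ? ? ?] [? ? ? ?]] := tri_data.
have ww0 := ww_ge0 r0 Ht.
case: (Req_dec t al) => [ta|ta]; last first.
  by have : 0 < wu v u w rho t by [apply: wu_gt0; lra]; lra.
have := wu_ge0 r0 Ht; suff : 0 < ww v u w rho t by lra.
apply: Rdiv_lt_0_compat; last exact: Rmult_lt_0_compat.
by apply: Rmult_lt_0_compat => //; rewrite ta.
Qed.

Lemma wv_gt0 rho t : 0 < rho -> rho * polar_bound v u w < 1 -> 0 <= t <= al -> 0 < wv v u w rho t.
Proof.
move=> r0 rB Ht; have [[? ? ? sal] [Su Sw Cu Cw]] := tri_data.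
have K l x : 0 < S l -> 0 < C l ->
    rho * sin x / (S l * sin al) * C l <= rho * (C l / (S l * sin al)).
  move=> Sl Cl; have [_ sx] := SIN_bound x.
  have -> : rho * sin x / (S l * sin al) * C l = rho * (C l / (S l * sin al)) * sin x.
    by field; lra.
  rewrite -[X in _ <= X]Rmult_1_r; apply: Rmult_le_compat_l => //.
  apply: Rmult_le_pos; first lra.
  by apply: Rle_mult_inv_pos; [lra | apply: Rmult_lt_0_compat].
have h1 := K (len v u) (al - t) Su Cu; have h2 := K (len v w) t Sw Cw.
by rewrite /wv /wu /ww -/al; rewrite /polar_bound -/al in rB; lra.
Qed.

Lemma wn_gt0 rho t : 0 < rho -> rho * polar_bound v u w < 1 -> 0 <= t <= al -> 0 < wn v u w rho t.
Proof.
move=> r0 rB Ht; have := wv_gt0 r0 rB Ht; have := wuw_gt0 r0 Ht; rewrite /wn; lra.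
Qed.

Lemma wn1 rho t : 0 < wn v u w rho t -> wv v u w rho t / wn v u w rho t +
  wu v u w rho t / wn v u w rho t + ww v u w rho t / wn v u w rho t = 1.
Proof. by move=> N0; rewrite /wn in N0 *; field; lra. Qed.

Lemma pw_point rho t : 0 < rho -> rho * polar_bound v u w < 1 -> 0 <= t <= al ->
  is_point (polar v u w rho t) /\ supported (polar v u w rho t) [:: v; u; w].
Proof.
move=> r0 rB Ht; have N0 := wn_gt0 r0 rB Ht; split; last exact: mk_supported.
apply: mk_point => //; try (apply: Rle_mult_inv_pos => //).
- by have := wv_gt0 r0 rB Ht; lra.
- exact: wu_ge0.
- exact: ww_ge0.
- exact: wn1.
Qed.

Lemma tv_pw sg rho t : sg = 1 \/ sg = -1 -> 0 < wn v u w rho t ->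
  tv lu lw (sg * al) (wv v u w rho t / wn v u w rho t) (wu v u w rho t / wn v u w rho t)
     (ww v u w rho t / wn v u w rho t) =
  lin (/ wn v u w rho t) (kvec rho (sg * t)) 0 (kvec rho (sg * t)).
Proof.
move=> sgE N0; have [[? ? ? sal] [Su Sw Cu Cw]] := tri_data.
have cE x : cos (sg * x) = cos x.
  by case: sgE => ->; [rewrite Rmult_1_l | rewrite (_ : -1 * x = - x) ?cos_neg //; ring].
have sE x : sin (sg * x) = sg * sin x.
  by case: sgE => ->; [rewrite !Rmult_1_l | rewrite (_ : -1 * x = - x) ?sin_neg //; ring].
rewrite /tv /tvec /lin /kvec /pol /= -/C -/S !cE !sE cos_0 sin_0.
move: (wn v u w rho t) N0 => N N0; congr (_, _, _).
- by rewrite /wv /lu /lw; field; lra.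
- rewrite /wu /ww sin_minus -/al -/lu -/lw; field; lra.
- rewrite /wu /ww sin_minus -/al -/lu -/lw; field; lra.
Qed.

Lemma dom_kvec rho t : 0 <= rho -> rho * polar_bound v u w < 1 -> dom (pl G) (kvec rho t).
Proof.
move=> r0 rB; have [[l0 ? ? sal] [Su Sw Cu Cw]] := tri_data.
have E : kvec rho t = lin (1 - rho * C lu / S lu) (1, 0, 0) (rho / S lu) (pol (pl G) lu t).
  by rewrite /kvec /lin /pol /= -/C -/S; congr (_, _, _); field; lra.
have k1 : rho * C lu / S lu < 1.
  apply: Rle_lt_trans rB; rewrite /polar_bound Rmult_plus_distr_l.
  have h : 0 <= rho * (C (len v w) / (S (len v w) * sin (ang v u w))).
    by apply: Rmult_le_pos => //; apply: Rle_mult_inv_pos; [rewrite -/lw; lra | apply: Rmult_lt_0_compat].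
  suff : rho * C lu / S lu <= rho * (C (len v u) / (S (len v u) * sin (ang v u w))) by lra.
  rewrite /Rdiv -(Rmult_assoc rho); apply: Rmult_le_compat_l; first by apply: Rmult_le_pos; rewrite -/lu; lra.
  apply: Rinv_le_contravar; first exact: Rmult_lt_0_compat.
  have [_ s1] := SIN_bound al; rewrite -[X in _ <= X]Rmult_1_r.
  by apply: Rmult_le_compat_l; [rewrite -/lu; lra | exact: s1].
rewrite E; have h0 : 0 <= rho / S lu by apply: Rle_mult_inv_pos.
apply: dom_lin => //; try lra; first exact: dom_o.
by apply: dom_pol; lra.
Qed.

Lemma devl_pw rho t : 0 < rho -> rho * polar_bound v u w < 1 -> 0 <= t <= al ->
  devl v u w (polar v u w rho t) = lin (/ wn v u w rho t) (kvec rho t) 0 (kvec rho t).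
Proof.
move=> r0 rB Ht; have N0 := wn_gt0 r0 rB Ht; have wv0 := wv_gt0 r0 rB Ht.
have wu0 := wu_ge0 r0 Ht; have ww0 := ww_ge0 r0 Ht.
rewrite /devl /polar devl_mk //; try (apply: Rle_mult_inv_pos => //; lra); last exact: wn1.
have := @tv_pw 1 rho t (or_introl erefl) N0; rewrite !Rmult_1_l => <- //.
Qed.

Lemma D_scale (k k' : R) V W : 0 < k -> 0 < k' -> dom (pl G) V -> dom (pl G) W ->
  D (lin k V 0 V) (lin k' W 0 W) = D V W.
Proof.
move=> k0 k0' HV HW; have HW' : dom (pl G) (lin k' W 0 W) by apply: dom_lin => //; lra.
by rewrite /D md_scale // md_sym md_scale // md_sym.
Qed.

Lemma pw_dist rho t rho' t' : finite_shapes len v u -> finite_shapes len v w ->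
  0 < rho -> rho * polar_bound v u w < 1 -> 0 <= t <= al ->
  0 < rho' -> rho' * polar_bound v u w < 1 -> 0 <= t' <= al ->
  d (polar v u w rho t) (polar v u w rho' t') = D (kvec rho t) (kvec rho' t').
Proof.
move=> fu fw r0 rB Ht r0' rB' Ht'.
have N0 := wn_gt0 r0 rB Ht; have wv0 := wv_gt0 r0 rB Ht.
have wu0 := wu_ge0 r0 Ht; have ww0 := ww_ge0 r0 Ht; have wuw := wuw_gt0 r0 Ht.
have N0' := wn_gt0 r0' rB' Ht'; have wv0' := wv_gt0 r0' rB' Ht'.
have wu0' := wu_ge0 r0' Ht'; have ww0' := ww_ge0 r0' Ht'; have wuw' := wuw_gt0 r0' Ht'.
rewrite /polar (tri_exact PM LM dim2 glue H3 fu fw); try (apply: Rdiv_lt_0_compat => //; lra);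
  try (apply: Rle_mult_inv_pos => //; lra); try exact: wn1.
- have E := @tv_pw 1 rho t (or_introl erefl) N0.
  have E' := @tv_pw 1 rho' t' (or_introl erefl) N0'.
  rewrite !Rmult_1_l in E E'; rewrite -/tv -/ang -/al -/lu -/lw E E' -/D D_scale //.
  + exact: Rinv_0_lt_compat.
  + exact: Rinv_0_lt_compat.
  + by apply: dom_kvec => //; lra.
  + by apply: dom_kvec => //; lra.
- by rewrite -Rdiv_plus_distr; apply: Rdiv_lt_0_compat.
- by rewrite -Rdiv_plus_distr; apply: Rdiv_lt_0_compat.
Qed.

Lemma pw_swap rho t : polar v u w rho t = polar v w u rho (al - t).
Proof.
have e : ang v w u = al by rewrite /al /ang (ang_sym PM H3).
rewrite /polar mk_132; have E1 : wu v w u rho (al - t) = ww v u w rho t.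
  by rewrite /wu /ww e; congr (_ * sin _ / _); ring.
have E2 : ww v w u rho (al - t) = wu v u w rho t by rewrite /wu /ww e -/al.
have E3 : wv v w u rho (al - t) = wv v u w rho t by rewrite /wv E1 E2; ring.
have E4 : wn v w u rho (al - t) = wn v u w rho t by rewrite /wn E1 E2 E3; ring.
by rewrite E1 E2 E3 E4.
Qed.

End OneTriangle.

Lemma bnd_swap v u w : is_chain [:: v; u; w] -> polar_bound v w u = polar_bound v u w.
Proof. by move=> H3; rewrite /polar_bound /ang (ang_sym PM H3) Rplus_comm. Qed.

Lemma chain_swap v u w : is_chain [:: v; u; w] -> is_chain [:: v; w; u].
Proof. by move=> /is_chain3[vu vw uw]; apply/is_chain3; split=> //; apply: adj_sym. Qed.

Lemma pw_ray v u w w' rho : is_chain [:: v; u; w] -> is_chain [:: v; u; w'] ->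
  polar v u w rho 0 = polar v u w' rho 0.
Proof.
move=> H H'; have [[_ _ _ s0] [Su _ _ _]] := tri_data H; have [[_ _ _ s0'] _] := tri_data H'.
have E x : is_chain [:: v; u; x] -> 0 < sin (ang v u x) ->
    wu v u x rho 0 = rho / S (len v u) /\ ww v u x rho 0 = 0.
  move=> _ sx; rewrite /wu /ww sin_0 Rminus_0_r; split; first by field; lra.
  by rewrite Rmult_0_r Rdiv_0_l.
have [E1 E2] := E w H s0; have [E1' E2'] := E w' H' s0'.
have E3 : wv v u w rho 0 = wv v u w' rho 0 by rewrite /wv E1 E1' E2 E2' !Rmult_0_l.
rewrite /polar /wn E1 E1' E2 E2' E3 Rdiv_0_l; exact: mk_0.
Qed.

Lemma kvec_rot rho t phi : kvec rho (t + phi) = rot phi (kvec rho t).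
Proof. by rewrite /kvec /rot /= cos_plus sin_plus; congr (_, _, _); ring. Qed.

Lemma devl_any v u w w0 w1 p q : is_chain [:: v; u; w] -> valid_vtx w0 -> valid_vtx w1 ->
  is_point p -> is_point q ->
  supported p [:: v; u; w] -> supported q [:: v; u; w] ->
  D (devl v u w0 p) (devl v u w0 q) = D (devl v u w1 p) (devl v u w1 q).
Proof.
move=> H3 Hw0 Hw1 Pp Pq Sp Sq; have [vu vw uw] := proj1 (is_chain3 _ _ _) H3.
have [Hv Hu _ _] := vu.
rewrite /devl !(devl_supp PM _ _ _ H3) //.
have vs : List.In v [:: v; u; w] by left.
have us : List.In u [:: v; u; w] by right; left.
apply/(sd_place PM dim2 vu Hw1 H3 vs us (vequiv_refl Hv) (vequiv_refl Hu) _ Pp Pq Sp Sq).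
by apply/(sd_place PM dim2 vu Hw0 H3 vs us (vequiv_refl Hv) (vequiv_refl Hu) _ Pp Pq Sp Sq).
Qed.

Section Crossing.
Variables (v u w1 w2 : vtx n).
Hypotheses (H1 : is_chain [:: v; u; w1]) (H2 : is_chain [:: v; u; w2]).
Hypothesis ne : ~ vequiv w1 w2.

Lemma devl_pw_other rho t : 0 < rho -> rho * polar_bound v u w1 < 1 -> 0 <= t <= ang v u w1 ->
  devl v u w2 (polar v u w1 rho t) = lin (/ wn v u w1 rho t) (kvec rho (- t)) 0 (kvec rho (- t)).
Proof.
move=> r0 rB Ht; have N0 := wn_gt0 H1 r0 rB Ht; have wv0 := wv_gt0 H1 r0 rB Ht.
have wu0 := wu_ge0 H1 r0 Ht; have ww0 := ww_ge0 H1 r0 Ht.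
have [_ [_ Hw2 _ _] _] := proj1 (is_chain3 _ _ _) H2.
rewrite /devl /polar devl_mk_other //; try (apply: Rle_mult_inv_pos => //; lra); last exact: wn1.
have := @tv_pw v u w1 H1 (-1) rho t (or_intror erefl) N0.
by rewrite -!(Ropp_mult_distr_l 1) !Rmult_1_l => <-.
Qed.

(** [plane] provides rotations only; reflections come from unfolding one and the same triangle to
    either side of its edge. *)
Lemma kvec_reflect rho t rho' t' : 0 < rho -> rho * polar_bound v u w1 < 1 -> 0 <= t <= ang v u w1 ->
  0 < rho' -> rho' * polar_bound v u w1 < 1 -> 0 <= t' <= ang v u w1 ->
  D (kvec rho (- t)) (kvec rho' (- t')) = D (kvec rho t) (kvec rho' t').
Proof.
move=> r0 rB Ht r0' rB' Ht'; have [P1 S1] := pw_point H1 r0 rB Ht; have [P2 S2] := pw_point H1 r0' rB' Ht'.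
have [_ [_ Hw1 _ _] _] := proj1 (is_chain3 _ _ _) H1.
have [_ [_ Hw2 _ _] _] := proj1 (is_chain3 _ _ _) H2.
have := devl_any H1 Hw2 Hw1 P1 P2 S1 S2; rewrite !devl_pw_other // !(devl_pw H1) //.
have N1 := Rinv_0_lt_compat _ (wn_gt0 H1 r0 rB Ht).
have N2 := Rinv_0_lt_compat _ (wn_gt0 H1 r0' rB' Ht').
by rewrite !D_scale // => *; apply: (dom_kvec H1) => //; lra.
Qed.

(** [star_lower] centred at radius [rho] on the common edge: near that point, passing from one
    triangle to the other is no shorter than in the plane. *)
Lemma crossing rho : finite_shapes len v u -> 0 < rho -> rho * polar_bound v u w2 < 1 ->
  exists2 r, 0 < r & forall rho1 t1 rho2 t2,
    0 < rho1 -> rho1 * polar_bound v u w1 < 1 -> 0 <= t1 < ang v u w1 ->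
    0 < rho2 -> rho2 * polar_bound v u w2 < 1 -> 0 <= t2 < ang v u w2 ->
    D (kvec rho 0) (kvec rho1 (- t1)) < r -> D (kvec rho 0) (kvec rho2 t2) < r ->
    D (kvec rho1 (- t1)) (kvec rho2 t2) <= d (polar v u w1 rho1 t1) (polar v u w2 rho2 t2).
Proof.
move=> fu r0 rB; have [[_ _ A2 _] _] := tri_data H2; have [[_ _ A1 _] _] := tri_data H1.
have H0 : 0 <= 0 <= ang v u w2 by lra.
have H0' : 0 <= 0 < ang v u w2 by lra.
have N0 := wn_gt0 H2 r0 rB H0.
have a0 := Rdiv_lt_0_compat _ _ (wv_gt0 H2 r0 rB H0) N0.
have b0 := Rdiv_lt_0_compat _ _ (wu_gt0 H2 r0 H0') N0.
have g0 := Rle_mult_inv_pos _ _ (ww_ge0 H2 r0 H0) N0.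
have [r r0' H] := star_lower PM LM dim2 H2 fu a0 b0 g0 (wn1 N0).
exists r => // rho1 t1 rho2 t2 r10 r1B Ht1 r20 r2B Ht2.
have Ht1' : 0 <= t1 <= ang v u w1 by lra.
have Ht2' : 0 <= t2 <= ang v u w2 by lra.
have [P1 S1] := pw_point H1 r10 r1B Ht1'; have [P2 S2] := pw_point H2 r20 r2B Ht2'.
have N1 := wn_gt0 H1 r10 r1B Ht1'; have N2 := wn_gt0 H2 r20 r2B Ht2'.
have dk0 : dom (pl G) (kvec rho 0) by apply: (dom_kvec H2) => //; lra.
have dk1 : dom (pl G) (kvec rho1 (- t1)) by apply: (dom_kvec H1) => //; lra.
have dk2 : dom (pl G) (kvec rho2 t2) by apply: (dom_kvec H2) => //; lra.
have := H (polar v u w1 rho1 t1) (polar v u w2 rho2 t2) P1 P2.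
have [e1 e2 _] := mk_at (wv v u w1 rho1 t1 / wn v u w1 rho1 t1)
  (wu v u w1 rho1 t1 / wn v u w1 rho1 t1) (ww v u w1 rho1 t1 / wn v u w1 rho1 t1) H1.
have [f1 f2 _] := mk_at (wv v u w2 rho2 t2 / wn v u w2 rho2 t2)
  (wu v u w2 rho2 t2 / wn v u w2 rho2 t2) (ww v u w2 rho2 t2 / wn v u w2 rho2 t2) H2.
rewrite [polar v u w1 rho1 t1 v]e1 [polar v u w1 rho1 t1 u]e2.
rewrite [polar v u w2 rho2 t2 v]f1 [polar v u w2 rho2 t2 u]f2.
rewrite -/devl -/(polar v u w2 rho 0) devl_pw_other // !(devl_pw H2) //.
have i0 := Rinv_0_lt_compat _ N0; have i1 := Rinv_0_lt_compat _ N1; have i2 := Rinv_0_lt_compat _ N2.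
rewrite -/D !D_scale //; apply.
- exact: Rdiv_lt_0_compat (wv_gt0 H1 r10 r1B Ht1') N1.
- exact: Rdiv_lt_0_compat (wu_gt0 H1 r10 Ht1) N1.
- exact: Rdiv_lt_0_compat (wv_gt0 H2 r20 r2B Ht2') N2.
- exact: Rdiv_lt_0_compat (wu_gt0 H2 r20 Ht2) N2.
Qed.

End Crossing.

End Polar.

(** * The unrolled chord in the plane *)

Section Chords.
Variables (pl : plane) (h tau : R).
Hypotheses (Hh : 0 < h < PI) (tau0 : 0 < tau).
Hypothesis dk : forall rho t, 0 <= rho <= tau -> dom pl (kvec rho t).

Let D := md pl.

(* The line through the two points at radius tau and angles 0 and h, parametrized by the angle. *)
Definition chord_radius (t : R) : R := tau * cos (h / 2) / cos (t - h / 2).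
Definition chord (t : R) : vec := kvec (chord_radius t) t.
(** [chord t] freed of its denominator: every coordinate is a combination of [cos t] and [sin t]. *)
Let raw (t : R) : vec := (cos (t - h / 2), tau * cos (h / 2) * cos t, tau * cos (h / 2) * sin t).

Lemma cos_half_le t : 0 <= t <= h -> 0 < cos (h / 2) <= cos (t - h / 2).
Proof.
move=> Ht; have c0 : 0 < cos (h / 2) by apply: cos_gt_0; lra.
split=> //; case: (Rle_dec 0 (t - h / 2)) => [ge|/Rnot_le_lt lt].
  by apply: cos_decr_1; lra.
by rewrite -(cos_neg (t - _)); apply: cos_decr_1; lra.
Qed.

Lemma crho_bound t : 0 <= t <= h -> 0 < chord_radius t <= tau.
Proof.
move=> Ht; have [c0 c1] := cos_half_le Ht; rewrite /chord_radius; split.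
  by apply: Rdiv_lt_0_compat; [apply: Rmult_lt_0_compat | lra].
apply: (Rmult_le_reg_r (cos (t - h / 2))); first lra.
by rewrite Rdiv_mulK; [apply: Rmult_le_compat_l; lra | lra].
Qed.

Lemma crho0 : chord_radius 0 = tau.
Proof.
have H0 : 0 <= 0 <= h by lra.
have [c0 c1] := cos_half_le H0; rewrite /chord_radius (_ : 0 - h / 2 = - (h / 2)) ?cos_neg; last lra.
by field; lra.
Qed.

Lemma crhoh : chord_radius h = tau.
Proof.
have H0 : 0 <= h <= h by lra.
have [c0 c1] := cos_half_le H0; rewrite /chord_radius (_ : h - h / 2 = h / 2); last lra.
by field; lra.
Qed.

Lemma dom_cvec t : 0 <= t <= h -> dom pl (chord t).
Proof. by move=> Ht; apply: dk; have := crho_bound Ht; lra. Qed.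

Lemma cvec_raw t : 0 <= t <= h -> raw t = lin (cos (t - h / 2)) (chord t) 0 (chord t).
Proof.
move=> Ht; have [c0 c1] := cos_half_le Ht; rewrite /raw /chord /kvec /chord_radius /lin /=.
by congr (_, _, _); field; lra.
Qed.

Lemma dom_raw t : 0 <= t <= h -> dom pl (raw t).
Proof.
move=> Ht; have [c0 c1] := cos_half_le Ht; rewrite cvec_raw //.
by apply: dom_lin; try lra; apply: dom_cvec.
Qed.

Lemma D_raw s t : 0 <= s <= h -> 0 <= t <= h -> D (raw s) (raw t) = D (chord s) (chord t).
Proof.
move=> Hs Ht; have [c0 c1] := cos_half_le Hs; have [c0' c1'] := cos_half_le Ht.
have ds := dom_cvec Hs; have dt := dom_cvec Ht.
have dr := dom_raw Ht; rewrite /D (cvec_raw Hs) md_scale //; try lra.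
by rewrite (cvec_raw Ht) md_sym md_scale // 1?md_sym; lra.
Qed.

(** The identity holds for every combination of cosine and sine. Its coefficients being nonnegative
    for [r <= s <= t], it says that the points of the chord come in the order of their angles. *)
Lemma raw_lin r s t : lin (sin (t - r)) (raw s) 0 (raw s) =
  lin (sin (t - s)) (raw r) (sin (s - r)) (raw t).
Proof.
have E a b c : sin (c - a) * cos b = sin (c - b) * cos a + sin (b - a) * cos c.
  have := sin2_cos2 b; rewrite /Rsqr !sin_minus; nra.
have E' a b c : sin (c - a) * sin b = sin (c - b) * sin a + sin (b - a) * sin c.
  have := sin2_cos2 b; rewrite /Rsqr !sin_minus; nra.
rewrite /raw /lin /=; congr (_, _, _).
- rewrite Rmult_0_l Rplus_0_r.
  have K x y : x - h / 2 - (y - h / 2) = x - y by lra.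
  by have := E (r - h / 2) (s - h / 2) (t - h / 2); rewrite !K.
- transitivity (tau * cos (h / 2) * (sin (t - r) * cos s)); first ring.
  by rewrite E; ring.
- transitivity (tau * cos (h / 2) * (sin (t - r) * sin s)); first ring.
  by rewrite E'; ring.
Qed.

Lemma cvec_add r s t : 0 <= r <= s -> s <= t <= h ->
  D (chord r) (chord s) + D (chord s) (chord t) = D (chord r) (chord t).
Proof.
move=> rs st; have Hr : 0 <= r <= h by lra.
have Hs : 0 <= s <= h by lra.
have Ht : 0 <= t <= h by lra.
case: (Req_dec r t) => [e|ne].
  have -> : s = r by lra.
  by rewrite /D md_refl; [lra | apply: dom_cvec].
rewrite -!D_raw //.
have s0 : 0 < sin (t - r) by apply: sin_gt_0; lra.
have s1 : 0 <= sin (t - s) by apply: sin_ge_0; lra.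
have s2 : 0 <= sin (s - r) by apply: sin_ge_0; lra.
have dr := dom_raw Hr; have ds := dom_raw Hs; have dt := dom_raw Ht.
have E := md_scale s0 ds dr; have E' := md_scale s0 ds dt.
rewrite /D (md_sym _ (raw r) (raw s)) -E -E' raw_lin md_sym; apply: md_add => //.
case: s1 => [|e1]; first lra.
case: s2 => [|e2]; first lra.
have : raw s = (0, 0, 0) -> False.
  by rewrite /raw => -[h0 _ _]; have := cos_half_le Hs; lra.
have := raw_lin r s t; rewrite -e1 -e2 /lin /= => -[K1 _ _] _.
have := cos_half_le Hs; nra.
Qed.

Lemma cvec_pos s t : 0 <= s < t -> t <= h -> 0 < D (chord s) (chord t).
Proof.
move=> st th; have Hs : 0 <= s <= h by lra.
have Ht : 0 <= t <= h by lra.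
have [rs _] := crho_bound Hs; have [rt _] := crho_bound Ht.
(* The functional vanishes on the ray at angle [s] and is positive beyond it. *)
pose k : vec := (0, - sin s, cos s).
have kE x : ev k (chord x) = chord_radius x * sin (x - s).
  by rewrite /ev /k /chord /kvec /= sin_minus; ring.
have st0 : 0 < sin (t - s) by apply: sin_gt_0; lra.
have kt : 0 < ev k (chord t) by rewrite kE; apply: Rmult_lt_0_compat.
have [r r0 H] := md_gap (dom_cvec Ht) kt.
rewrite /D md_sym; apply: Rlt_le_trans r0 _; apply: H; first exact: dom_cvec.
by rewrite kE Rminus_diag sin_0; lra.
Qed.

Lemma sin_plus_le x y : 0 <= x <= PI -> 0 <= y <= PI -> sin (x + y) <= sin x + sin y.
Proof.
move=> Hx Hy; rewrite sin_plus.
have sx : 0 <= sin x by apply: sin_ge_0; lra.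
have sy : 0 <= sin y by apply: sin_ge_0; lra.
have [_ cx] := COS_bound x; have [_ cy] := COS_bound y; nra.
Qed.

Lemma sin_le_id x : 0 <= x -> sin x <= x.
Proof. by case=> [/sin_lt_x|<-]; rewrite ?sin_0; lra. Qed.

(** Continuity along the segments from [raw m] to the two ends of the chord; [raw_lin] turns angles
    into segment parameters. *)
Lemma cvec_cont m r : 0 <= m <= h -> 0 < r ->
  exists2 e, 0 < e & forall t, 0 <= t <= h -> Rabs (t - m) < e -> D (chord m) (chord t) < r.
Proof.
move=> Hm r0; have dm := dom_raw Hm.
have K z : 0 <= z <= h -> exists2 e, 0 < e & forall t, 0 <= t <= h ->
    (m <= t <= z \/ z <= t <= m) -> Rabs (t - m) < e -> D (chord m) (chord t) < r.
  move=> Hz; have dz := dom_raw Hz.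
  case: (Req_dec z m) => [e|zm].
    exists 1; first lra.
    move=> t Ht tz _; have -> : t = m by lra.
    by rewrite /D md_refl //; apply: dom_cvec.
  have [r1 r10 H] := md_cont dm dz r0.
  have s0 : 0 < sin (Rabs (z - m)).
    have : 0 < Rabs (z - m) by apply: Rabs_pos_lt; lra.
    by move=> ?; apply: sin_gt_0 => //; have : Rabs (z - m) <= h by [apply: Rabs_le; lra]; lra.
  exists (r1 * sin (Rabs (z - m))); first exact: Rmult_lt_0_compat.
  move=> t Ht tz lt; set A := Rabs (z - t); set B := Rabs (t - m) in lt *.
  have A0 : 0 <= A by apply: Rabs_pos.
  have B0 : 0 <= B by apply: Rabs_pos.
  have AB : Rabs (z - m) = A + B.
    rewrite /A /B; case: tz => tz; first by rewrite !Rabs_right; lra.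
    by rewrite !Rabs_left1; lra.
  have Ah : A <= h by rewrite /A; apply: Rabs_le; lra.
  have Bh : B <= h by rewrite /B; apply: Rabs_le; lra.
  have ABh : A + B <= h by rewrite -AB; apply: Rabs_le; lra.
  rewrite AB in s0 lt.
  have sA : 0 <= sin A by apply: sin_ge_0; lra.
  have sB : 0 <= sin B by apply: sin_ge_0; lra.
  have sAB : sin (A + B) <= sin A + sin B by apply: sin_plus_le; lra.
  have raw_abs : lin (sin (A + B)) (raw t) 0 (raw t) = lin (sin A) (raw m) (sin B) (raw z).
    have := raw_lin m t z; rewrite -AB /A /B; case: tz => tz.
      by rewrite !Rabs_right; lra || idtac.
    rewrite !Rabs_left1; try lra.
    rewrite /lin !sin_neg /= => -[e1 e2 e3]; congr (_, _, _); lra.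
  have dt := dom_raw Ht.
  rewrite -D_raw // /D md_sym -(md_scale s0 dt dm) raw_abs.
  (* [q] normalizes the two weights to a convex combination; it is at least [sin (A + B)], which
     does not depend on [t]. *)
  have [q qE] : exists q, q = sin A + sin B by exists (sin A + sin B).
  rewrite -qE in sAB; have q0 : 0 < q by lra.
  have -> : lin (sin A) (raw m) (sin B) (raw z) =
      lin q (lin (1 - sin B / q) (raw m) (sin B / q) (raw z)) 0
        (lin (1 - sin B / q) (raw m) (sin B / q) (raw z)).
    by rewrite /lin /=; have -> : sin A = q - sin B by [lra]; congr (_, _, _); field; lra.
  have t0 : 0 <= sin B / q by apply: Rle_mult_inv_pos.
  have t1 : sin B / q <= 1.
    by apply: (Rmult_le_reg_r q) => //; rewrite Rdiv_mulK; lra.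
  have dl : dom pl (lin (1 - sin B / q) (raw m) (sin B / q) (raw z)) by apply: dom_lin => //; lra.
  rewrite md_scale // md_sym; apply: H; first by lra.
  apply: (Rmult_lt_reg_r q) => //; rewrite Rdiv_mulK; last lra.
  have := sin_le_id B0; nra.
have H0 : 0 <= 0 <= h by lra.
have H1 : 0 <= h <= h by lra.
have [e1 e10 K1] := K _ H1; have [e2 e20 K2] := K _ H0.
exists (Rmin e1 e2); first exact: Rmin_pos.
move=> t Ht lt; have lt1 := Rlt_le_trans _ _ _ lt (Rmin_l _ _).
have lt2 := Rlt_le_trans _ _ _ lt (Rmin_r _ _).
case: (Rle_dec m t) => [le|/Rnot_le_lt gt]; first by apply: K1 => //; left; lra.
by apply: K2 => //; right; lra.
Qed.

End Chords.

(** * Unrolling a cycle of triangles *)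

Section Cycles.
Variables (n : nat) (G : geom n) (len : vtx n -> vtx n -> R) (d : (vtx n -> R) -> (vtx n -> R) -> R).
Hypothesis PM : piecewise_metric (real G) len.
Hypothesis LM : is_length_metric (sd G len) d.
Hypothesis dim2 : two_dimensional n.
Hypothesis glue : cat_glue d.
Hypothesis uniq : cat_unique d.
Implicit Types (v w : vtx n) (p q : vtx n -> R).

Let D := md (pl G).
Let ang := angle G len.
Let pw := polar G len.
Let bnd := polar_bound G len.

Fixpoint phi v (u : nat -> vtx n) (i : nat) : R :=
  if i is i'.+1 then phi v u i' + ang v (u i') (u i'.+1) else 0.

Section Path.
Variables (v : vtx n) (u : nat -> vtx n) (J : nat) (h tau : R).
Hypothesis Hc : forall i, (i <= J)%N -> is_chain [:: v; u i; u i.+1].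
Hypothesis Hn : forall i, (i < J)%N -> ~ vequiv (u i) (u i.+2).
Hypothesis fin : forall i, (i <= J.+1)%N -> finite_shapes len v (u i).
Hypotheses (Hh : 0 < h < PI) (tau0 : 0 < tau).
Hypothesis Hb : forall i, (i <= J)%N -> tau * bnd v (u i) (u i.+1) < 1.

Let crho := chord_radius h tau.
Let cvec := chord h tau.

(** The point of the complex over [chord t], taken in triangle number [i]; consecutive triangles
    agree on their common ray by [cpt_ray]. *)
Definition cpt (i : nat) (t : R) : vtx n -> R := pw v (u i) (u i.+1) (crho t) (t - phi v u i).

Lemma path_dom rho t : 0 <= rho <= tau -> dom (pl G) (kvec rho t).
Proof.
move=> Hr; have B0 := bnd_gt0 PM (Hc (leq0n J)); have := Hb (leq0n J) => H.
apply: (dom_kvec PM (Hc (leq0n J))); first lra.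
by apply: Rle_lt_trans H; apply: Rmult_le_compat_r; [apply: Rlt_le | lra].
Qed.

Lemma crho_bnd i t : (i <= J)%N -> 0 <= t <= h -> 0 < crho t /\ crho t * bnd v (u i) (u i.+1) < 1.
Proof.
move=> iJ Ht; have [c0 c1] := crho_bound Hh tau0 Ht; split=> //.
have B0 := bnd_gt0 PM (Hc iJ).
by apply: Rle_lt_trans (Hb iJ); apply: Rmult_le_compat_r; [apply: Rlt_le | ].
Qed.

Lemma phi_ge0 i : (i <= J.+1)%N -> 0 <= phi v u i.
Proof.
elim: i => [|i IH] iJ /=; first lra.
have [[_ _ A _] _] := tri_data PM (Hc iJ); have := IH (ltnW iJ); rewrite /ang; lra.
Qed.

Lemma phi_step i : (i <= J)%N -> phi v u i < phi v u i.+1.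
Proof. by move=> iJ /=; have [[_ _ A _] _] := tri_data PM (Hc iJ); rewrite /ang; lra. Qed.

Lemma cpt_point i t : (i <= J)%N -> 0 <= t <= h -> phi v u i <= t <= phi v u i.+1 ->
  is_point (cpt i t).
Proof.
move=> iJ Ht It; have [c0 cb] := crho_bnd iJ Ht.
have It' : 0 <= t - phi v u i <= ang v (u i) (u i.+1) by move: It => /=; lra.
by case: (pw_point PM (Hc iJ) c0 cb It').
Qed.

Lemma cpt_dist i s t : (i <= J)%N -> 0 <= s <= h -> 0 <= t <= h ->
  phi v u i <= s <= phi v u i.+1 -> phi v u i <= t <= phi v u i.+1 ->
  d (cpt i s) (cpt i t) = D (cvec s) (cvec t).
Proof.
move=> iJ Hs Ht Is It; have [c0 cb] := crho_bnd iJ Hs; have [c0' cb'] := crho_bnd iJ Ht.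
rewrite /= in Is It; rewrite /cpt (pw_dist PM LM dim2 glue (Hc iJ)) //; try (apply: fin => //; exact: ltnW);
  try (rewrite -/ang; lra).
have dk r t' : 0 <= r <= tau -> dom (pl G) (kvec r t') by apply: path_dom.
have [_ c1] := crho_bound Hh tau0 Hs; have [_ c1'] := crho_bound Hh tau0 Ht.
rewrite -(md_rot (phi v u i)); try (apply: dk; rewrite -/crho in c1 c1'; lra).
by rewrite -!kvec_rot /D /cvec /chord; congr (md _ (kvec _ _) (kvec _ _)); ring.
Qed.

Lemma cpt_ray i : (i < J)%N -> cpt i (phi v u i.+1) = cpt i.+1 (phi v u i.+1).
Proof.
move=> iJ; have C1 := Hc (ltnW iJ); have C2 := Hc iJ.
rewrite /cpt /pw (pw_swap PM C1) -/ang Rminus_diag.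
rewrite (_ : ang v (u i) (u i.+1) - (phi v u i.+1 - phi v u i) = 0); last by rewrite /=; ring.
exact: (pw_ray PM _ (chain_swap C1) C2).
Qed.

(** The chord rolled back onto the triangles is a geodesic. Inside one triangle this is [cpt_dist];
    across a ray the distance is bounded below by [crossing] and above by the triangle inequality,
    and [glue] joins the pieces. *)
Lemma cpt_path i s t : (i <= J)%N -> 0 <= s < phi v u 1 -> s <= t <= h ->
  phi v u i <= t <= phi v u i.+1 -> d (cpt 0 s) (cpt i t) = D (cvec s) (cvec t).
Proof.
have dk r t' : 0 <= r <= tau -> dom (pl G) (kvec r t') by apply: path_dom.
elim: i t => [|i IH] t iJ Is Hst It; first by apply: cpt_dist => //=; rewrite /= in Is; lra.
set m := phi v u i.+1 in It.
have iJ' := ltnW iJ; have p0 := phi_ge0 (leqW iJ').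
have st1 := phi_step iJ'; have st2 := phi_step iJ; rewrite -/m in st1 st2.
have sm : s < m.
  have : phi v u 1 <= m.
    rewrite /m; elim: (i) iJ' => [|k IHk] kJ; first lra.
    by have := IHk (ltnW kJ); have := phi_step kJ; lra.
  lra.
have m0 : 0 < m by lra.
have Hm : 0 <= m <= h by lra.
have Ht : 0 <= t <= h by lra.
have Hs : 0 <= s <= h by lra.
have ma : d (cpt 0 s) (cpt i m) = D (cvec s) (cvec m) by apply: IH => //; rewrite -/m; lra.
have E : cpt i m = cpt i.+1 m by exact: cpt_ray.
case: (Req_dec t m) => [->|tm]; first by rewrite -E.
have C1 := chain_swap (Hc iJ'); have C2 := Hc iJ.
have [cm cmb] := crho_bnd iJ Hm.
have [r r0 Hr] := crossing PM LM dim2 C1 C2 (Hn iJ) (fin (leqW iJ)) cm cmb.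
have [e e0 He] := cvec_cont Hh tau0 dk Hm r0.
pose x0 := Rmax s (phi v u i).
have x0m : x0 < m by apply: Rmax_lub_lt.
have x0s : s <= x0 by apply: Rmax_l.
have x0p : phi v u i <= x0 by apply: Rmax_r.
pose eta := Rmin (e / 2) (Rmin ((m - x0) / 2) (t - m)).
have eta0 : 0 < eta by apply: Rmin_pos; [lra | apply: Rmin_pos; lra].
have eta1 : eta <= e / 2 by apply: Rmin_l.
have eta2 : eta <= (m - x0) / 2 by apply: Rle_trans (Rmin_r _ _) (Rmin_l _ _).
have eta3 : eta <= t - m by apply: Rle_trans (Rmin_r _ _) (Rmin_r _ _).
(* Halved so that [m + etaz] stays strictly before the next ray, as [crossing] requires. *)
pose etaz := eta / 2.
have Hy : 0 <= m - eta <= h by lra.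
have Hz : 0 <= m + etaz <= h by rewrite /etaz; lra.
have Iy : phi v u i <= m - eta <= m by lra.
have Iz : m <= m + etaz <= phi v u i.+2 by rewrite /etaz; lra.
have Im : m <= m <= phi v u i.+2 by lra.
have Im' : phi v u i <= m <= m by lra.
have Py := cpt_point iJ' Hy Iy; have Pz := cpt_point iJ Hz Iz; have Pm := cpt_point iJ Hm Im.
have Pt := cpt_point iJ Ht It; have Ps : is_point (cpt 0 s) by apply: cpt_point => //=; rewrite /= in Is; lra.
have Dy : d (cpt 0 s) (cpt i (m - eta)) = D (cvec s) (cvec (m - eta)).
  by apply: IH => //; rewrite -/m; lra.
have Dym : d (cpt i (m - eta)) (cpt i.+1 m) = D (cvec (m - eta)) (cvec m).
  by rewrite -E; apply: cpt_dist.
have Dmz : d (cpt i.+1 m) (cpt i.+1 (m + etaz)) = D (cvec m) (cvec (m + etaz)) by apply: cpt_dist.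
have Dmt : d (cpt i.+1 m) (cpt i.+1 t) = D (cvec m) (cvec t) by apply: cpt_dist.
have Dzt : d (cpt i.+1 (m + etaz)) (cpt i.+1 t) = D (cvec (m + etaz)) (cvec t) by apply: cpt_dist.
have rotD r1 t1 r2 t2 : 0 <= r1 <= tau -> 0 <= r2 <= tau ->
    D (kvec r1 t1) (kvec r2 t2) = D (kvec r1 (t1 + m)) (kvec r2 (t2 + m)).
  by move=> h1 h2; rewrite !kvec_rot /D md_rot //; apply: dk.
have [cy0 cy1] := crho_bound Hh tau0 Hy; have [cz0 cz1] := crho_bound Hh tau0 Hz.
have [cm0 cm1] := crho_bound Hh tau0 Hm.
have Dyz : D (cvec (m - eta)) (cvec (m + etaz)) <= d (cpt i (m - eta)) (cpt i.+1 (m + etaz)).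
  have [by0 by1] := crho_bnd iJ' Hy; have [bz0 bz1] := crho_bnd iJ Hz.
  rewrite /cpt /pw (pw_swap PM (Hc iJ')) -/ang -/m.
  have -> : ang v (u i) (u i.+1) - (m - eta - phi v u i) = eta by rewrite /m /=; ring.
  have -> : m + etaz - m = etaz by ring.
  have e1 : cvec (m - eta) = kvec (crho (m - eta)) (- eta + m).
    by rewrite /cvec /chord; congr kvec; ring.
  have e2 : cvec (m + etaz) = kvec (crho (m + etaz)) (etaz + m).
    by rewrite /cvec /chord; congr kvec; ring.
  have e3 : cvec m = kvec (crho m) (0 + m).
    by rewrite /cvec /chord; congr kvec; ring.
  rewrite e1 e2 -rotD; try (rewrite -/crho in cy0 cy1 cz0 cz1; lra).
  have angs : ang v (u i.+1) (u i) = m - phi v u i.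
    by rewrite /ang -(ang_sym PM (Hc iJ')) /m /=; rewrite /ang; ring.
  have angs2 : ang v (u i.+1) (u i.+2) = phi v u i.+2 - m by rewrite /m /=; ring.
  apply: Hr => //.
  - by rewrite (bnd_swap PM (Hc iJ')).
  - by rewrite -/ang angs; lra.
  - by rewrite -/ang angs2 /etaz; lra.
  - rewrite -/D rotD; try (rewrite -/crho in cy0 cy1 cm0 cm1; lra).
    by rewrite -e3 -e1; apply: He => //; rewrite Rabs_left; lra.
  - rewrite -/D rotD; try (rewrite -/crho in cz0 cz1 cm0 cm1; lra).
    by rewrite -e3 -e2; apply: He => //; rewrite Rabs_right /etaz; lra.
have add := cvec_add Hh tau0 dk.
have A1 := add (m - eta) m (m + etaz); rewrite -/D -/cvec in A1.
have A2 := add s (m - eta) m; rewrite -/D -/cvec in A2.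
have A3 := add m (m + etaz) t; rewrite -/D -/cvec in A3.
have A4 := add s m t; rewrite -/D -/cvec in A4.
have Z : 0 <= etaz by rewrite /etaz; lra.
have etazt : m + etaz <= t by rewrite /etaz; lra.
(* The gluing is over the segment from [m - eta] to [m] here, and over the one from [m] to
   [m + etaz] in [G2]. *)
have G1 : d (cpt 0 s) (cpt i.+1 m) + d (cpt i.+1 m) (cpt i.+1 (m + etaz)) =
    d (cpt 0 s) (cpt i.+1 (m + etaz)).
  apply: (@glue _ (cpt i (m - eta))) => //.
  - by rewrite Dy Dym -E ma A2 //; lra.
  - rewrite Dym Dmz; apply: Rle_antisym; last by rewrite -Dym -Dmz; apply: (d_tri LM).
    by rewrite A1 //; lra.
  - by rewrite Dym; apply: cvec_pos => //; lra.
have G2 : d (cpt 0 s) (cpt i.+1 (m + etaz)) + d (cpt i.+1 (m + etaz)) (cpt i.+1 t) =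
    d (cpt 0 s) (cpt i.+1 t).
  apply: (@glue _ (cpt i.+1 m)) => //.
  - by rewrite Dmz Dzt Dmt A3 //; lra.
  - by rewrite Dmz; apply: cvec_pos => //; rewrite /etaz; lra.
have e1 : d (cpt 0 s) (cpt i.+1 m) = D (cvec s) (cvec m) by rewrite -E.
rewrite -G2 -G1 e1 Dmz Dzt.
have mz : 0 <= m <= m + etaz by lra.
have mt : m + etaz <= t <= h by lra.
have s_m : 0 <= s <= m by lra.
have m_t : m <= t <= h by lra.
have B3 := A3 mz mt; have B4 := A4 s_m m_t; rewrite -B4 -B3; ring.
Qed.

End Path.

Lemma phi_rev v u k : (forall i, (i < k)%N -> is_chain [:: v; u i; u i.+1]) ->
  forall i, (i <= k)%N -> phi v (fun j => u (k - j)%N) i = phi v u k - phi v u (k - i)%N.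
Proof.
move=> Hc; elim=> [|i IH] ik; first by rewrite subn0 /=; ring.
rewrite [LHS]/= IH ?(ltnW ik) //.
have e : (k - i = (k - i.+1).+1)%N by rewrite subnSK.
rewrite e [phi v u (k - i.+1).+1]/= /ang (ang_sym PM (Hc _ _)) ?rltn_subLR //.
  by ring.
by rewrite ltn_subrL; apply: leq_ltn_trans ik.
Qed.

Lemma small_radius (F : nat -> R) k : exists2 tau, 0 < tau & forall i, (i < k)%N -> tau * F i < 1.
Proof.
elim: k => [|k [t t0 IH]]; first by exists 1; [lra | ].
have K0 : 0 < 1 + Rabs (F k) by have := Rabs_pos (F k); lra.
exists (Rmin t (/ (1 + Rabs (F k)))) => [|i]; first by apply: Rmin_pos => //; apply: Rinv_0_lt_compat.
have T0 : 0 < Rmin t (/ (1 + Rabs (F k))) by apply: Rmin_pos => //; apply: Rinv_0_lt_compat.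
rewrite ltnS leq_eqVlt => /orP[/eqP ->|ik].
  apply: Rle_lt_trans (_ : / (1 + Rabs (F k)) * Rabs (F k) < 1).
    apply: (@Rle_trans _ (Rmin t (/ (1 + Rabs (F k))) * Rabs (F k))).
      by apply: Rmult_le_compat_l; [lra | apply: Rle_abs].
    by apply: Rmult_le_compat_r; [apply: Rabs_pos | apply: Rmin_r].
  apply: (Rmult_lt_reg_r (1 + Rabs (F k))) => //.
  by rewrite Rmult_comm -Rmult_assoc Rinv_r; lra.
case: (Rle_dec (F i) 0) => [F0|/Rnot_le_lt F0]; first by nra.
apply: Rle_lt_trans (IH i ik); apply: Rmult_le_compat_r; [lra | exact: Rmin_l].
Qed.

Lemma phi_cross v u k h : 0 <= h <= phi v u k -> (0 < k)%N ->
  exists2 j, (j < k)%N & phi v u j <= h <= phi v u j.+1.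
Proof.
elim: k => // k IH Hh _; case: (Rle_dec (phi v u k) h) => [le|/Rnot_le_lt lt].
  by exists k => //; lra.
case: k IH Hh lt => [|k] IH Hh lt; first by rewrite /= in lt; lra.
have [||j jk Hj] := IH => //; first by lra.
by exists j => //; apply: ltnW.
Qed.

(* If the total angle theta of the cycle were less than 2 pi, unrolling it in both directions from the
   ray through (u 0) would give two distinct geodesics to the opposite point at angle theta / 2. *)
Theorem cycle_angle v u k : (1 < k)%N -> (forall i, (i < k)%N -> is_chain [:: v; u i; u i.+1]) ->
  (forall i, (i <= k)%N -> finite_shapes len v (u i)) ->
  (forall i, (i.+2 <= k)%N -> ~ vequiv (u i) (u i.+2)) -> u k = u 0%N ->
  ~ vequiv (u k.-1) (u 1%N) -> 2 * PI <= phi v u k.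
Proof.
move=> k1 Hc fin Hn ku ne; case: (Rle_dec (2 * PI) (phi v u k)) => // /Rnot_le_lt lt.
exfalso; have k0 : (0 < k)%N by apply: ltnW.
have step i : (i < k)%N -> phi v u i < phi v u i.+1.
  by move=> ik /=; have [[_ _ A _] _] := tri_data PM (Hc i ik); rewrite /ang; lra.
have th0 : 0 < phi v u k.
  have : forall i, (i < k)%N -> 0 < phi v u i.+1.
    elim=> [|i IH] ik; first by have := step 0%N ik; rewrite [phi v u 0]/=.
    by have := IH (ltnW ik); have := step _ ik; lra.
  by move=> /(_ k.-1); rewrite prednK //; apply.
pose h := phi v u k / 2; have Hh : 0 < h < PI by rewrite /h; lra.
have [tau tau0 Hb] := small_radius (fun i => bnd v (u i) (u i.+1)) k.
have Ih : 0 <= h <= phi v u k by rewrite /h; lra.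
have [j jk Hj] := phi_cross Ih k0.
(* The cycle run backwards; its triangle [j'] is triangle [j], the one met by the ray at half the
   total angle. *)
pose u' i := u (k - i)%N; pose j' := (k - j.+1)%N.
have e' i : (i < k)%N -> (k - i = (k - i.+1).+1)%N by move=> ik; rewrite subnSK.
have jk' : (j' < k)%N by rewrite /j' ltn_subrL.
have Hc' i : (i < k)%N -> is_chain [:: v; u' i; u' i.+1].
  move=> ik; rewrite /u' (e' i ik); apply: chain_swap; apply: Hc.
  by rewrite ltn_subrL.
have Hcj i : (i <= j)%N -> is_chain [:: v; u i; u i.+1] by move=> ij; apply: Hc; apply: leq_ltn_trans jk.
have Hcj' i : (i <= j')%N -> is_chain [:: v; u' i; u' i.+1].
  by move=> ij; apply: Hc'; apply: leq_ltn_trans jk'.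
have Hnj i : (i < j)%N -> ~ vequiv (u i) (u i.+2).
  by move=> ij; apply: Hn; apply: leq_ltn_trans jk.
have Hnj' i : (i < j')%N -> ~ vequiv (u' i) (u' i.+2).
  move=> ij; have ik : (i.+2 <= k)%N by apply: leq_ltn_trans jk'.
  have ik1 : (i.+1 < k)%N by [].
  rewrite /u' (e' i (ltnW ik1)) (e' _ ik1) => e.
  have kk : ((k - i.+2).+2 <= k)%N by rewrite -(e' _ ik1) -(e' i (ltnW ik1)) leq_subr.
  apply: (Hn _ kk); apply: vequiv_sym e.
  have ck := Hc (k - i.+2).+1 kk.
  by have [[_ _ _ _] [_ Hv _ _] _] := proj1 (is_chain3 _ _ _) ck.
have finj i : (i <= j.+1)%N -> finite_shapes len v (u i).
  by move=> ij; apply: fin; apply: leq_trans jk.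
have finj' i : (i <= j'.+1)%N -> finite_shapes len v (u' i).
  by move=> ij; apply: fin; apply: leq_subr.
have Hbj i : (i <= j)%N -> tau * bnd v (u i) (u i.+1) < 1.
  by move=> ij; apply: Hb; apply: leq_ltn_trans jk.
have Hb' i : (i < k)%N -> tau * bnd v (u' i) (u' i.+1) < 1.
  move=> ik; have lk : (k - i.+1 < k)%N by rewrite ltn_subrL.
  by rewrite /u' (e' i ik) /bnd (bnd_swap PM (Hc _ lk)); apply: Hb.
have Hbj' i : (i <= j')%N -> tau * bnd v (u' i) (u' i.+1) < 1.
  by move=> ij; apply: Hb'; apply: leq_ltn_trans jk'.
have P1 := cpt_path Hcj Hnj finj Hh tau0 Hbj.
have P2 := cpt_path Hcj' Hnj' finj' Hh tau0 Hbj'.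
have phi' := phi_rev Hc.
have kj : (k - j' = j.+1)%N by rewrite /j' subKn.
have kj1 : (k - j'.+1 = j)%N by rewrite subnS kj.
have pj' : phi v u' j' = phi v u k - phi v u j.+1 by rewrite /u' phi' ?kj // ltnW.
have pj1' : phi v u' j'.+1 = phi v u k - phi v u j by rewrite /u' phi' ?kj1.
have Ij' : phi v u' j' <= h <= phi v u' j'.+1 by rewrite pj' pj1' /h; rewrite /h in Hj; lra.
have dk := path_dom Hcj Hbj.
have H0 : 0 <= 0 <= h by lra.
have Hhh : 0 <= h <= h by lra.
have cr0 : chord_radius h tau 0 = tau by exact: crho0.
have crh : chord_radius h tau h = tau by exact: crhoh.
have Q : cpt v u h tau j h = cpt v u' h tau j' h.
  rewrite /cpt pj' /u' kj kj1 /pw (pw_swap PM (Hc j jk)); congr polar.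
  by rewrite -/ang /h /=; field.
have C0 := Hc 0%N k0; have C0' := Hc' 0%N k0.
have u'0 : u' 0%N = u 0%N by rewrite /u' subn0.
have u'1 : u' 1%N = u k.-1 by rewrite /u' subn1.
have P : cpt v u h tau 0 0 = cpt v u' h tau 0 0.
  rewrite /cpt /= Rminus_0_r /pw u'0; apply: (pw_ray PM _ C0).
  by rewrite -{1}u'0.
have C1 : is_chain [:: v; u 0%N; u k.-1] by rewrite -u'1 -{1}u'0.
have f0 := fin 0%N (leq0n k).
have tb : tau * polar_bound G len v (u 0%N) (u 1%N) < 1 by apply: Hb.
have [r r0 Hr] := crossing PM LM dim2 C1 C0 ne f0 tau0 tb.
have [e e0 He] := cvec_cont Hh tau0 dk H0 r0.
have a0 : 0 < phi v u 1 by have := step 0%N k0; rewrite [phi v u 0]/=.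
have a0' : 0 < phi v u' 1.
  by have [[_ _ A _] _] := tri_data PM C0'; rewrite /= /ang; lra.
(* An angle so small that the points at [s] in either direction lie in the first triangle and close
   to the ray through [u 0]. *)
pose s := Rmin (Rmin (e / 2) h) (Rmin (phi v u 1 / 2) (phi v u' 1 / 2)).
have s0 : 0 < s by do 2!apply: Rmin_pos; lra.
have s1 : s <= e / 2 by apply: Rle_trans (Rmin_l _ _) (Rmin_l _ _).
have s2 : s <= h by apply: Rle_trans (Rmin_l _ _) (Rmin_r _ _).
have s3 : s <= phi v u 1 / 2 by apply: Rle_trans (Rmin_r _ _) (Rmin_l _ _).
have s4 : s <= phi v u' 1 / 2 by apply: Rle_trans (Rmin_r _ _) (Rmin_r _ _).
have Hs : 0 <= s <= h by lra.
have Z : 0 <= 0 < phi v u 1 by lra.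
have Z' : 0 <= 0 < phi v u' 1 by lra.
have Is : 0 <= s < phi v u 1 by lra.
have Is' : 0 <= s < phi v u' 1 by lra.
have F0 : phi v u 0 <= s <= phi v u 1 by rewrite [phi v u 0]/=; lra.
have F0' : phi v u' 0 <= s <= phi v u' 1 by rewrite [phi v u' 0]/=; lra.
have F00 : phi v u 0 <= 0 <= phi v u 1 by rewrite [phi v u 0]/=; lra.
have shh : s <= h <= h by lra.
have d1 := P1 0%N 0 s (leq0n j) Z Hs F0.
have d2 := P1 j s h (leqnn j) Is shh Hj.
have d3 := P1 j 0 h (leqnn j) Z Hhh Hj.
have d1' := P2 0%N 0 s (leq0n j') Z' Hs F0'.
have d2' := P2 j' s h (leqnn j') Is' shh Ij'.
rewrite -P in d1'; rewrite -Q in d2'.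
have pp := cpt_point Hcj Hh tau0 Hbj (leq0n j) H0 F00.
have pm := cpt_point Hcj Hh tau0 Hbj (leq0n j) Hs F0.
have pq := cpt_point Hcj Hh tau0 Hbj (leqnn j) Hhh Hj.
have pm' := cpt_point Hcj' Hh tau0 Hbj' (leq0n j') Hs F0'.
have ad := cvec_add Hh tau0 dk (conj (Rle_refl 0) (proj1 Hs)) shh.
(* Both chords join the same two points with the same lengths, so uniqueness of geodesics identifies
   their points at angle [s]. *)
have mm : d (cpt v u' h tau 0 s) (cpt v u h tau 0 s) = 0.
  apply: (uniq pp pq pm' pm); first by rewrite d1 d1'.
    by rewrite d1' d2' d3.
  by rewrite d1 d2 d3.
have [c0 c1] := crho_bound Hh tau0 Hs.
have [_ cb] := crho_bnd Hcj Hh tau0 Hbj (leq0n j) Hs.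
have [_ cb'] := crho_bnd Hcj' Hh tau0 Hbj' (leq0n j') Hs.
rewrite u'0 u'1 in cb'.
have E2 : cpt v u h tau 0 s = polar G len v (u 0%N) (u 1%N) (chord_radius h tau s) s.
  by rewrite /cpt /= Rminus_0_r.
have E2' : cpt v u' h tau 0 s = polar G len v (u 0%N) (u k.-1) (chord_radius h tau s) s.
  by rewrite /cpt /= Rminus_0_r u'0 u'1.
rewrite E2 E2' in mm.
have As : 0 <= s < angle G len v (u 0%N) (u 1%N) by rewrite /= in Is; rewrite /ang in Is; lra.
have As' : 0 <= s < angle G len v (u 0%N) (u k.-1).
  by rewrite /= u'0 u'1 in Is'; rewrite /ang in Is'; lra.
have As'' : 0 <= s <= angle G len v (u 0%N) (u k.-1) by lra.
have A0' : 0 <= 0 <= angle G len v (u 0%N) (u k.-1) by lra.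
have near : D (kvec tau 0) (kvec (chord_radius h tau s) s) < r.
  have := He s Hs; rewrite /chord cr0; apply.
  by rewrite Rminus_0_r Rabs_right; lra.
have tb' : tau * polar_bound G len v (u 0%N) (u k.-1) < 1 by have := Hb' 0%N k0; rewrite u'0 u'1.
(* [crossing] needs the nearness of the mirror image at angle [- s]; by reflection it follows from
   that of the point at [s]. *)
have rf := kvec_reflect PM dim2 C1 C0 ne tau0 tb' A0' c0 cb' As''.
rewrite Ropp_0 in rf.
have := Hr _ _ _ _ c0 cb' As' c0 cb As; rewrite rf mm => /(_ near near).
(* The two points would now be at distance 0 in the plane too, although the line of the edge
   separates them. *)
have ss : 0 < sin s by apply: sin_gt_0; lra.
have kk : 0 < ev (0, 0, 1) (kvec (chord_radius h tau s) s).
  by rewrite /ev /kvec /=; have := Rmult_lt_0_compat _ _ c0 ss; lra.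
have dks t : dom (pl G) (kvec (chord_radius h tau s) t) by apply: dk; lra.
have [z z0 Hz] := md_gap (dks s) kk.
have : z <= md (pl G) (kvec (chord_radius h tau s) s) (kvec (chord_radius h tau s) (- s)).
  apply: Hz => //; rewrite /ev /kvec /= sin_neg; have := Rmult_lt_0_compat _ _ c0 ss; lra.
by rewrite md_sym; lra.
Qed.

End Cycles.

(** * The complex K_4 *)

Section Inner.
Variable n : nat.
Implicit Types (w : seq 'I_n) (i j k : 'I_n).

(* W_n acts on Z by the reflections x |-> kap i - x; inner automorphisms affinely change kap,
   whereas a partial conjugation need not. *)
Definition zact (kap : 'I_n -> Z) w (x : Z) : Z := foldr (fun i y => (kap i - y)%Z) x w.

Lemma zact_cat kap u w x : zact kap (u ++ w) x = zact kap u (zact kap w x).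
Proof. by rewrite /zact foldr_cat. Qed.

Lemma zact_red kap w x : zact kap (red w) x = zact kap w x.
Proof.
elim: w => //= i w <-; rewrite -/(red w); case: (red w) => //= j r.
by case: eqP => [->|_] //=; lia.
Qed.

Lemma zact_affine kap w : exists e t, (e * e = 1)%Z /\
  (forall x, zact kap w x = e * x + t)%Z /\ (forall x, zact kap (rev w) x = e * (x - t))%Z.
Proof.
elim: w => [|i w [e [t [e1 [H H']]]]].
  by exists 1%Z, 0%Z; split=> //; split=> x; rewrite [zact _ _ _]/=; lia.
exists (- e)%Z, (kap i - t)%Z; split; first lia.
split=> x; first by rewrite /= H; lia.
rewrite rev_cons -cats1 zact_cat /= H'; ring.
Qed.

Lemma zact_conj kap w : exists e t, (e * e = 1)%Z /\
  forall i x, (zact kap (w ++ i :: rev w) x = e * kap i - x + 2 * t)%Z.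
Proof.
have [e [t [e1 [H H']]]] := zact_affine kap w; exists e, t; split=> // i x.
rewrite zact_cat H -[zact _ _ x]/(kap i - zact kap (rev w) x)%Z H'.
transitivity (e * kap i - (e * e) * (x - t) + t)%Z; first ring.
by rewrite e1; ring.
Qed.

(** [kap] agrees at [j] and [k]. An inner automorphism changes all constants of reflections by one
    affine map and keeps these two equal, but conjugating [j] alone by [i] turns 1 into -1. *)
Lemma pc_not_inner i j k w : i != j -> i != k -> j != k -> ~ heq (pc i [set j]) (inn w).
Proof.
move=> ij ik jk E; pose kap (a : 'I_n) : Z := if a == i then 0%Z else 1%Z.
have [e [t [e1 H]]] := zact_conj kap w.
have K a : zact kap (pc i [set j] a) 0%Z = (e * kap a + 2 * t)%Z.
  by rewrite -zact_red E zact_red H; lia.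
have := K i; have := K k; have := K j; move: K=> _.
rewrite !pcE !inE eqxx (negbTE ij) eq_sym (negbTE jk) /= /kap eqxx.
rewrite ![_ == i]eq_sym (negbTE ij) (negbTE ik); lia.
Qed.

End Inner.

(** * Nuclear vertices and chains *)

Section Four.
Implicit Types (T : {set {set 'I_4}}) (v u x y : vtx 4).

(** In [nuc] any two vertices are joined by a walk of one step, so nothing is separated by a third
    vertex. *)
Lemma carries_nuc (i : 'I_4) (D : {set 'I_4}) : i \notin D -> D != set0 -> carries nuc i D -> D = [set~ i].
Proof.
move=> iD /set0Pn[d dD] H; apply/setP=> j; rewrite !inE.
case: (eqVneq j i) => [->|ji]; first exact: negbTE.
apply/idP; case: (boolP (j \in D)) => // jD; exfalso.
have dj : d != j by apply: contraTneq dD => ->.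
have W : is_walk nuc d j [:: d; j] [:: setT].
  split=> //=; first by rewrite !inE dj.
  by rewrite !inE eqxx.
  by case=> [|k] //= _; rewrite !inE.
have := H d j dD jD ji _ _ W; rewrite !inE => /orP[/eqP e|/eqP e].
  by rewrite e dD in iD.
by rewrite e eqxx in ji.
Qed.

Lemma pc_carried_nuc T p : pc_carried nuc p -> pc_carried T p /\ heq (pc p.1 p.2) (inn [:: p.1]).
Proof.
case: p => i D [/= iD D0 c]; have DE := carries_nuc iD D0 c.
split; last by rewrite DE; apply: pc_full.
split=> //= d j dD jD ji; by move: jD; rewrite DE !inE ji.
Qed.

(** A nuclear vertex therefore determines its marking up to inner automorphisms, and its marking
    serves for all vertices above it. *)
Lemma carried_nuc T Q : carried nuc Q -> carried T Q /\ exists w, heq Q (inn w).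
Proof.
case=> ps [w [H E]]; split.
  by exists ps, w; split=> // p /H/(pc_carried_nuc T)[].
have [w' E'] : exists w', heq (prod_pc ps) (inn w').
  elim: ps H {E} => [|p ps IH] H; first by exists [::].
  have [|w' E'] := IH; first by move=> q qs; apply: H; rewrite inE qs orbT.
  have [_ Ep] := pc_carried_nuc T (H p (mem_head _ _)).
  exists ([:: p.1] ++ w'); apply: heq_trans (inn_comp _ _) => /=.
  apply: heq_trans (hcomp_heqr (@is_hom_pc _ _ _) E') _; exact: hcomp_heql.
exists (w' ++ w); apply: heq_trans E _; apply: heq_trans (hcomp_heql _ E') _; exact: inn_comp.
Qed.

Lemma rel_nuc T a b : is_hom a -> rel_carried nuc a b -> rel_carried T a b.
Proof.
move=> ha /(rel_carriedE _ _ ha)[Q HQ E]; apply/(rel_carriedE _ _ ha); exists Q => //.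
by case: (carried_nuc T HQ).
Qed.

Lemma not_rel_nuc a (i j k : 'I_4) : is_aut0 a -> i != j -> i != k -> j != k ->
  ~ rel_carried nuc a (hcomp a (pc i [set j])).
Proof.
move=> Ha ij ik jk; have ha := is_aut0_hom Ha; move=> /(rel_carriedE _ _ ha)[Q HQ E].
have [_ [w Ew]] := carried_nuc nuc HQ; apply: (@pc_not_inner _ i j k w ij ik jk).
apply: heq_trans Ew; have [g [Hg _ ga]] := is_aut0_inv Ha; have hg := is_aut0_hom Hg.
have K f : heq (hcomp g (hcomp a f)) f.
  apply: heq_trans (heq_sym (hcompA _ _ hg)) _.
  exact: heq_trans (hcomp_heql _ ga) (hcomp1f _).
apply: heq_trans (heq_sym (K _)) _; apply: heq_trans (K Q).
exact: hcomp_heqr.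
Qed.

Lemma valid_card v : valid_vtx v -> (0 < #|v.2| <= 3)%N.
Proof. by case=> _ H; rewrite (hypertree_card H) andbT; apply: hypertree_gt0 H. Qed.

(** Adjacent vertices differ in the number of hyperedges, which is 1, 2 or 3. *)
Lemma chain4_dim : two_dimensional 4.
Proof.
move=> s v u x y Hs vs us xs ys vu xv xu yv yu.
case: (excluded_middle_informative (vequiv x y)) => // xy; exfalso.
have c a b (as_ : List.In a s) (bs : List.In b s) (ne : ~ vequiv a b) := adj_card (chain_In Hs as_ bs ne).
have := (c _ _ vs us vu, c _ _ xs vs xv, c _ _ xs us xu, (c _ _ ys vs yv, c _ _ ys us yu, c _ _ xs ys xy)).
have r a (as_ : List.In a s) := valid_card (chain_valid Hs as_).
have := (r _ vs, r _ us, r _ xs, r _ ys).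
move: #|v.2| #|u.2| #|x.2| #|y.2| => a b e f.
case=> [[[/andP[/ltP ? /leP ?] /andP[/ltP ? /leP ?]] /andP[/ltP ? /leP ?]] /andP[/ltP ? /leP ?]].
case=> [[[/eqP ? /eqP ?] /eqP ?] [[/eqP ? /eqP ?] /eqP ?]]; lia.
Qed.

Lemma adj_intro (a b : hom 4) T L : is_aut0 a -> is_aut0 b -> is_hypertree T -> is_hypertree L ->
  T <> L -> ht_le T L -> rel_carried L a b -> adj (a, T) (b, L).
Proof.
move=> Ha Hb HT HL ne le R; split; try by split.
  by case=> /= e _.
by left; split.
Qed.

Lemma nuc_min v w : valid_vtx v -> v.2 = nuc -> adj v w -> vequiv (v.1, w.2) w.
Proof.
move=> Hv vn [_ Hw ne [le|[le R]]]; first exact: vle_min.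
exfalso; apply: ne; case: (ht_leP le) => [e|]; last first.
  rewrite vn cards1 ltnS leqn0; have /andP[] := valid_card Hw; by case: #|w.2|.
by apply: vequiv_sym => //; split=> //; rewrite e.
Qed.

Lemma In_mem (T : eqType) (x : T) (s : seq T) : x \in s -> List.In x s.
Proof. by elim: s => //= a s IH; rewrite inE => /orP[/eqP ->|/IH]; [left | right]. Qed.

Lemma chain_213 v u w : is_chain [:: v; u; w] -> is_chain [:: u; v; w].
Proof. by move=> /is_chain3[vu vw uw]; apply/is_chain3; split=> //; apply: adj_sym. Qed.

(** * Invariance of edge lengths *)

Section Metric.
Variables (G : geom 4) (len : vtx 4 -> vtx 4 -> R) (d : (vtx 4 -> R) -> (vtx 4 -> R) -> R).
Hypothesis PM : piecewise_metric (real G) len.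
Hypothesis LM : is_length_metric (sd G len) d.
Hypothesis EQ : equivariant d.

Lemma finite_shapes_sym v u : finite_shapes len v u -> finite_shapes len u v.
Proof.
case=> l H; exists (map (fun z => (z.2, z.1)) l) => u' v' w uu' vv' /chain_213 C.
by have := H v' u' w vv' uu' C; apply: (List.in_map (fun z : R * R => (z.2, z.1))).
Qed.

(** Every vertex adjacent to a nuclear one can be written with its marking, and there are only
    finitely many hypertrees. *)
Lemma finite_shapes_nuc v u : valid_vtx v -> valid_vtx u -> v.2 = nuc -> finite_shapes len v u.
Proof.
move=> Hv Hu vn.
exists [seq (len v (v.1, T), len u (v.1, T)) | T <- enum [set: {set {set 'I_4}}]].
move=> v' u' w vv' uu' /is_chain3[_ v'w _].
have Hv' := proj1 (vequiv_valid vv') Hv; have [_ Hw _ _] := v'w.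
have v'n : v'.2 = nuc by case: vv' => <-.
have e' := nuc_min Hv' v'n v'w.
have e : vequiv (v.1, w.2) w.
  apply: vequiv_trans e'; first by split; [case: Hv' | case: Hw].
  split=> //=; apply: rel_nuc; first by apply: is_aut0_hom; case: Hv.
  by case: vv' => E; rewrite vn.
rewrite -(len_equiv PM (vequiv_refl Hv) e) -(len_equiv PM (vequiv_refl Hu) e).
apply: (List.in_map (fun T => (len v (v.1, T), len u (v.1, T)))); apply: In_mem.
by rewrite mem_enum inE.
Qed.

Lemma tv_edge (l l' t a b : R) : tvec G l l' t a b 0 = lin a (1, 0, 0) b (pol (pl G) l 0).
Proof. by rewrite /tvec /lin /=; congr (_, _, _); ring. Qed.

(* Near its midpoint, an edge is a geodesic parametrized according to its length. *)
Lemma mid_edge v u w : is_chain [:: v; u; w] -> finite_shapes len v u ->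
  exists2 e, 0 < e & forall t, / 2 <= t -> t - / 2 < e -> t < 1 ->
    d (mk v u w (/ 2) (/ 2) 0) (mk v u w (1 - t) t 0) =
    md (pl G) (lin (/ 2) (1, 0, 0) (/ 2) (pol (pl G) (len v u) 0))
              (lin (1 - t) (1, 0, 0) t (pol (pl G) (len v u) 0)).
Proof.
move=> H3 fin.
have q1 : 0 < / 4 by lra.
have q3 : 0 < 3 / 4 by lra.
have h : 0 <= / 2 <= 1 by lra.
have z : 0 <= 0 by lra.
have E1 : 3 / 4 + / 4 + 0 = 1 by lra.
have E2 : / 4 + 3 / 4 + 0 = 1 by lra.
have b0 : 0 < (1 - / 2) * / 4 + / 2 * (3 / 4) by lra.
(* A chord along the edge, from the weights 3/4, 1/4 to 1/4, 3/4; the midpoint is interior to it, at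
   parameter [/ 2]. *)
have [e e0 H] := chord_local PM LM chain4_dim H3 q3 q1 (Rlt_le _ _ q1) (Rlt_le _ _ q3) z z E1 E2 fin h b0.
exists (Rmin (e / 2) (/ 8)); first by apply: Rmin_pos; lra.
move=> t t2 te t1; have t3 := Rlt_le_trans _ _ _ te (Rmin_l _ _).
have t4 := Rlt_le_trans _ _ _ te (Rmin_r _ _).
(* The parameter on that chord at which [u] has weight [t]. *)
pose s := / 2 + 2 * (t - / 2).
have H' := H (/ 2) s; rewrite /cmk in H'.
rewrite (_ : mk v u w (/ 2) (/ 2) 0 = mk v u w ((1 - / 2) * (3 / 4) + / 2 * / 4)
  ((1 - / 2) * / 4 + / 2 * (3 / 4)) ((1 - / 2) * 0 + / 2 * 0)); last by congr mk; lra.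
rewrite (_ : mk v u w (1 - t) t 0 = mk v u w ((1 - s) * (3 / 4) + s * / 4)
  ((1 - s) * / 4 + s * (3 / 4)) ((1 - s) * 0 + s * 0)); last by rewrite /s; congr mk; lra.
rewrite H'; rewrite /s ?Rminus_diag ?Rabs_R0 ?Rabs_right; try lra.
rewrite !devl_mk //; try lra.
rewrite (_ : (1 - / 2) * 0 + / 2 * 0 = 0); last lra.
rewrite (_ : (1 - (/ 2 + 2 * (t - / 2))) * 0 + (/ 2 + 2 * (t - / 2)) * 0 = 0); last lra.
by rewrite !tv_edge; congr (md _ (lin _ _ _ _) (lin _ _ _ _)); lra.
Qed.

(** [EQ] speaks of [d] only. The length is recovered by [md_inj] from the distance between the
    midpoint and a point near enough for [mid_edge] to apply to both edges. *)
Lemma len_vact f v u w : is_aut0 f -> is_chain [:: v; u; w] -> finite_shapes len v u ->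
  finite_shapes len (vact f v) (vact f u) -> len (vact f v) (vact f u) = len v u.
Proof.
move=> Hf H3 fin fin'; have [vu vw uw] := proj1 (is_chain3 _ _ _) H3.
have H3' : is_chain [:: vact f v; vact f u; vact f w].
  by apply/is_chain3; split; apply: vact_adj.
have [Hv Hu _ _] := vu; have [_ Hw _ _] := vw.
have [e e0 H] := mid_edge H3 fin; have [e' e0' H'] := mid_edge H3' fin'.
pose t := / 2 + Rmin (/ 4) (Rmin (e / 2) (e' / 2)).
have m0 : 0 < Rmin (/ 4) (Rmin (e / 2) (e' / 2)) by do 2?apply: Rmin_pos; lra.
have m1 : Rmin (/ 4) (Rmin (e / 2) (e' / 2)) <= / 4 by apply: Rmin_l.
have m2 : Rmin (/ 4) (Rmin (e / 2) (e' / 2)) <= e / 2 by apply: Rle_trans (Rmin_r _ _) (Rmin_l _ _).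
have m3 : Rmin (/ 4) (Rmin (e / 2) (e' / 2)) <= e' / 2 by apply: Rle_trans (Rmin_r _ _) (Rmin_r _ _).
have [l0 _] := len_adj PM vu; have [l0' _] := len_adj PM (vact_adj Hf vu).
apply: (@md_inj (pl G) _ _ t) => //; try (rewrite /t; lra).
rewrite -H ?/t; try lra.
rewrite -/t -H' ?/t; try lra.
rewrite -/t -(EQ Hf); try (apply: mk_point => //; rewrite /t; lra).
by rewrite !pull_mk.
Qed.

Definition base T : vtx 4 := (@hid 4, T).
Definition lam T L : R := len (base T) (base L).

Definition flag (e T : {set {set 'I_4}}) :=
  [/\ is_hypertree e, is_hypertree T, ht_le nuc e, ht_le e T & [/\ nuc <> e, nuc <> T & e <> T]].

Lemma flag_chain a b c e T : flag e T -> is_aut0 a -> is_aut0 b -> is_aut0 c ->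
  rel_carried e a b -> rel_carried T a c -> rel_carried T b c ->
  is_chain [:: (a, nuc); (b, e); (c, T)].
Proof.
move=> [He HT ne eT [n1 n2 n3]] Ha Hb Hc R1 R2 R3; have Hn := nuc_hypertree.
apply/is_chain3; split; apply: adj_intro => //.
exact: ht_le_trans ne eT.
Qed.

Lemma vact_base f T : is_aut0 f -> is_hypertree T -> vequiv (f, T) (vact f (base T)).
Proof.
move=> Hf HT; split=> //=; apply: rel_heq; first exact: is_aut0_hom.
by apply: heq_sym; apply: hcompf1.
Qed.

Lemma base_chain e T : flag e T -> is_chain [:: base nuc; base e; base T].
Proof.
move=> F; have h1 := @is_aut0_1 4; have r L := @rel_refl 4 L _ (@is_hom1 4).
by apply: flag_chain.
Qed.

Lemma len_nuc a e T : flag e T -> is_aut0 a ->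
  len (a, nuc) (a, e) = lam nuc e /\ len (a, nuc) (a, T) = lam nuc T.
Proof.
move=> F Ha; have C := base_chain F; have [ne nT eT] := proj1 (is_chain3 _ _ _) C.
have [He HT _ _ _] := F; have Hn := nuc_hypertree.
have [Hvn Hve _ _] := ne; have [_ HvT _ _] := nT.
have fin x : valid_vtx x -> finite_shapes len (base nuc) x by move=> Hx; apply: finite_shapes_nuc.
have fin' x : valid_vtx x -> finite_shapes len (vact a (base nuc)) x.
  by move=> Hx; apply: finite_shapes_nuc => //; apply: vact_valid.
have va := vact_base Ha.
split.
  rewrite (len_equiv PM (va _ Hn) (va _ He)); apply: (len_vact (w := base T)) => //; first exact: fin.
  by apply: fin'; apply: vact_valid.
rewrite (len_equiv PM (va _ Hn) (va _ HT)); apply: (len_vact (w := base e)) => //.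
- exact: chain_swap.
- exact: fin.
- by apply: fin'; apply: vact_valid.
Qed.

(** The third vertex of a triangle on such an edge is nuclear, and invariance of the two lengths
    issuing from it leaves a single shape. *)
Lemma finite_shapes_top a b e T : flag e T -> #|e| = 2%N -> #|T| = 3%N -> is_aut0 a -> is_aut0 b ->
  finite_shapes len (a, e) (b, T).
Proof.
move=> F c2 c3 Ha Hb; have [He HT ne eT [n1 n2 n3]] := F; have Hn := nuc_hypertree.
exists [:: (lam nuc e, lam nuc T)] => v' u' w vv' uu' C; left.
have [v'u' v'w u'w] := proj1 (is_chain3 _ _ _) C.
have [Hv' Hw _ _] := v'w; have [Hu' _ _ _] := u'w.
have Hae : valid_vtx (a, e) by split.
have HbT : valid_vtx (b, T) by split.
have ev : v'.2 = e by case: vv' => <-.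
have eu : u'.2 = T by case: uu' => <-.
have wn : w.2 = nuc.
  apply: hypertree_card1; first by case: Hw.
  have := adj_card v'w; have := adj_card u'w; rewrite ev eu c2 c3; have /andP[] := valid_card Hw.
  by case: #|w.2| => [|[|[|[|]]]].
have wv := nuc_min Hw wn (adj_sym v'w); have wu := nuc_min Hw wn (adj_sym u'w).
rewrite ev in wv; rewrite eu in wu.
have Hw1 : is_aut0 w.1 by case: Hw.
have wE : w = (w.1, nuc) by rewrite -wn; case: (w).
have [E1 E2] := len_nuc F Hw1.
rewrite (len_equiv PM vv' (vequiv_refl Hw)) (len_equiv PM uu' (vequiv_refl Hw)).
rewrite -(len_sym PM v'w) -(len_sym PM u'w).
rewrite -(len_equiv PM (vequiv_refl Hw) wv) -(len_equiv PM (vequiv_refl Hw) wu).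
by rewrite {1 3}wE E1 E2.
Qed.

Lemma len_top a e T : flag e T -> #|e| = 2%N -> #|T| = 3%N -> is_aut0 a -> len (a, e) (a, T) = lam e T.
Proof.
move=> F c2 c3 Ha; have [He HT _ _ _] := F; have va := vact_base Ha.
rewrite (len_equiv PM (va _ He) (va _ HT)).
have h1 := @is_aut0_1 4.
apply: (len_vact (w := base nuc)) => //.
- have C := base_chain F; exact: chain_swap (chain_213 C).
- exact: finite_shapes_top.
- by apply: finite_shapes_top => //; apply: is_aut0_comp.
Qed.

End Metric.
End Four.

(** * Angle inequalities from short cycles *)

Section Cycles4.
Variables (G : geom 4) (len : vtx 4 -> vtx 4 -> R) (d : (vtx 4 -> R) -> (vtx 4 -> R) -> R).
Hypothesis PM : piecewise_metric (real G) len.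
Hypothesis LM : is_length_metric (sd G len) d.
Hypothesis EQ : equivariant d.
Hypothesis glue : cat_glue d.
Hypothesis uniq_geod : cat_unique d.
Implicit Types (e T : {set {set 'I_4}}) (v : vtx 4) (a b : hom 4).

(** The cycles used alternate between two kinds of vertices, so that the conditions of [cycle_angle]
    on second neighbours become conditions within each kind. *)
Lemma alternating_cycle v (p q : nat -> vtx 4) K : (0 < K)%N ->
  (forall i, (i < K)%N -> is_chain [:: v; p i; q i] /\ is_chain [:: v; q i; p i.+1]) ->
  (forall i, (i <= K)%N -> finite_shapes len v (p i)) ->
  (forall i, (i < K)%N -> finite_shapes len v (q i)) ->
  (forall i, (i < K)%N -> ~ vequiv (p i) (p i.+1)) ->
  (forall i, (i.+1 < K)%N -> ~ vequiv (q i) (q i.+1)) ->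
  p K = p 0%N -> ~ vequiv (q K.-1) (q 0%N) ->
  2 * PI <= \big[Rplus/0]_(i < K) (angle G len v (p i) (q i) + angle G len v (q i) (p i.+1)).
Proof.
move=> K0 Hc fp fq np nq pK nqK.
pose u i := if odd i then q i./2 else p i./2.
have u0 i : u i.*2 = p i by rewrite /u odd_double doubleK.
have u1 i : u i.*2.+1 = q i by rewrite /u /= odd_double /= uphalf_double.
have par (P : nat -> Prop) : (forall i, P i.*2) -> (forall i, P i.*2.+1) -> forall i, P i.
  by move=> H0 H1 i; rewrite -(odd_double_half i); case: (odd i); [apply: H1 | apply: H0].
have <- : phi G len v u K.*2 =
    \big[Rplus/0]_(i < K) (angle G len v (p i) (q i) + angle G len v (q i) (p i.+1)).
  elim: (K) => [|k IH]; first by rewrite big_ord0.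
  by rewrite big_ord_recr /= -IH -doubleS !u0 u1; ring.
apply: (cycle_angle PM LM chain4_dim glue uniq_geod).
- by rewrite -[1%N]/(0.*2.+1)%N ltn_Sdouble.
- apply: par => i; rewrite ?doubleS ?u0 ?u1 -?doubleS ?u0 ?ltn_double => iK.
    by case: (Hc i iK).
  have iK' : (i < K)%N by rewrite -ltn_double; apply: leq_trans iK; rewrite leqnSn.
  by case: (Hc i iK').
- apply: par => i; rewrite ?u0 ?u1; first by rewrite leq_double; apply: fp.
  by rewrite ltn_double; apply: fq.
- apply: par => i; rewrite -?doubleS ?u0 ?u1.
    by rewrite leq_double; apply: np.
  by rewrite ltn_double; apply: nq.
- by rewrite u0 -[0%N in RHS]/(0.*2)%N u0.
rewrite -[1%N]/(0.*2.+1)%N u1.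
have -> : K.*2.-1 = K.-1.*2.+1 by case: (K) K0.
by rewrite u1.
Qed.

(* The angles of the triangle nuc < e < T at nuc, e and T. *)
Definition angN e T := acos (cosang (pl G) (lam len nuc e) (lam len nuc T) (lam len e T)).
Definition angE e T := acos (cosang (pl G) (lam len nuc e) (lam len e T) (lam len nuc T)).
Definition angT e T := acos (cosang (pl G) (lam len nuc T) (lam len e T) (lam len nuc e)).

Definition full_flag e T := [/\ flag e T, #|e| = 2%N & #|T| = 3%N].

Lemma triangle_angles e T : full_flag e T ->
  [/\ 0 < angN e T, 0 < angE e T, 0 < angT e T & angN e T + angE e T + angT e T <= PI].
Proof.
case=> F _ _; have C1 := base_chain F; have [ne nT eT] := proj1 (is_chain3 _ _ _) C1.
have C2 := chain_213 C1; have C3 := chain_213 (chain_swap C1).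
have [l1 _] := len_adj PM ne; have [l2 _] := len_adj PM nT; have [l3 _] := len_adj PM eT.
have [[A1 _] _] := ang_bound PM C1; have [[A2 _] _] := ang_bound PM C2.
have [[A3 _] _] := ang_bound PM C3.
have b1 := len_chain3 PM C1; have b2 := len_chain3 PM C2; have b3 := len_chain3 PM C3.
rewrite /angle (len_sym PM ne) in A2 b2; rewrite /angle (len_sym PM nT) (len_sym PM eT) in A3 b3.
rewrite /angle in A1; split=> //; exact: angle_sum.
Qed.

(** [a], [b] and [c] are the markings at [nuc], [e] and [T]. *)
Definition triangle e T a b c := [/\ is_aut0 a, is_aut0 b & is_aut0 c] /\
  [/\ rel_carried e a b, rel_carried T a c & rel_carried T b c].

Lemma triangle_chain e T a b c : flag e T -> triangle e T a b c ->
  is_chain [:: (a, nuc); (b, e); (c, T)].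
Proof. by move=> F [[Ha Hb Hc] [R1 R2 R3]]; apply: flag_chain. Qed.

Lemma triangle_ang e T a b c : full_flag e T -> triangle e T a b c ->
  [/\ angle G len (a, nuc) (b, e) (c, T) = angN e T,
      angle G len (b, e) (a, nuc) (c, T) = angE e T &
      angle G len (c, T) (a, nuc) (b, e) = angT e T].
Proof.
case=> F c2 c3 t; have C := triangle_chain F t; have [ne nT eT] := proj1 (is_chain3 _ _ _) C.
move: t => [[Ha Hb Hc] [R1 R2 R3]]; have [E1 E2] := len_nuc PM LM EQ F Ha.
have E3 := len_top PM LM EQ F c2 c3 Hb.
have [Hn Hbe _ _] := ne; have [_ HcT _ _] := nT; have [_ He] := Hbe; have [_ HT] := HcT.
have Hae : valid_vtx (a, e) by split.
have HaT : valid_vtx (a, T) by split.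
have HbT : valid_vtx (b, T) by split.
have ve : vequiv (a, e) (b, e) by split.
have vT : vequiv (a, T) (c, T) by split.
have vT' : vequiv (b, T) (c, T) by split.
have Q1 : len (a, nuc) (b, e) = lam len nuc e.
  by rewrite -E1; apply: esym; apply: (len_equiv PM (vequiv_refl Hn) ve).
have Q2 : len (a, nuc) (c, T) = lam len nuc T.
  by rewrite -E2; apply: esym; apply: (len_equiv PM (vequiv_refl Hn) vT).
have Q3 : len (b, e) (c, T) = lam len e T.
  by rewrite -E3; apply: esym; apply: (len_equiv PM (vequiv_refl Hbe) vT').
by rewrite /angle /angN /angE /angT (len_sym PM ne) (len_sym PM nT) (len_sym PM eT) Q1 Q2 Q3.
Qed.

Lemma triangle_base e T : triangle e T (@hid 4) (@hid 4) (@hid 4).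
Proof.
have h := @is_aut0_1 4; have r L := @rel_refl 4 L _ (@is_hom1 4); by split; split.
Qed.

(** The 4-cycle round [e] alternates between the nuclear vertices marked by the identity and by [x],
    and the trees [T] and [T']. As [x] is carried by all three hypertrees, either angle occurs
    twice; [k] witnesses that [x] is not inner. *)
Lemma edge_link e T T' (i j k : 'I_4) : full_flag e T -> full_flag e T' -> T <> T' ->
  uniq [:: i; j; k] -> carries e i [set j] -> carries T i [set j] -> carries T' i [set j] ->
  PI <= angE e T + angE e T'.
Proof.
move=> F F' TT U ce cT cT'; have [ff c2 c3] := F; have [ff' _ c3'] := F'.
have [ij ik jk] : [/\ i != j, i != k & j != k].
  by move: U; rewrite /= !inE !negb_or andbT => /andP[/andP[-> ->] ->].
have iD : i \notin [set j] by rewrite inE.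
have D0 : [set j] != set0 by apply/set0Pn; exists j; rewrite inE.
have h1 := @is_hom1 4; have h := @is_aut0_1 4.
pose x := hcomp (@hid 4) (pc i [set j]).
have Hx : is_aut0 x by apply: is_aut0_comp => //; apply: is_aut0_pc.
have rx L : carries L i [set j] -> rel_carried L x (@hid 4).
  by move=> cL; apply: rel_sym => //; apply: rel_comp => //; apply: carried_pc.
have tri0 L := triangle_base e L.
have tri1 L : carries L i [set j] -> triangle e L x (@hid 4) (@hid 4).
  by move=> cL; split; split => //; [apply: rx | apply: rx | apply: rel_refl].
have C0 L (FL : full_flag e L) :=
  let: And3 f _ _ := FL in chain_213 (triangle_chain f (tri0 L)).
have C1 L (FL : full_flag e L) (cL : carries L i [set j]) :=
  let: And3 f _ _ := FL in chain_213 (triangle_chain f (tri1 L cL)).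
have A0 L (FL : full_flag e L) : angle G len (@hid 4, e) (@hid 4, nuc) (@hid 4, L) = angE e L.
  by case: (triangle_ang FL (tri0 L)).
have A1 L (FL : full_flag e L) (cL : carries L i [set j]) :
    angle G len (@hid 4, e) (x, nuc) (@hid 4, L) = angE e L.
  by case: (triangle_ang FL (tri1 L cL)).
pose p n := nth (@hid 4, nuc) [:: (@hid 4, nuc); (x, nuc)] n.
pose q n := nth (@hid 4, T) [:: (@hid 4, T); (@hid 4, T')] n.
have [Hn He] : valid_vtx (@hid 4, nuc) /\ valid_vtx (@hid 4, e).
  by split; split=> //; [exact: nuc_hypertree | case: ff].
have Hxn : valid_vtx (x, nuc) by split=> //; exact: nuc_hypertree.
have := @alternating_cycle (@hid 4, e) p q 2 isT.
rewrite !big_ord_recr big_ord0 /p /q /=.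
rewrite (ang_sym PM (chain_swap (C1 _ F cT))) (ang_sym PM (chain_swap (C0 _ F'))).
rewrite !A0 ?A1 // => H.
suff : 2 * PI <= 0 + (angE e T + angE e T) + (angE e T' + angE e T') by lra.
have nx : ~ rel_carried nuc (@hid 4) x by apply: (@not_rel_nuc _ i j k).
apply: H => //.
- case=> [|[|//]] _; split;
    [exact: C0 | exact: chain_swap (C1 _ _ _) | exact: C1 | exact: chain_swap (C0 _ _)].
- move=> n _; apply: finite_shapes_sym; apply: (finite_shapes_nuc PM) => //.
    by case: n => [|[|[|n]]].
  by case: n => [|[|[|n]]].
- by case=> [|[|//]] _; apply: (finite_shapes_top PM LM EQ).
- case=> [|[|//]] _ [_] //= /(rel_sym Hx); exact: nx.
- by case=> [|//] _ [].
- by case=> /esym.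
Qed.

Fixpoint iprod (g : nat -> hom 4) n : hom 4 := if n is n'.+1 then hcomp (iprod g n') (g n') else @hid 4.

(** The nuclear vertices marked by the partial products of a relation form a cycle round [T], closed
    because the whole product is inner. Between two consecutive ones lies an edge vertex with
    hypertree [es i], which contributes its angle twice. *)
Lemma tree_link T K (es : nat -> {set {set 'I_4}}) (s t r : nat -> 'I_4) w :
  (1 < K)%N -> (forall i, (i < K)%N -> full_flag (es i) T) ->
  (forall i, (i < K)%N -> uniq [:: s i; t i; r i]) ->
  (forall i, (i < K)%N -> carries (es i) (s i) [set t i] /\ carries T (s i) [set t i]) ->
  (forall i, (i.+1 < K)%N -> es i <> es i.+1) -> es K.-1 <> es 0%N ->
  heq (iprod (fun i => pc (s i) [set t i]) K) (inn w) ->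
  PI <= \big[Rplus/0]_(i < K) angT (es i) T.
Proof.
move=> K1 F U ca ne neK E; set g := fun i => _ in E.
have h1 := @is_hom1 4; have h := @is_aut0_1 4; have Hn := nuc_hypertree.
have st i : (i < K)%N -> s i \notin [set t i].
  by move=> /U; rewrite /= !inE negb_or => /andP[/andP[? _] _].
have Hg i : (i <= K)%N -> is_aut0 (iprod g i).
  elim: i => //= i IH iK; apply: is_aut0_comp; first exact/IH/ltnW.
  by apply: is_aut0_pc; apply: st.
have cg L i : (i < K)%N -> carries L (s i) [set t i] -> carried L (g i).
  move=> iK cL; apply: carried_pc => //; first exact: st.
  by apply/set0Pn; exists (t i); rewrite inE.
have rT i : (i <= K)%N -> rel_carried T (iprod g i) (@hid 4).
  move=> iK; apply: rel_sym => //; elim: i iK => [|i IH] iK; first exact: rel_refl.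
  apply: (rel_trans h (IH (ltnW iK))); apply: rel_comp; first exact/is_aut0_hom/Hg/ltnW.
  by apply: cg => //; case: (ca i iK).
have rK L : rel_carried L (iprod g K) (@hid 4).
  apply: rel_sym => //; apply/(rel_carriedE _ _ h1); exists (inn w); first exact: carried_inn.
  by apply: heq_trans E _; apply: heq_sym; apply: hcomp1f.
(* The full product is the identity only up to an inner automorphism, whereas [alternating_cycle]
   requires the last vertex to be the first one literally. *)
pose al i := if i == K then @hid 4 else iprod g i.
have alE i : (i < K)%N -> al i = iprod g i by move=> iK; rewrite /al ltn_eqF.
have Ha i : (i <= K)%N -> is_aut0 (al i) by rewrite /al; case: eqP => // _; apply: Hg.
have raT i : (i <= K)%N -> rel_carried T (al i) (@hid 4).
  by rewrite /al; case: eqP => [_ _|_]; [apply: rel_refl | apply: rT].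
have alK L i : (i <= K)%N -> rel_carried L (iprod g i) (al i).
  rewrite /al; case: eqP => [-> _|_ /Hg/is_aut0_hom]; [exact: rK | exact: rel_refl].
have re i : (i < K)%N -> rel_carried (es i) (al i) (al i.+1).
  move=> iK; rewrite (alE _ iK); apply: rel_trans (alK _ _ iK); first exact/Hg/ltnW.
  by apply: rel_comp; [exact/is_aut0_hom/Hg/ltnW | apply: cg => //; case: (ca i iK)].
have nn i : (i < K)%N -> ~ rel_carried nuc (al i) (al i.+1).
  move=> iK R; apply: (@not_rel_nuc (al i) (s i) (t i) (r i)) => //; try exact/Ha/ltnW;
    try by have := U i iK; rewrite /= !inE !negb_or andbT => /andP[/andP[]].
  apply: (rel_trans (Ha _ (ltnW iK)) R); rewrite (alE _ iK); apply: rel_sym; first exact: (Hg i.+1).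
  exact: alK.
have tri0 i : (i < K)%N -> triangle (es i) T (al i) (al i) (@hid 4).
  move=> iK; have iK' := ltnW iK; split; split=> //; try exact: Ha; try exact: raT.
  by apply: rel_refl; apply: is_aut0_hom; apply: Ha.
have tri1 i : (i < K)%N -> triangle (es i) T (al i.+1) (al i) (@hid 4).
  move=> iK; have iK' := ltnW iK; split; split=> //; try exact: Ha; try exact: raT.
  by apply: rel_sym; [apply: Ha | apply: re].
have C0 i (iK : (i < K)%N) : is_chain [:: (@hid 4, T); (al i, nuc); (al i, es i)].
  by have [f _ _] := F i iK; apply: chain_213; apply: chain_swap; apply: (triangle_chain f (tri0 i iK)).
have C1 i (iK : (i < K)%N) : is_chain [:: (@hid 4, T); (al i.+1, nuc); (al i, es i)].
  by have [f _ _] := F i iK; apply: chain_213; apply: chain_swap; apply: (triangle_chain f (tri1 i iK)).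
have HT : is_hypertree T by have [[]] := F 0%N (ltnW K1).
have := @alternating_cycle (@hid 4, T) (fun i => (al i, nuc)) (fun i => (al i, es i)) K (ltnW K1).
have -> : \big[Rplus/0]_(i < K) (angle G len (@hid 4, T) (al i, nuc) (al i, es i) +
      angle G len (@hid 4, T) (al i, es i) (al i.+1, nuc)) = 2 * \big[Rplus/0]_(i < K) angT (es i) T.
  have D (x : R) : 2 * x = x + x by ring.
  rewrite D big_split /=; congr Rplus; apply: eq_bigr => i _.
    by case: (triangle_ang (F i (ltn_ord i)) (tri0 i (ltn_ord i))).
  rewrite -(ang_sym PM (C1 i (ltn_ord i))).
  by case: (triangle_ang (F i (ltn_ord i)) (tri1 i (ltn_ord i))).
move=> H; suff : 2 * PI <= 2 * \big[Rplus/0]_(i < K) angT (es i) T by lra.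
apply: H.
- by move=> i iK; split; [apply: C0 | apply: chain_swap; apply: C1].
- move=> i iK; apply: finite_shapes_sym; apply: (finite_shapes_nuc PM) => //; split=> //; exact: Ha.
- move=> i iK; have [f c2 c3] := F i iK; apply: finite_shapes_sym; apply: (finite_shapes_top PM LM EQ) => //.
  exact/Ha/ltnW.
- by move=> i iK [_] /=; apply: nn.
- by move=> i iK [eq _]; exact: ne iK eq.
- by rewrite /= (alE 0%N (ltnW K1)) /al eqxx.
- by case=> /neK.
Qed.

End Cycles4.

(** * Relations for stars and paths, and the 8-cycle round a nuclear vertex *)

Section Contradiction.
Variables (G : geom 4) (len : vtx 4 -> vtx 4 -> R) (d : (vtx 4 -> R) -> (vtx 4 -> R) -> R).
Hypothesis PM : piecewise_metric (real G) len.
Hypothesis LM : is_length_metric (sd G len) d.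
Hypothesis EQ : equivariant d.
Hypothesis glue : cat_glue d.
Hypothesis uniq_geod : cat_unique d.
Implicit Types (c l m k p q r s : 'I_4) (e T : {set {set 'I_4}}).

Lemma uniq4E c l m k : uniq [:: c; l; m; k] =
  [&& c != l, c != m, c != k, l != m, l != k & m != k].
Proof. by rewrite /= !inE !negb_or !andbT -!andbA. Qed.

Lemma uniq4_neqs c l m k : uniq [:: c; l; m; k] ->
  [/\ c != l, c != m, c != k, l != m & l != k /\ m != k] /\
  [/\ l != c, m != c, k != c, m != l & k != l /\ k != m].
Proof.
rewrite uniq4E => /and5P[a1 a2 a3 a4 /andP[a5 a6]].
by rewrite (eq_sym l c) (eq_sym m c) (eq_sym k c) (eq_sym m l) (eq_sym k l) (eq_sym k m).
Qed.

Lemma full_flags4 c l m k : uniq [:: c; l; m; k] ->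
  [/\ full_flag (rk c l) (star c), full_flag (rk m k) (path4 c l m k) &
      full_flag (rk l c) (path4 c l m k)].
Proof.
move=> U; have [[cl cm ck lm [lk mk]] [lc mc kc ml [kl km]]] := uniq4_neqs U.
have U1 : uniq [:: m; k; c; l] by rewrite uniq4E; do ?(apply/andP; split).
have U2 : uniq [:: l; c; m; k] by rewrite uniq4E; do ?(apply/andP; split).
have [h1 h2 h3] := hypertrees4 U; have [h1' _ _] := hypertrees4 U1; have [h1'' _ _] := hypertrees4 U2.
have [f1 f2 f3 f4] := folds4 U; have [f1' _ _ _] := folds4 U1; have [f1'' _ _ _] := folds4 U2.
have [c1 c2 c3 c4] := cards4 U; have [_ c2' _ _] := cards4 U1; have [_ c2'' _ _] := cards4 U2.
have ne e T : #|e| = 2%N -> #|T| = 3%N -> [/\ nuc <> e, nuc <> T & e <> T].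
  by move=> e2 T3; split=> E; [move: e2 | move: T3 | move: T3]; rewrite -E ?c1 ?e2.
by split; split=> //; split=> //; apply: ne.
Qed.

Lemma mem4 c l m k x : uniq [:: c; l; m; k] -> x \in [:: c; l; m; k].
Proof.
move=> U; have := uniq_min_size U (s2 := enum 'I_4) (fun y _ => mem_enum _ y).
by rewrite size_enum_ord => /(_ isT)[_ ->]; rewrite mem_enum.
Qed.

(** The 6-cycle comes from the relation that conjugating [l], [m] and [k] in turn by [c] is
    inner. *)
Lemma star_link c l m k : uniq [:: c; l; m; k] ->
  PI <= angT G len (rk c l) (star c) + angT G len (rk c m) (star c) + angT G len (rk c k) (star c).
Proof.
move=> U; have [[cl cm ck lm [lk mk]] [lc mc kc ml [kl km]]] := uniq4_neqs U.
have U1 : uniq [:: c; m; k; l] by rewrite uniq4E; do ?(apply/andP; split).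
have U2 : uniq [:: c; k; l; m] by rewrite uniq4E; do ?(apply/andP; split).
have [F1 _ _] := full_flags4 U; have [F2 _ _] := full_flags4 U1; have [F3 _ _] := full_flags4 U2.
have [r1 s1 _ _] := carries4 U; have [r2 s2 _ _] := carries4 U1; have [r3 s3 _ _] := carries4 U2.
have [[n1 _ _ _] _] := neqs4 U; have [[n2 _ _ _] _] := neqs4 U1; have [[n3 _ _ _] _] := neqs4 U2.
have := @tree_link _ _ _ PM LM EQ glue uniq_geod (star c) 3 (fun i => rk c (nth l [:: l; m; k] i))
  (fun=> c) (fun i => nth l [:: l; m; k] i) (fun i => nth l [:: m; k; l] i) [:: c] isT.
rewrite !big_ord_recr big_ord0 /= Rplus_0_l; apply.
- by case=> [|[|[|]]].
- by case=> [|[|[|//]]] _ /=; rewrite !inE !negb_or ?cl ?cm ?ck ?lm ?mk ?kl.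
- by case=> [|[|[|]]].
- by case=> [|[|//]] _ /=; apply/eqP.
- exact/eqP.
have cD x : c != x -> c \notin [set x] by rewrite inE.
have h x : c != x -> is_hom (pc c [set x]) by move=> _; apply: is_hom_pc.
apply: heq_trans (hcomp_heql _ (hcomp_heql _ (hcomp1f _))) _.
apply: heq_trans (hcomp_heql _ (pc_comp _ _ _)) _; rewrite ?cD // ?disjoints1 ?inE //.
apply: heq_trans (pc_comp _ _ _) _; rewrite ?inE ?negb_or ?cl ?cm ?ck //.
  by rewrite disjoint_sym disjoints1 !inE negb_or kl km.
suff -> : [set l] :|: [set m] :|: [set k] = [set~ c] by apply: pc_full.
apply/setP=> x; rewrite !inE; have := mem4 x U; rewrite !inE.
case: (eqVneq x c) => [->|xc] /=; last by rewrite orbA => ->.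
by rewrite (negbTE cl) (negbTE cm) (negbTE ck).
Qed.

(** The two carried partial conjugations at the ends of the path commute. Their commutator gives an
    8-cycle in which either flag serves two of the four factors, whence only half of [PI]. *)
Lemma path_link p q r s : uniq [:: p; q; r; s] ->
  PI / 2 <= angT G len (rk r s) (path4 p q r s) + angT G len (rk q p) (path4 p q r s).
Proof.
move=> U; have [[pq pr ps qr [qs rs]] [qp rp sp rq [sq sr]]] := uniq4_neqs U.
have U1 : uniq [:: r; s; p; q] by rewrite uniq4E; do ?(apply/andP; split).
have U2 : uniq [:: q; p; r; s] by rewrite uniq4E; do ?(apply/andP; split).
have [_ F1 F2] := full_flags4 U; have [r1 _ _ _] := carries4 U1; have [r2 _ _ _] := carries4 U2.
have [_ _ p1 p2] := carries4 U; have [[_ _ n1 _] _] := neqs4 U1; have [[_ _ n2 _] _] := neqs4 U2.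
have := @tree_link _ _ _ PM LM EQ glue uniq_geod (path4 p q r s) 4
  (fun i => if odd i then rk q p else rk r s) (fun i => if odd i then q else r)
  (fun i => if odd i then p else s) (fun i => if odd i then r else p) [::] isT.
rewrite !big_ord_recr big_ord0 /= Rplus_0_l => H.
suff : PI <= angT G len (rk r s) (path4 p q r s) + angT G len (rk q p) (path4 p q r s) +
  angT G len (rk r s) (path4 p q r s) + angT G len (rk q p) (path4 p q r s) by lra.
have N : rk r s <> rk q p by apply/eqP; rewrite eq_sym.
apply: H.
- by move=> i _; case: odd.
- by move=> i _; case: odd; rewrite /= !inE !negb_or ?qp ?qr ?pr ?rs ?rp ?sp.
- by move=> i _; case: odd.
- by move=> i _ /=; case: odd => //= /esym.
- by move/esym.
set x := pc r [set s]; set y := pc q [set p].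
have hx : is_hom x by apply: is_hom_pc.
have hy : is_hom y by apply: is_hom_pc.
have h1 := @is_hom1 4.
have hxy : is_hom (hcomp x y).
  by apply: is_aut0_hom; apply: is_aut0_comp; apply: is_aut0_pc; rewrite inE.
have xx : heq (hcomp x x) (@hid 4) by apply: pc_invol; rewrite inE.
have yy : heq (hcomp y y) (@hid 4) by apply: pc_invol; rewrite inE.
have xy : heq (hcomp x y) (hcomp y x) by apply: pc_commute; rewrite ?disjoints1 ?inE.
apply: heq_trans (hcomp_heql _ (hcomp_heql _ (hcomp_heql _ (hcomp1f _)))) _.
apply: heq_trans (hcompA _ _ hxy) _; apply: heq_trans (hcomp_heqr hxy xy) _.
apply: heq_trans (hcompA _ _ hx) _.
apply: heq_trans (hcomp_heqr hx (heq_sym (hcompA _ _ hy))) _.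
apply: heq_trans (hcomp_heqr hx (hcomp_heql _ yy)) _.
by apply: heq_trans (hcomp_heqr hx (hcomp1f _)) _.
Qed.

(* The 8-cycle round the nuclear vertex involves 8 triangles, of total angle at most 8 pi: 2 pi are used at
   nuc, 4 pi at the edges e (edge_link) and pi at the trees P and Q (path_link). *)
Lemma stars_le c c' m k : uniq [:: c; c'; m; k] ->
  angT G len (rk c m) (star c) + angT G len (rk c k) (star c) +
  angT G len (rk c' m) (star c') + angT G len (rk c' k) (star c') <= PI.
Proof.
move=> U; have [[cd cm ck dm [dk mk]] [dc mc kc md' [kd km]]] := uniq4_neqs U.
have U1 : uniq [:: c; m; c'; k] by rewrite uniq4E; do ?(apply/andP; split).
have U2 : uniq [:: c; k; c'; m] by rewrite uniq4E; do ?(apply/andP; split).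
have U3 : uniq [:: c'; m; c; k] by rewrite uniq4E; do ?(apply/andP; split).
have U4 : uniq [:: c'; k; c; m] by rewrite uniq4E; do ?(apply/andP; split).
have UP : uniq [:: k; c; c'; m] by rewrite uniq4E; do ?(apply/andP; split).
have UQ : uniq [:: m; c; c'; k] by rewrite uniq4E; do ?(apply/andP; split).
set P := path4 k c c' m; set Q := path4 m c c' k.
have [F1 _ _] := full_flags4 U1; have [F2 _ _] := full_flags4 U2.
have [F3 _ _] := full_flags4 U3; have [F4 _ _] := full_flags4 U4.
have [_ F5 F6] := full_flags4 UP; have [_ F7 F8] := full_flags4 UQ; rewrite -/P -/Q in F5 F6 F7 F8.
have [r1 s1 _ _] := carries4 U1; have [r2 s2 _ _] := carries4 U2.
have [r3 s3 _ _] := carries4 U3; have [r4 s4 _ _] := carries4 U4.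
have [_ _ t5 t6] := carries4 UP; have [_ _ t7 t8] := carries4 UQ; rewrite -/P -/Q in t5 t6 t7 t8.
have [_ [x1 x2 x3 x4]] := neqs4 UP; have [_ [z1 z2 z3 z4]] := neqs4 UQ.
rewrite -/P -/Q in x1 x2 x3 x4 z1 z2 z3 z4.
have u3 a b g : a != b -> a != g -> b != g -> uniq [:: a; b; g].
  by move=> ab ag bg; rewrite /= !inE negb_or ab ag bg.
have link := edge_link PM LM EQ glue uniq_geod.
have R1 : PI <= angE G len (rk c m) (star c) + angE G len (rk c m) Q.
  by apply: (link _ _ _ c m k) => //; [apply/eqP | apply: u3].
have R2 : PI <= angE G len (rk c k) (star c) + angE G len (rk c k) P.
  by apply: (link _ _ _ c k m) => //; [apply/eqP | apply: u3].
have R3 : PI <= angE G len (rk c' m) (star c') + angE G len (rk c' m) P.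
  by apply: (link _ _ _ c' m k) => //; [apply/eqP | apply: u3].
have R4 : PI <= angE G len (rk c' k) (star c') + angE G len (rk c' k) Q.
  by apply: (link _ _ _ c' k m) => //; [apply/eqP | apply: u3].
have L1 := path_link UP; have L2 := path_link UQ; rewrite -/P -/Q in L1 L2.
have [_ _ _ A1] := triangle_angles PM F1; have [_ _ _ A2] := triangle_angles PM F2.
have [_ _ _ A3] := triangle_angles PM F3; have [_ _ _ A4] := triangle_angles PM F4.
have [_ _ _ A5] := triangle_angles PM F5; have [_ _ _ A6] := triangle_angles PM F6.
have [_ _ _ A7] := triangle_angles PM F7; have [_ _ _ A8] := triangle_angles PM F8.
(* In cyclic order the entries of [rs] and [ts] alternate; the default [rk c m] of [nth] at index 4
   closes the cycle. *)
pose rs := [:: rk c m; rk c k; rk c' m; rk c' k]; pose ts := [:: star c; P; star c'; Q].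
have C e T (F : full_flag e T) : is_chain [:: (@hid 4, nuc); (@hid 4, e); (@hid 4, T)].
  by case: F => f _ _; apply: base_chain.
have B e T (F : full_flag e T) :
    angle G len (@hid 4, nuc) (@hid 4, e) (@hid 4, T) = angN G len e T.
  by case: (triangle_ang PM LM EQ F (triangle_base _ _)).
have B' e T (F : full_flag e T) :
    angle G len (@hid 4, nuc) (@hid 4, T) (@hid 4, e) = angN G len e T.
  by rewrite -(ang_sym PM (C _ _ F)) B.
have h1 := @is_aut0_1 4.
have Hn : valid_vtx (@hid 4, nuc) by split=> //; exact: nuc_hypertree.
have fin e T (F : full_flag e T) : finite_shapes len (@hid 4, nuc) (@hid 4, e) /\
    finite_shapes len (@hid 4, nuc) (@hid 4, T).
  by case: F => -[He HT _ _ _] _ _; split; apply: (finite_shapes_nuc PM) => //; split.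
have := alternating_cycle PM LM glue uniq_geod (v := (@hid 4, nuc))
  (p := fun i => (@hid 4, nth (rk c m) rs i)) (q := fun i => (@hid 4, nth (rk c m) ts i)) (K := 4) isT.
rewrite !big_ord_recr big_ord0 /= Rplus_0_l.
rewrite (B _ _ F1) (B' _ _ F2) (B _ _ F6) (B' _ _ F5) (B _ _ F3) (B' _ _ F4) (B _ _ F7) (B' _ _ F8) => H.
suff : 2 * PI <= angN G len (rk c m) (star c) + angN G len (rk c k) (star c) +
   (angN G len (rk c k) P + angN G len (rk c' m) P) +
   (angN G len (rk c' m) (star c') + angN G len (rk c' k) (star c')) +
   (angN G len (rk c' k) Q + angN G len (rk c m) Q) by lra.
have V1 : uniq [:: c; m; k; c'] by rewrite uniq4E; do ?(apply/andP; split).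
have V2 : uniq [:: c'; m; k; c] by rewrite uniq4E; do ?(apply/andP; split).
have [[y1 _ _ _] _] := neqs4 V1.
have [[y2 _ y3 _] _] := neqs4 U2.
have [[_ _ y4 _] _] := neqs4 U4.
have [[y5 _ _ _] _] := neqs4 V2.
apply: H.
- case=> [|[|[|[|//]]]] _ /=; split; try exact: C; exact: chain_swap (C _ _ _).
- by case=> [|[|[|[|[|]]]]] //= _; [case: (fin _ _ F1) | case: (fin _ _ F2) | case: (fin _ _ F3)
    | case: (fin _ _ F4) | case: (fin _ _ F1)].
- by case=> [|[|[|[|]]]] //= _; [case: (fin _ _ F1) | case: (fin _ _ F5) | case: (fin _ _ F3)
    | case: (fin _ _ F7)].
- by case=> [|[|[|[|//]]]] _ [/= E _]; move: E; apply/eqP.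
- case=> [|[|[|//]]] _ [/= E _]; move: E; apply/eqP => //; by rewrite eq_sym.
- by [].
by case=> /= E _; move: E; apply/eqP; rewrite eq_sym.
Qed.

Lemma no_equivariant_metric : False.
Proof.
pose o0 : 'I_4 := @Ordinal 4 0 isT; pose o1 : 'I_4 := @Ordinal 4 1 isT.
pose o2 : 'I_4 := @Ordinal 4 2 isT; pose o3 : 'I_4 := @Ordinal 4 3 isT.
(* Over the three pairs, [rk c l] with [c], [l] among [o0], [o1], [o2] is counted once and [rk c o3]
   twice; the three surplus angles are positive, which makes the contradiction strict. *)
have N1 := @stars_le o0 o1 o2 o3 isT; have N2 := @stars_le o0 o2 o1 o3 isT.
have N3 := @stars_le o1 o2 o0 o3 isT.
have S0 := @star_link o0 o1 o2 o3 isT; have S1 := @star_link o1 o0 o2 o3 isT.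
have S2 := @star_link o2 o0 o1 o3 isT.
have [F0 _ _] := @full_flags4 o0 o3 o1 o2 isT; have [F1 _ _] := @full_flags4 o1 o3 o0 o2 isT.
have [F2 _ _] := @full_flags4 o2 o3 o0 o1 isT.
have [_ _ p0 _] := triangle_angles PM F0; have [_ _ p1 _] := triangle_angles PM F1.
have [_ _ p2 _] := triangle_angles PM F2; lra.
Qed.

End Contradiction.

Theorem theorem6p10 :
  ~ (exists (len : vtx 4 -> vtx 4 -> R) (d : (vtx 4 -> R) -> (vtx 4 -> R) -> R),
       [/\ piecewise_metric (@eucl_real 4) len, is_length_metric (sd_E len) d,
           equivariant d & CAT0 (@is_point 4) d]) /\
  ~ (exists (len : vtx 4 -> vtx 4 -> R) (d : (vtx 4 -> R) -> (vtx 4 -> R) -> R),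
       [/\ piecewise_metric (@hyp_real 4) len, is_length_metric (sd_H len) d,
           equivariant d & CATm1 (@is_point 4) d]).
Proof.
split=> -[len [d [PM LM EQ CAT]]].
  have [glue uniq_geod] := CAT0_glue PM LM CAT.
  exact: (@no_equivariant_metric (geomE 4) len d).
have [glue uniq_geod] := CATm1_glue PM LM CAT.
exact: (@no_equivariant_metric (geomH 4) len d).
Qed.
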